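(* Let $H$ be a real Hilbert space, $A:\mathcal D(A)\to H$ a positive self-adjoint operator with compact inverse, $V=\mathcal D(A^{1/2})$, $\mu$ an admissible memory kernel, and $k\in L^\infty_{loc}(0,+\infty)$ an on--off coefficient (of arbitrary sign) with switching times $(t_n)_{n\in\mathbb N}$, interval lengths $T_n=t_{n+1}-t_n$ and bounds $k_{2n+1}$. Consider $$u_{tt}(t)+Au(t)-\int_0^\infty\mu(s)Au(t-s)\,ds-k(t)u_t(t)=0,\quad t>0,\qquad u(t)=u_0(t),\quad t\le 0.\qquad (Q)$$ Assume that $T_{2n}>\frac1\alpha\ln C$ for all $n\in\mathbb N$, and put $c_n=Ce^{-\alpha T_{2n}}\in(0,1)$, where $C,\alpha$ are the decay constants of the problem with $k\equiv0$. If $$\sum_{n=0}^\infty\ln\left(e^{2k_{2n+1}T_{2n+1}}c_n\right)=-\infty,$$ then (Q) is asymptotically stable, i.e. every solution $u$ of (Q) satisfies $E_S(t)\to0$ as $t\to+\infty$.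
   Context: Admissible memory kernel: $\mu:[0,+\infty)\to[0,+\infty)$ with i) $\mu\in C^1(\mathbb R^+)\cap L^1(\mathbb R^+)$; ii) $\mu(0)=\mu_0>0$; iii) $\int_0^{+\infty}\mu(t)\,dt=\tilde\mu<1$; iv) $\mu'(t)\le-\delta\mu(t)$ for all $t$, for some $\delta>0$. On--off coefficient: there are times $0=t_0<t_1<t_2<\dots$ and numbers $k_{2n+1}>0$ such that, for all $n\in\mathbb N=\{0,1,2,\dots\}$, $k(t)=0$ for $t\in I_{2n}=[t_{2n},t_{2n+1})$ and $|k(t)|<k_{2n+1}$ for $t\in I_{2n+1}=[t_{2n+1},t_{2n+2})$. Write $T_n=t_{n+1}-t_n$. Phase space and solutions: with $\eta^t(s):=u(t)-u(t-s)$, $s>0$, let $\mathcal H=V\times H\times L^2_\mu((0,\infty);V)$, where $L^2_\mu((0,\infty);V)$ has squared norm $\int_0^\infty\mu(s)\|A^{1/2}w(s)\|_H^2ds$, and the squared norm of $\mathcal H$ is $(1-\tilde\mu)\|A^{1/2}u\|_H^2+\|v\|_H^2+\int_0^\infty\mu(s)\|A^{1/2}w(s)\|_H^2ds$. A solution of (Q) with initial datum $U_0\in\mathcal H$ is $U=(u,u_t,\eta)\in C([0,\infty);\mathcal H)$ with $U(0)=U_0=(u_0(0),\partial_tu_0(0),\eta_0)$, $\eta_0(s)=u_0(0)-u_0(-s)$, such that for a.e. $t>0$, with $f(t)=k(t)u_t(t)$, $$\langle u_{tt},\tilde v\rangle=-(1-\tilde\mu)\langle A^{1/2}u,A^{1/2}\tilde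 v\rangle_H-\int_0^\infty\mu(s)\langle A^{1/2}\eta(s),A^{1/2}\tilde v\rangle_Hds+\langle f,\tilde v\rangle_H,$$ $$\int_0^\infty\mu(s)\langle\eta_t(s)+\eta_s(s),A\tilde\eta(s)\rangle_Hds=\int_0^\infty\mu(s)\langle u_t,A\tilde\eta(s)\rangle_Hds$$ for all $\tilde v\in V$ and $\tilde\eta\in L^2_\mu(\mathbb R^+;\mathcal D(A))$. Standard energy: $E_S(t)=\frac12\|u_t(t)\|_H^2+\frac{1-\tilde\mu}2\|A^{1/2}u(t)\|_H^2+\frac12\int_0^\infty\mu(s)\|A^{1/2}\eta^t(s)\|_H^2ds$. Decay constants: it is a known result that for $k\equiv0$ the energy $E_S$ of every solution is non-increasing and there are constants $C>1$, $\alpha>0$, independent of the solution, with $E_S(t)\le Ce^{-\alpha t}E_S(0)$ for all $t\ge0$ and every solution. $C,\alpha$ denote such fixed constants. *)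

(* Defs.v *)
From HB Require Import structures.
From mathcomp Require Import all_boot all_order all_algebra.
From mathcomp Require Import all_classical all_reals all_analysis.

Set Implicit Arguments.
Unset Strict Implicit.
Unset Printing Implicit Defensive.

Import Order.TTheory GRing.Theory Num.Theory.
Import numFieldNormedType.Exports.

Local Open Scope classical_set_scope.
Local Open Scope ring_scope.

(* A real Hilbert space is a complete normed module [H] over [R : realType]
   together with a form [dot : {dot H for idfun}] (symmetric, bilinear and
   positive definite) that induces the norm. *)
Definition induces_norm (R : realType) (H : completeNormedModType R)
    (dot : {dot H for idfun}) : Prop :=
  forall x : H, `|x| ^+ 2 = dot x x.

(* Unbounded operators in H. The values of [app] outside [dom] are junk. *)
Record operator (R : realType) (H : completeNormedModType R) := Operator {
  dom : set H ;
  app :> H -> H }.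

Definition linear_operator (R : realType) (H : completeNormedModType R)
    (B : operator H) : Prop :=
  dom B 0 /\
  forall (a : R) (x y : H), dom B x -> dom B y ->
    dom B (a *: x + y) /\ B (a *: x + y) = a *: B x + B y.

(* The second conjunct says that B and its adjoint have the same graph. *)
Definition self_adjoint (R : realType) (H : completeNormedModType R)
    (dot : {dot H for idfun}) (B : operator H) : Prop :=
  closure (dom B) = [set: H] /\
  forall x y : H,
    (dom B x /\ B x = y) <-> (forall z, dom B z -> dot (B z) x = dot z y).

Definition positive_operator (R : realType) (H : completeNormedModType R)
    (dot : {dot H for idfun}) (B : operator H) : Prop :=
  forall x : H, dom B x -> x != 0 -> 0 < dot (B x) x.

Definition nonneg_operator (R : realType) (H : completeNormedModType R)
    (dot : {dot H for idfun}) (B : operator H) : Prop :=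
  forall x : H, dom B x -> 0 <= dot (B x) x.

Definition compact_inverse (R : realType) (H : completeNormedModType R)
    (B : operator H) : Prop :=
  exists G : H -> H,
    [/\ forall y, dom B (G y) /\ B (G y) = y,
        forall x, dom B x -> G (B x) = x &
        forall S : set H, bounded_set S -> compact (closure (G @` S))].

(* [B] is A^{1/2}: the (unique) nonnegative self-adjoint operator with
   B B = A, as an equality of unbounded operators. *)
Definition is_sqrt_operator (R : realType) (H : completeNormedModType R)
    (dot : {dot H for idfun}) (B A : operator H) : Prop :=
  [/\ linear_operator B, self_adjoint dot B, nonneg_operator dot B,
      dom A = [set x | dom B x /\ dom B (B x)] &
      forall x, dom A x -> A x = B (B x)].

Definition kernel_mass (R : realType) (mu : R -> R) : R :=
  \int[lebesgue_measure]_(s in `]0, +oo[) mu s.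

(* Only the restriction of [mu] to [0, +oo) matters. [mu] is C^1 on the open
   half-line and continuous up to 0, so that mu 0 is the limit at 0+. *)
Record admissible_kernel (R : realType) (mu : R -> R) : Prop := {
  kernel_ge0 : forall s : R, 0 <= s -> 0 <= mu s ;
  kernel_continuous : {within `[0, +oo[, continuous mu} ;
  kernel_derivable : forall s : R, 0 < s -> derivable mu s 1 ;
  kernel_C1 : {within `]0, +oo[, continuous (derive1 mu : R -> R)} ;
  kernel_L1 : lebesgue_measure.-integrable `]0, +oo[ (EFin \o mu) ;
  kernel_0 : 0 < mu 0 ;
  kernel_mass_lt1 : kernel_mass mu < 1 ;
  kernel_decay : exists2 delta : R, 0 < delta &
    forall s : R, 0 < s -> derive1 mu s <= - delta * mu s }.

Definition Linfty_loc (R : realType) (k : R -> R) : Prop :=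
  measurable_fun (`]0, +oo[%classic : set R) k /\
  forall a b : R, 0 < a -> a < b -> exists M : R,
    {ae lebesgue_measure, forall t : R, a <= t <= b -> `|k t| <= M}.

Record on_off (R : realType) (t_ kb : nat -> R) (k : R -> R) : Prop := {
  on_off_t0 : t_ 0%N = 0 ;
  on_off_incr : forall n, t_ n < t_ n.+1 ;
  on_off_bound_gt0 : forall n, 0 < kb n.*2.+1 ;
  on_off_even : forall (n : nat) (t : R),
    t_ n.*2 <= t < t_ n.*2.+1 -> k t = 0 ;
  on_off_odd : forall (n : nat) (t : R),
    t_ n.*2.+1 <= t < t_ n.*2.+2 -> `|k t| < kb n.*2.+1 }.

(* Almost everywhere on (0, +oo) for the measure mu(s) ds. *)
Definition mu_ae (R : realType) (mu : R -> R) (P : R -> Prop) : Prop :=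
  {ae lebesgue_measure, forall s : R, 0 < s -> 0 < mu s -> P s}.

Definition simple_function (R : realType) (H : completeNormedModType R)
    (g : R -> H) : Prop :=
  finite_set (range g) /\ forall y, measurable (g @^-1` [set y]).

Definition strongly_measurable (R : realType) (H : completeNormedModType R)
    (mu : R -> R) (f : R -> H) : Prop :=
  exists2 g : nat -> R -> H, (forall n, simple_function (g n)) &
    mu_ae mu (fun s => g n s @[n --> \oo] --> f s).

(* L^2_mu((0, +oo); D(B)) for B bijective from D(B) onto H, where D(B) has the
   norm |B x|; as B is then an isometry of D(B) onto H, strong measurability
   of w in D(B) is that of B \o w in H. It is used with B = A^{1/2} (giving V)
   and with B = A. Functions are not quotiented by a.e. equality. *)
Definition L2mu (R : realType) (H : completeNormedModType R)
    (mu : R -> R) (B : operator H) (w : R -> H) : Prop :=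
  [/\ mu_ae mu (fun s => dom B (w s)),
      strongly_measurable mu (fun s => B (w s)) &
      (\int[lebesgue_measure]_(s in `]0%R, +oo[)
         (mu s * `|B (w s)| ^+ 2)%:E < +oo)%E].

(* The phase space V x H x L^2_mu((0, +oo); V) and its squared norm; [Ah] is
   A^{1/2}. *)
Definition phase_space (R : realType) (H : completeNormedModType R)
    (Ah : operator H) (mu : R -> R) : set (H * H * (R -> H)) :=
  [set U | dom Ah U.1.1 /\ L2mu mu Ah U.2].

Definition phase_norm2 (R : realType) (H : completeNormedModType R)
    (Ah : operator H) (mu : R -> R) (U : H * H * (R -> H)) : R :=
  (1 - kernel_mass mu) * `|Ah U.1.1| ^+ 2 + `|U.1.2| ^+ 2 +
  \int[lebesgue_measure]_(s in `]0, +oo[) (mu s * `|Ah (U.2 s)| ^+ 2).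

(* eta^t(s) *)
Definition eta (R : realType) (H : completeNormedModType R)
    (u : R -> H) (t s : R) : H := u t - u (t - s).

(* [g'] is locally integrable on (0, +oo) and is the weak derivative of the
   continuous function [g] there. *)
Definition weak_derivative (R : realType) (g g' : R -> R) : Prop :=
  forall a b : R, 0 < a -> a < b ->
    lebesgue_measure.-integrable `[a, b] (EFin \o g') /\
    g b - g a = \int[lebesgue_measure]_(t in `[a, b]) g' t.

(* (u, v, eta u) is a solution of (Q) on [0, +oo) with past history u0 and
   initial datum (u0 0, u1, eta^0), where u1 is the velocity component of the
   datum, usually written d_t u0 (0); [u] is defined on the whole line.
   - The functional u_tt(t) on V is [utt t]; it is the derivative of u_t in
     the sense of V'-valued distributions.
   - eta is in general not differentiable in t and s separately, so
     eta_t + eta_s is the derivative of (t, s) |-> eta^t(s) in the direction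
     (1, 1). *)
Record solution (R : realType) (H : completeNormedModType R)
    (dot : {dot H for idfun}) (A Ah : operator H) (mu k : R -> R)
    (u0 : R -> H) (u1 : H) (u v : R -> H) : Prop := {
  solution_past : forall t : R, t <= 0 -> u t = u0 t ;
  solution_velocity0 : v 0 = u1 ;
  solution_phase : forall t : R, 0 <= t -> phase_space Ah mu (u t, v t, eta u t) ;
  solution_continuous : forall t : R, 0 <= t ->
    phase_norm2 Ah mu (u r - u t, v r - v t, fun s => eta u r s - eta u t s)
      @[r --> within `[0, +oo[ (nbhs t)] --> (0 : R) ;
  solution_ut : forall t : R, 0 < t -> is_derive t 1 u (v t) ;
  solution_wave : exists2 utt : R -> H -> R,
    (forall w, dom Ah w ->
       weak_derivative (fun t => dot (v t) w) (fun t => utt t w)) &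
    {ae lebesgue_measure, forall t : R, 0 < t -> forall w, dom Ah w ->
       utt t w =
         - (1 - kernel_mass mu) * dot (Ah (u t)) (Ah w)
         - \int[lebesgue_measure]_(s in `]0, +oo[)
             (mu s * dot (Ah (eta u t s)) (Ah w))
         + dot (k t *: v t) w} ;
  solution_memory :
    {ae lebesgue_measure, forall t : R, 0 < t -> forall z, L2mu mu A z ->
       \int[lebesgue_measure]_(s in `]0, +oo[)
         (mu s * dot ('D_(1, 1) (fun p : R * R => eta u p.1 p.2) (t, s))
                     (A (z s))) =
       \int[lebesgue_measure]_(s in `]0, +oo[) (mu s * dot (v t) (A (z s)))} }.

Definition energy (R : realType) (H : completeNormedModType R)
    (Ah : operator H) (mu : R -> R) (u v : R -> H) (t : R) : R :=
  2^-1 * `|v t| ^+ 2 + (1 - kernel_mass mu) / 2 * `|Ah (u t)| ^+ 2 +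
  2^-1 * \int[lebesgue_measure]_(s in `]0, +oo[)
           (mu s * `|Ah (eta u t s)| ^+ 2).

Definition decay_constants (R : realType) (H : completeNormedModType R)
    (dot : {dot H for idfun}) (A Ah : operator H) (mu : R -> R)
    (C alpha : R) : Prop :=
  [/\ 1 < C, 0 < alpha &
      forall (u0 : R -> H) (u1 : H) (u v : R -> H),
        solution dot A Ah mu (fun=> 0) u0 u1 u v ->
        forall t : R, 0 <= t ->
          energy Ah mu u v t <= C * expR (- alpha * t) * energy Ah mu u v 0].

Definition asymptotically_stable (R : realType) (H : completeNormedModType R)
    (dot : {dot H for idfun}) (A Ah : operator H) (mu k : R -> R) : Prop :=
  forall (u0 : R -> H) (u1 : H) (u v : R -> H),
    solution dot A Ah mu k u0 u1 u v ->
    energy Ah mu u v t @[t --> +oo] --> (0 : R).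

(* Main.v *)
(** Projecting on an eigenbasis [(e_j)] of [A] decouples the equation: the
    coordinate [f = <u, e_j>] solves a scalar delay equation with its own energy,
    and by Parseval and monotone convergence the energy of [u] is the sum of the
    energies of its modes, so that it is enough to estimate the modes.

    Where [|k| <= K], the energy of a mode satisfies [E' <= 2 K E] in the sense of
    upper right Dini derivatives, hence grows at most by [exp (2 K (t - a))].

    On an interval where [k = 0], the decay constants do not apply directly, since
    they concern solutions on the whole half line with [k = 0]. But the state of
    the mode at the beginning of the interval is the initial datum of a global
    solution of the scalar equation with [k = 0] (a fixed point of a Volterra
    operator contracting in a weighted norm), which agrees with the mode on the
    interval; its multiple by [e_j] is a solution for [k = 0], to which the decay
    estimate applies.

    The product of these factors over the successive intervals is the exponential
    of the partial sums of the series, which tend to [-oo]. *)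
Require Import Defs.
From mathcomp Require Import all_boot all_order all_algebra.
From mathcomp Require Import all_classical all_reals all_analysis.
From mathcomp Require Import measurable_realfun ring lra.

Set Implicit Arguments.
Unset Strict Implicit.
Unset Printing Implicit Defensive.

Import Order.TTheory GRing.Theory Num.Theory.
Import numFieldNormedType.Exports.

Local Open Scope classical_set_scope.
Local Open Scope ring_scope.

(** * Spectral decomposition *)

(** In [H] the unbounded operator [A] rules out a direct Picard iteration; along an eigenvector it
    is multiplication by [lam], and the restart at a time [a] becomes elementary. The past is split
    into a path frozen at [f a], which is Lipschitz up to any finite time, and a remainder [p] that
    vanishes for [t >= 0] and is merely square integrable with continuous translates. The unknown is
    the acceleration: two integrations gain [1 / beta^2] in the norm [sup e^(- beta t) |y t|], the
    delay term costs [2 lam], and [beta = 2 sqrt lam] gives the factor 1/2.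

    Three weaknesses of the data shape the rest. The past of a mode is known only through [eta],
    outside null sets of the kernel, so it is replaced by a measurable representative. The memory
    energy need not be differentiable; its increments are bounded by translating the delay variable,
    which costs little because the kernel is nonincreasing, but this bound is one-sided. The
    acceleration of a mode is only a weak derivative on [(0, +oo)].

    The eigenbasis may be padded with zero vectors, which treats all dimensions alike. *)

Section hilbert.
Context (R : realType) (H : completeNormedModType R) (dot : {dot H for idfun}).
Hypothesis hdot : induces_norm dot.
Implicit Types (x y z : H) (a : R).

Lemma dotC x y : dot x y = dot y x.
Proof. by rewrite hermC /= expr0 mul1r. Qed.

Lemma dotZl a x y : dot (a *: x) y = a * dot x y.
Proof. by rewrite linearZl_LR. Qed.

Lemma dotZr a x y : dot x (a *: y) = a * dot x y.
Proof. by rewrite dotC dotZl dotC. Qed.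

Lemma dot0l x : dot 0 x = 0.
Proof. by rewrite linear0l. Qed.

Lemma dot0r x : dot x 0 = 0.
Proof. by rewrite linear0r. Qed.

Lemma dotBl x y z : dot (x - y) z = dot x z - dot y z.
Proof. by rewrite linearBl. Qed.

Lemma dotBr x y z : dot z (x - y) = dot z x - dot z y.
Proof. by rewrite linearBr. Qed.

Lemma normB2 x y : `|x - y| ^+ 2 = `|x| ^+ 2 - 2 * dot x y + `|y| ^+ 2.
Proof. by rewrite !hdot dotBl !dotBr (dotC y x); ring. Qed.

Lemma dot_sqr_le x e : `|e| = 1 -> dot x e ^+ 2 <= `|x| ^+ 2.
Proof.
move=> e1; have := sqr_ge0 `|x - dot x e *: e|.
by rewrite normB2 dotZr normrZ e1 mulr1 real_normK ?num_real//; nra.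
Qed.

Lemma dot_le x y : `|dot x y| <= `|x| * `|y|.
Proof.
have [->|y0] := eqVneq y 0; first by rewrite dot0r !normr0 mulr0.
have y1 : 0 < `|y| by rewrite normr_gt0.
have := @dot_sqr_le x (`|y|^-1 *: y).
rewrite normrZ gtr0_norm ?invr_gt0// mulVf ?gt_eqF// => /(_ erefl).
rewrite dotZr exprMn exprVn mulrC ler_pdivrMr ?exprn_gt0// -exprMn => h.
by rewrite -(@ler_pXn2r _ 2)// ?nnegrE ?mulr_ge0// real_normK ?num_real.
Qed.

Lemma dot_continuousl y : continuous (fun x => dot x y).
Proof.
move=> x; apply/cvgrPdist_lt => e e0.
have y1 : 0 < `|y| + 1 by rewrite ltr_wpDl.
near=> z; rewrite -dotBl (le_lt_trans (dot_le _ _))//.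
rewrite (@le_lt_trans _ _ (`|x - z| * (`|y| + 1)))//.
  by rewrite ler_wpM2l// lerDl.
rewrite -ltr_pdivlMr//; near: z.
by apply: cvgr_dist_lt => //; rewrite divr_gt0.
Unshelve. all: by end_near. Qed.

Lemma closed_dot_eq0 y : closed [set x | dot x y = 0].
Proof.
exact: ((continuous_closedP _).1 (@dot_continuousl y) _ (closed_eq (y := 0))).
Qed.

End hilbert.

Section spectral.
Context (R : realType) (H : completeNormedModType R) (dot : {dot H for idfun}).
Hypothesis hdot : induces_norm dot.
Variables (A Ah : operator H).
Hypotheses (hAlin : linear_operator A) (hAsa : self_adjoint dot A).
Hypotheses (hApos : positive_operator dot A) (hAinv : compact_inverse A).
Hypothesis hAh : is_sqrt_operator dot Ah A.
Implicit Types (x y z e : H) (a : R).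

Lemma operator0 (B : operator H) : linear_operator B -> B 0 = 0.
Proof.
move=> [d0 /(_ (-1) 0 0 d0 d0)[_]].
by rewrite scaler0 add0r scaleN1r addNr.
Qed.

Lemma operatorP (B : operator H) (a : R) x y : linear_operator B ->
  dom B x -> dom B y -> dom B (a *: x + y) /\ B (a *: x + y) = a *: B x + B y.
Proof. by move=> [_ h]; apply: h. Qed.

Lemma operatorZ (B : operator H) (a : R) x : linear_operator B ->
  dom B x -> dom B (a *: x) /\ B (a *: x) = a *: B x.
Proof.
move=> Bl Bx; have := operatorP a Bl Bx Bl.1.
by rewrite operator0// !addr0.
Qed.

Lemma operatorB (B : operator H) x y : linear_operator B ->
  dom B x -> dom B y -> dom B (x - y) /\ B (x - y) = B x - B y.
Proof.
move=> Bl Bx By; have := operatorP (-1) Bl By Bx.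
by rewrite !scaleN1r ![- _ + _]addrC.
Qed.

Lemma self_adjoint_sym (B : operator H) x y : self_adjoint dot B ->
  dom B x -> dom B y -> dot (B x) y = dot x (B y).
Proof.
by move=> [_ /(_ y (B y))[+ _]] Bx By => /(_ (conj By erefl)) /(_ _ Bx).
Qed.

(** The vector [z = Ah e - sqrt l e] satisfies [Ah z = - sqrt l z], and nonnegativity of [Ah] then
    forces [z = 0]. *)
Lemma sqrt_eigenvector e (l : R) : 0 < l -> dom A e -> A e = l *: e ->
  dom Ah e /\ Ah e = Num.sqrt l *: e.
Proof.
case: hAh => Bl Bs Bp dA AB l0 de Ae; have := de; rewrite dA => -[/= de1 de2].
split=> //; pose z := Ah e - Num.sqrt l *: e.
have [dle Ahl] := operatorZ (Num.sqrt l) Bl de1.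
have [dz Ahz] := operatorB Bl de2 dle.
have sl : Num.sqrt l ^+ 2 = l by rewrite sqr_sqrtr// ltW.
have Ez : Ah z = - Num.sqrt l *: z.
  rewrite Ahz -(AB _ de) Ae Ahl /z scalerBr scalerA.
  by rewrite -{1}sl expr2 !scaleNr mulNr scaleNr opprK addrC.
have := Bp _ dz; rewrite Ez dotZl -hdot => h.
have : `|z| ^+ 2 <= 0.
  have sl0 : 0 < Num.sqrt l by rewrite sqrtr_gt0.
  by rewrite -(ler_pM2l sl0) mulr0; nra.
move=> h2.
have : `|z| ^+ 2 == 0 by rewrite eq_le h2 sqr_ge0.
by rewrite sqrf_eq0 normr_eq0 /z subr_eq0 => /eqP.
Qed.

(** Symmetry, positivity and linearity pass from [A] to its inverse; boundedness, hence continuity,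
    comes from the compact closure of the image of the unit ball. *)
Lemma inverse_spec : exists G : H -> H,
  [/\ forall y, dom A (G y) /\ A (G y) = y,
      forall x, dom A x -> G (A x) = x,
      forall (a : R) x y, G (a *: x + y) = a *: G x + G y,
      forall x y, dot (G x) y = dot x (G y) &
      [/\ forall x, 0 <= dot (G x) x,
      continuous G &
      compact (closure (G @` [set x | `|x| <= 1]))]].
Proof.
case: hAinv => G [G1 G2 G3]; exists G.
have Gl (a : R) x y : G (a *: x + y) = a *: G x + G y.
  have [dx Ax] := G1 x; have [dy Ay] := G1 y.
  have [d E] := operatorP a hAlin dx dy.
  by rewrite -[RHS]G2// E Ax Ay.
have G0 : G 0 = 0 by have := Gl (-1) 0 0; rewrite scaler0 add0r scaleN1r addNr.
have cK : compact (closure (G @` [set x | `|x| <= 1])).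
  apply: G3; exists 1; split=> // M M1 x /= x1.
  by rewrite (le_trans x1)// ltW.
split=> //.
  move=> x y; have [dx Ax] := G1 x; have [dy Ay] := G1 y.
  by rewrite -{1}Ay -self_adjoint_sym// Ax.
split=> //.
  move=> x; have [dx Ax] := G1 x; rewrite -{2}Ax dotC.
  have [->|x0] := eqVneq (G x) 0; first by rewrite dot0r.
  by rewrite ltW// hApos.
have [M0 [_ /(_ (M0 + 1)) hM]] := compact_bounded cK.
have {}hM := hM (ltr_pwDr ltr01 (lexx M0)); set M := M0 + 1 in hM.
have GM x : `|G x| <= M * `|x|.
  have [->|x0] := eqVneq x 0; first by rewrite G0 !normr0 mulr0.
  have nx : 0 < `|x| by rewrite normr_gt0.
  have Gs : G (`|x|^-1 *: x) = `|x|^-1 *: G x.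
    by have := Gl (`|x|^-1) x 0; rewrite G0 !addr0.
  have : `|G (`|x|^-1 *: x)| <= M.
    apply: hM; apply: subset_closure; exists (`|x|^-1 *: x) => //=.
    by rewrite normrZ gtr0_norm ?invr_gt0// mulVf// gt_eqF.
  by rewrite Gs normrZ gtr0_norm ?invr_gt0// mulrC ler_pdivrMr.
move=> x; apply/cvgrPdist_lt => e e0.
have M1 : 0 < `|M| + 1 by rewrite ltr_wpDl.
near=> z.
have -> : G x - G z = G (x - z).
  have := Gl (-1) z x; rewrite !scaleN1r ![- _ + _]addrC => ->.
  by [].
rewrite (le_lt_trans (GM _))//.
rewrite (@le_lt_trans _ _ ((`|M| + 1) * `|x - z|))//.
  by rewrite ler_wpM2r// (le_trans (ler_norm _))// lerDl.
rewrite mulrC -ltr_pdivlMr//; near: z.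
by apply: cvgr_dist_lt => //; rewrite divr_gt0.
Unshelve. all: by end_near. Qed.

End spectral.

(** * Eigenvectors of an injective compact positive operator, and Parseval's identity *)

Section compact_positive.
Context (R : realType) (H : completeNormedModType R) (dot : {dot H for idfun}).
Hypothesis hdot : induces_norm dot.
Variable G : H -> H.
Hypothesis Glin : forall (a : R) x y, G (a *: x + y) = a *: G x + G y.
Hypothesis Gsym : forall x y, dot (G x) y = dot x (G y).
Hypothesis Gpos : forall x, 0 <= dot (G x) x.
Hypothesis Gcont : continuous G.
Hypothesis Gcpt : compact (closure (G @` [set x | `|x| <= 1])).
Hypothesis Ginj : forall x, G x = 0 -> x = 0.
Implicit Types (x y z e : H) (s : seq H).

Let G0 : G 0 = 0.
Proof. by have := Glin (-1) 0 0; rewrite scaler0 add0r scaleN1r addNr. Qed.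

Let GZ (a : R) x : G (a *: x) = a *: G x.
Proof. by have := Glin a x 0; rewrite G0 !addr0. Qed.

Let GB x y : G (x - y) = G x - G y.
Proof. by have := Glin (-1) y x; rewrite !scaleN1r ![- _ + _]addrC. Qed.

Definition orthogonal_to s := [set x | forall y, y \in s -> dot x y = 0].

Lemma closed_orthogonal_to s : closed (orthogonal_to s).
Proof.
have -> : orthogonal_to s = \bigcap_(y in [set` s]) [set x | dot x y = 0].
  by rewrite predeqE => x; split=> h y; exact: h.
by apply: closed_bigI => y _; exact: closed_dot_eq0.
Qed.

(* [y] maximizes the norm on the compact closure of the image of the unit ball
   of the orthogonal of [s]. The bound [|z|^2 <= |G z|] on this set gives
   [G (G y) = m^2 y] for [m = |y|], hence [G y = m y] by positivity. *)
Lemma max_eigenvector s :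
  (forall e, e \in s -> exists m : R, G e = m *: e) ->
  exists em : H * R,
    [/\ 0 < em.2, G em.1 = em.2 *: em.1, orthogonal_to s em.1,
        em.1 = 0 \/ `|em.1| = 1 &
        forall x, orthogonal_to s x ->
          `|G x| <= em.2 * `|x| /\ (em.1 = 0 -> x = 0)].
Proof.
move=> hs.
have GM x : orthogonal_to s x -> orthogonal_to s (G x).
  move=> ox y ys; have [m Gy] := hs _ ys.
  by rewrite Gsym Gy dotZr ox// mulr0.
have [triv|] := pselect (forall x, orthogonal_to s x -> x = 0).
  (* When only 0 is orthogonal to [s], the vector 0 with the arbitrary positive value 1 keeps the
     construction going; this is the source of the alternative [em.1 = 0]. *)
  exists (0, 1); split=> //=.
  - by rewrite G0 scaler0.
  - by move=> y _; rewrite dot0l.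
  - by left.
  - by move=> x ox; split=> [|_]; [rewrite (triv _ ox) G0 normr0 mulr0|exact: triv].
move=> /existsNP[x0 /not_implyP[ox0 /eqP nx0]].
pose B := [set x | `|x| <= 1 /\ orthogonal_to s x].
pose K := closure (G @` B).
have KM : K `<=` orthogonal_to s.
  rewrite [X in _ `<=` X](closure_id _).1; last exact: closed_orthogonal_to.
  by apply: closure_subset => _ [x [_ ox] <-]; exact: GM.
have cK : compact K.
  apply: (subclosed_compact _ Gcpt); first exact: closed_closure.
  by apply: closure_subset => _ [x [x1 _] <-]; exists x.
have K0 : K !=set0.
  exists (G 0); apply: subset_closure; exists 0 => //; split; first by rewrite normr0.
  by move=> y _; rewrite dot0l.
have [y] := compact_EVT_max K0 cK (continuous_subspaceT (@norm_continuous _ H)).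
rewrite inE => Ky ymax; pose m := `|y|.
have Bm x : B x -> `|G x| <= m.
  by move=> Bx; apply: ymax; rewrite inE; apply: subset_closure; exists x.
have Gm x : orthogonal_to s x -> `|G x| <= m * `|x|.
  move=> ox; have [->|nx] := eqVneq x 0; first by rewrite G0 !normr0 mulr0.
  have xp : 0 < `|x| by rewrite normr_gt0.
  have := Bm (`|x|^-1 *: x); rewrite GZ normrZ gtr0_norm ?invr_gt0//.
  rewrite mulrC ler_pdivrMr//; apply; split.
    by rewrite normrZ gtr0_norm ?invr_gt0// mulVf// gt_eqF.
  by move=> z zs; rewrite dotZl ox// mulr0.
have m0 : 0 < m.
  rewrite lt_neqAle normr_ge0 andbT eq_sym; apply/eqP => m0.
  have := Gm _ ox0; rewrite m0 mul0r normr_le0 => /eqP/Ginj x00.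
  by rewrite x00 eqxx in nx0.
(* For [z = G x] with [|x| <= 1], symmetry gives [|z|^2 = <x, G z> <= |G z|], and the inequality
   passes to the closure. *)
have y2 : m ^+ 2 <= `|G y|.
  have cl : closed [set z : H | `|z| ^+ 2 - `|G z| <= 0].
    have cf : continuous (fun z : H => `|z| ^+ 2 - `|G z|).
      move=> z; apply: cvgB; last by apply: cvg_norm; exact: Gcont.
      apply: cvgM; exact: norm_continuous.
    exact: ((continuous_closedP _).1 cf _ (closed_le (y := 0))).
  have sub : G @` B `<=` [set z : H | `|z| ^+ 2 - `|G z| <= 0].
    move=> _ [x [x1 _] <-] /=; rewrite subr_le0 hdot Gsym.
    rewrite (le_trans (ler_norm _))// (le_trans (dot_le hdot _ _))//.
    by rewrite ler_piMl.
  have := closure_subset sub Ky; rewrite -(closure_id _).1//.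
  by rewrite /= subr_le0.
have yM := KM _ Ky.
have GGy : G (G y) = m ^+ 2 *: y.
  have h1 : `|G (G y)| <= m * `|G y| by apply: Gm; exact: GM.
  have h2 : `|G y| <= m ^+ 2 by rewrite expr2; exact: Gm.
  have h3 : `|G y| = m ^+ 2 by apply/eqP; rewrite eq_le h2.
  (* Since [|y| = m], [|G y| = m^2] and [|G (G y)| <= m^3], expanding the square gives [|G (G y) -
     m^2 y|^2 <= m^6 - 2 m^6 + m^6 = 0]. *)
  apply/eqP; rewrite -subr_eq0 -normr_eq0 -sqrf_eq0 eq_le sqr_ge0 andbT.
  rewrite (normB2 hdot) dotZr Gsym -hdot normrZ !h3 -/m.
  rewrite ger0_norm ?sqr_ge0//.
  have h4 : `|G (G y)| ^+ 2 <= (m * m ^+ 2) ^+ 2.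
    rewrite h3 in h1; have mm : 0 <= m * m ^+ 2 by exact: le_trans h1.
    by rewrite ler_sqr ?nnegrE.
  by lra.
have Gy : G y = m *: y.
  pose z := G y - m *: y.
  have Gz : G z = - m *: z.
    by rewrite /z GB GZ GGy scalerBr scalerA expr2 !mulNr !scaleNr opprK addrC.
  have := Gpos z; rewrite Gz dotZl -hdot => h.
  have : `|z| ^+ 2 <= 0 by have := sqr_ge0 `|z|; nra.
  move=> h2; have : `|z| ^+ 2 == 0 by rewrite eq_le h2 sqr_ge0.
  by rewrite sqrf_eq0 normr_eq0 /z subr_eq0 => /eqP.
have e1 : `|m^-1 *: y| = 1 by rewrite normrZ gtr0_norm ?invr_gt0// mulVf// gt_eqF.
exists (m^-1 *: y, m); split=> //=.
- by rewrite GZ Gy !scalerA mulrC.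
- by move=> z zs; rewrite dotZl yM// mulr0.
- by right.
- move=> x ox; split; first exact: Gm.
  by move=> e0; move: e1; rewrite e0 normr0 => /eqP; rewrite eq_sym oner_eq0.
Qed.

(** What is left of [x] once its first [n] components are removed. Projecting the previous remainder
    instead of [x] makes Bessel's identity and the commutation with [G] plain inductions. *)
Fixpoint residual (e_ : nat -> H) (n : nat) (x : H) : H :=
  if n is m.+1 then residual e_ m x - dot (residual e_ m x) (e_ m) *: e_ m else x.

Lemma eigen_sequence : exists (e_ : nat -> H) (m_ : nat -> R),
  [/\ forall n, 0 < m_ n, forall n, G (e_ n) = m_ n *: e_ n,
      forall n, e_ n = 0 \/ `|e_ n| = 1,
      forall i j, i != j -> dot (e_ i) (e_ j) = 0 &
      forall n x, (forall i, (i < n)%N -> dot x (e_ i) = 0) ->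
        `|G x| <= m_ n * `|x| /\ (e_ n = 0 -> x = 0)].
Proof.
pose ok s := forall e, e \in s -> exists m : R, G e = m *: e.
have /choice[F HF] : forall s, exists em : H * R, ok s ->
    [/\ 0 < em.2, G em.1 = em.2 *: em.1, orthogonal_to s em.1,
        em.1 = 0 \/ `|em.1| = 1 &
        forall x, orthogonal_to s x ->
          `|G x| <= em.2 * `|x| /\ (em.1 = 0 -> x = 0)].
  move=> s; have [/max_eigenvector[em Hem]|nos] := pselect (ok s).
    by exists em.
  by exists (0, 0).
pose S := fix S n := if n is m.+1 then (F (S m)).1 :: S m else [::].
have Sok n : ok (S n).
  elim: n => [//|n IH] e; have -> : S n.+1 = (F (S n)).1 :: S n by [].
  rewrite in_cons => /predU1P[->|]; last exact: IH.
  by exists (F (S n)).2; have [] := HF _ IH.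
have Smem n e : e \in S n <-> exists2 i, (i < n)%N & e = (F (S i)).1.
  elim: n => [|n IH]; first by split=> // -[].
  have -> : S n.+1 = (F (S n)).1 :: S n by [].
  rewrite in_cons; split.
    move=> /predU1P[->|/IH[i ilt ->]]; first by exists n.
    by exists i => //; exact: ltnW.
  move=> [i + Ee]; rewrite ltnS leq_eqVlt => /predU1P[Ei|ilt].
    by rewrite Ee Ei eqxx.
  by apply/orP; right; apply/IH; exists i.
have E n : orthogonal_to (S n) = [set x | forall i, (i < n)%N -> dot x (F (S i)).1 = 0].
  rewrite predeqE => x; split=> h /=.
    by move=> i ilt; apply: h; apply/Smem; exists i.
  by move=> y /Smem[i ilt ->]; exact: h.
exists (fun n => (F (S n)).1), (fun n => (F (S n)).2); split.
- by move=> n; have [] := HF _ (Sok n).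
- by move=> n; have [] := HF _ (Sok n).
- by move=> n; have [] := HF _ (Sok n).
- move=> i j; rewrite neq_ltn => /orP[ij|ji].
    by rewrite dotC; have [_ _ + _ _] := HF _ (Sok j); rewrite E; exact.
  by have [_ _ + _ _] := HF _ (Sok i); rewrite E; exact.
- move=> n x hx; have [_ _ _ _] := HF _ (Sok n); apply.
  by rewrite E.
Qed.

Section complete.
Variables (e_ : nat -> H) (m_ : nat -> R).
Hypothesis m_gt0 : forall n, 0 < m_ n.
Hypothesis Ge : forall n, G (e_ n) = m_ n *: e_ n.
Hypothesis e01 : forall n, e_ n = 0 \/ `|e_ n| = 1.
Hypothesis eort : forall i j, i != j -> dot (e_ i) (e_ j) = 0.
Hypothesis em : forall n x, (forall i, (i < n)%N -> dot x (e_ i) = 0) ->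
        `|G x| <= m_ n * `|x| /\ (e_ n = 0 -> x = 0).

(** Treats the unit vectors and the zero vectors of the family at once. *)
Let ee n (x : H) : dot x (e_ n) * dot (e_ n) (e_ n) = dot x (e_ n).
Proof.
by rewrite -hdot; have [->|->] := e01 n; rewrite ?dot0r ?mul0r// expr1n mulr1.
Qed.

Lemma dot_residual n x i :
  dot (residual e_ n x) (e_ i) = if (i < n)%N then 0 else dot x (e_ i).
Proof.
elim: n => [//|n IH] /=; rewrite dotBl dotZl; have [<-|ni] := eqVneq n i.
  by rewrite ltnS leqnn ee subrr.
by rewrite eort// mulr0 subr0 IH ltnS [in RHS]leq_eqVlt eq_sym (negbTE ni).
Qed.

Lemma norm_residual n x :
  `|residual e_ n x| ^+ 2 = `|x| ^+ 2 - series (fun j => dot x (e_ j) ^+ 2) n.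
Proof.
elim: n => [|n IH] /=; first by rewrite /series/= big_geq// subr0.
rewrite seriesSr (normB2 hdot) IH dotZr dot_residual ltnn normrZ exprMn.
have dd : dot x (e_ n) ^+ 2 * `|e_ n| ^+ 2 = dot x (e_ n) ^+ 2.
  by rewrite hdot expr2 -mulrA ee.
by rewrite real_normK ?num_real// dd; ring.
Qed.

Lemma norm_residual_le n x : `|residual e_ n x| <= `|x|.
Proof.
rewrite -(@ler_pXn2r _ 2)// ?nnegrE// norm_residual gerBl.
by rewrite /series/= sumr_ge0// => i _; exact: sqr_ge0.
Qed.

Lemma residualB n x y : residual e_ n (x - y) = residual e_ n x - residual e_ n y.
Proof.
elim: n => [//|n IH] /=; rewrite IH dotBl scalerBl.
by rewrite !opprB addrACA [RHS]addrACA; congr (_ + _); rewrite addrC.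
Qed.

Lemma residualG n x : residual e_ n (G x) = G (residual e_ n x).
Proof.
by elim: n => [//|n IH] /=; rewrite IH GB GZ Ge Gsym Ge dotZr !scalerA mulrC.
Qed.

(** Otherwise the sequence [G e_n = m_n e_n] has a cluster point [y] by compactness. It is
    orthogonal to every [e_j], yet lies within [eps] of some [G e_n], whose component along [e_n] is
    [m_n >= eps]. *)
Lemma eigenvalue_small (eps : R) : 0 < eps ->
  exists n, m_ n < eps \/ e_ n = 0.
Proof.
move=> eps0; apply: contrapT => /forallNP h.
have me n : eps <= m_ n by rewrite leNgt; apply/negP => ?; apply: (h n); left.
have e1 n : `|e_ n| = 1 by have [e0|//] := e01 n; exfalso; apply: (h n); right.
have FK : ((G \o e_) @ \oo) (closure (G @` [set x | `|x| <= 1])).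
  by exists 0%N => // n _; apply: subset_closure; exists (e_ n) => //=; rewrite e1.
have [y [_ cy]] := Gcpt (F := (G \o e_) @ \oo) _ FK.
have ye j : dot y (e_ j) = 0.
  suff: closure [set z | dot z (e_ j) = 0] y.
    by rewrite -(closure_id _).1//; exact: closed_dot_eq0.
  move=> U /cy; apply.
  by exists j.+1 => // n jn; rewrite /= Ge dotZl eort ?mulr0// gtn_eqF.
have [z [[n zn] zy]] : [set z | exists n, z = G (e_ n)] `&` ball y eps !=set0.
  apply: cy; last exact: nbhsx_ballx.
  by exists 0%N => // n _; exists n.
move: zy; rewrite -ball_normE /= => zy.
have := dot_le hdot (y - z) (e_ n).
rewrite e1 mulr1 dotBl ye zn Ge dotZl -hdot e1 expr1n mulr1 sub0r normrN.
rewrite -(Ge n) -zn gtr0_norm// => h2.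
by have := le_lt_trans (le_trans (me n) h2) zy; rewrite ltxx.
Qed.

(** The remainder is orthogonal to the first [n] vectors, so [G] multiplies its norm by at most
    [m_n]; and it is zero when [e_n = 0]. *)
Lemma residual_small x (eps : R) : 0 < eps ->
  exists n, `|G (residual e_ n x)| < eps.
Proof.
move=> eps0.
have x1 : 0 < `|x| + 1 by rewrite ltr_wpDl.
have [n hn] := @eigenvalue_small (eps / (`|x| + 1)) (divr_gt0 eps0 x1).
have ort i : (i < n)%N -> dot (residual e_ n x) (e_ i) = 0.
  by move=> ilt; rewrite dot_residual ilt.
exists n; have [h1 h2] := em ort.
case: hn => [hm|/h2 ->]; last by rewrite G0 normr0.
rewrite (le_lt_trans h1)//.
rewrite (@le_lt_trans _ _ (m_ n * `|x|))//.
  by rewrite ler_pM2l// norm_residual_le.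
rewrite (@le_lt_trans _ _ (m_ n * (`|x| + 1)))// ?ler_pM2l ?lerDl//.
by rewrite -ltr_pdivlMr.
Qed.

(** By density [x] is close to some [G y]. Taking remainders is a contraction and commutes with [G],
    so [residual_small] at [y] controls the remainder of [G y]; norms of remainders decrease with
    the index, hence one good index is enough. *)
Lemma parseval x : closure (range G) = setT ->
  series (fun j => dot x (e_ j) ^+ 2) @ \oo --> `|x| ^+ 2.
Proof.
move=> dG; apply/cvgrPdist_lt => eps eps0.
have [eta [eta0 eta2]] : exists eta : R, 0 < eta /\ (2 * eta) ^+ 2 <= eps.
  exists (Num.sqrt eps / 2); split; first by rewrite divr_gt0// sqrtr_gt0.
  by rewrite mulrCA mulfV// mulr1 sqr_sqrtr// ltW.
have : closure (range G) x by rewrite dG.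
move=> /(_ _ (nbhsx_ballx x eta eta0))[_ [[y _ <-]]].
rewrite -ball_normE /= => xy.
have [N hN] := @residual_small y eta eta0.
near=> n.
rewrite -norm_residual ger0_norm ?sqr_ge0// (lt_le_trans _ eta2)//.
rewrite ltrXn2r//.
have -> : residual e_ n x = residual e_ n (x - G y) + residual e_ n (G y).
  by rewrite residualB subrK.
rewrite (le_lt_trans (ler_normD _ _))// mulr_natl mulr2n ltrD//.
  by rewrite (le_lt_trans (norm_residual_le _ _)).
have nN : (N <= n)%N by near: n; exact: nbhs_infty_ge.
rewrite -residualG in hN; apply: le_lt_trans hN.
rewrite -(@ler_pXn2r _ 2)// ?nnegrE// !norm_residual lerB//.
by apply: nondecreasing_series => // i _ _; exact: sqr_ge0.
Unshelve. all: by end_near. Qed.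

End complete.
End compact_positive.

(** The eigenvectors are those of the inverse, whose range [dom A] is dense by self-adjointness. A
    zero [e_n] also comes with a positive [l_n], so it needs no separate treatment. *)
Lemma eigenbasis (R : realType) (H : completeNormedModType R)
    (dot : {dot H for idfun}) (A : operator H) :
  induces_norm dot -> linear_operator A -> self_adjoint dot A ->
  positive_operator dot A -> compact_inverse A ->
  exists (e_ : nat -> H) (l_ : nat -> R),
  [/\ forall n, 0 < l_ n,
      forall n, dom A (e_ n) /\ A (e_ n) = l_ n *: e_ n,
      forall n, e_ n = 0 \/ `|e_ n| = 1 &
      forall x, series (fun j => dot x (e_ j) ^+ 2) @ \oo --> `|x| ^+ 2].
Proof.
move=> hdot hAlin hAsa hApos hAinv.
have [G [G1 G2 Gl Gs [Gp Gc Gk]]] := inverse_spec hAlin hAsa hApos hAinv.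
have Ginj x : G x = 0 -> x = 0.
  by move=> Gx; have [_ <-] := G1 x; rewrite Gx operator0.
have [e_ [m_ [m0 Ge e01 eo em]]] := eigen_sequence hdot Gl Gs Gp Gc Gk Ginj.
exists e_, (fun n => (m_ n)^-1); split=> //.
- by move=> n; rewrite invr_gt0.
- move=> n; have [d AG] := G1 ((m_ n)^-1 *: e_ n).
  have G0 : G 0 = 0 by have := Gl (-1) 0 0; rewrite scaler0 add0r scaleN1r addNr.
  have Ee : G ((m_ n)^-1 *: e_ n) = e_ n.
    have := Gl (m_ n)^-1 (e_ n) 0.
    by rewrite G0 !addr0 Ge scalerA mulVf ?scale1r// gt_eqF.
  by rewrite Ee in d AG.
- move=> x; apply: (parseval hdot Gl Gs Gk m0 Ge e01 eo em).
  have -> : range G = dom A; last by case: hAsa.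
  rewrite predeqE => y; split=> [[z _ <-]|dy]; first by have [] := G1 z.
  by exists (A y) => //; exact: G2.
Qed.

(** * Integration against the kernel *)

Section negligible.
Local Open Scope ereal_scope.
Context d (T : measurableType d) (R : realType).
Variable mu : {measure set T -> \bar R}.
Import HBNNSimple.

(** Setting a simple function to 0 on [N] leaves its integral unchanged and places it below [G],
    which is nonnegative. *)
Let sup_le (N : set T) (F G : T -> \bar R) : measurable N -> mu N = 0 ->
  (forall x, 0 <= G x) -> (forall x, ~ N x -> F x = G x) ->
  ereal_sup [set sintegral mu h |
    h in [set h : {nnsfun T >-> R} | forall x, (h x)%:E <= F x]] <=
  ereal_sup [set sintegral mu h |
    h in [set h : {nnsfun T >-> R} | forall x, (h x)%:E <= G x]].
Proof.
move=> mN N0 G0 FG; apply/ge_ereal_sup => /= _ -[h hF <-].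
pose h' := proj_nnsfun h (measurableC mN).
apply: ereal_sup_ubound; exists h'.
  move=> x /=; rewrite mindicE; have [/set_mem Nx|] := boolP (x \in N).
    by rewrite memNset/= ?mulr0//; apply.
  by rewrite notin_setE => Nx; rewrite mem_set//= mulr1 -FG.
have E (g : {nnsfun T >-> R}) : sintegral mu g = \int[mu]_x (g x)%:E.
  by rewrite integral_nnsfun// patch_setT.
rewrite !E; apply: ae_eq_integral => //.
- exact/measurable_EFinP.
- exact/measurable_EFinP.
- exists N; split=> // x /= /not_implyP[_ hx]; apply: contrapT => Nx; apply: hx.
  by rewrite mindicE mem_set//= mulr1.
Qed.

(* No measurability: the integral of the library is defined for every function,
   and the nonnegative simple functions below two functions that agree outside
   a null set have the same integrals. *)
Lemma negligible_eq_integral (D N : set T) (f g : T -> \bar R) :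
  measurable N -> mu N = 0 -> (forall x, D x -> ~ N x -> f x = g x) ->
  \int[mu]_(x in D) f x = \int[mu]_(x in D) g x.
Proof.
move=> mN N0 fg.
have fgD x : ~ N x -> (f \_ D) x = (g \_ D) x.
  by move=> Nx; rewrite !patchE; case: ifPn => // /set_mem Dx; exact: fg.
rewrite /integral; congr (_ - _); apply/eqP; rewrite eq_le; apply/andP; split.
all: by apply: (sup_le mN N0) => // x Nx; rewrite ?funeposE ?funenegE fgD.
Qed.

Lemma ae_eq_integral_any (D : set T) (f g : T -> \bar R) :
  {ae mu, forall x, D x -> f x = g x} ->
  \int[mu]_(x in D) f x = \int[mu]_(x in D) g x.
Proof.
move=> [N [mN N0 sub]]; apply: (negligible_eq_integral mN N0) => x Dx Nx.
by apply: contrapT => h; apply: Nx; apply: sub => /= /(_ Dx).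
Qed.

Lemma ae_eq_Rintegral (D : set T) (f g : T -> R) :
  {ae mu, forall x, D x -> f x = g x} ->
  (\int[mu]_(x in D) f x = \int[mu]_(x in D) g x)%R.
Proof.
move=> fg; congr fine; apply: ae_eq_integral_any.
by apply: filterS fg => x /[apply] ->.
Qed.

End negligible.

Section shift.
Context (R : realType).
Local Notation leb := (@lebesgue_measure R).
Implicit Types (h : R) (A : set R).

Lemma measurable_shift h : measurable_fun [set: measurableTypeR R]
  (fun x : measurableTypeR R => (x : R) + h : measurableTypeR R).
Proof. exact: (@measurable_funD _ _ R). Qed.

Lemma shift_preimage_itv h (a b : R) b0 b1 :
  (fun x => x + h) @^-1` [set` Interval (BSide b0 a) (BSide b1 b)] =
  [set` Interval (BSide b0 (a - h)) (BSide b1 (b - h))].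
Proof.
rewrite predeqE => x /=; rewrite !in_itv /=.
by case: b0; case: b1; rewrite /= ?lerBlDr ?ltrBlDr ?lerBrDr ?ltrBrDr.
Qed.

Lemma lebesgue_measure_shift h A : measurable A ->
  pushforward leb (fun x : measurableTypeR R => (x : R) + h : measurableTypeR R) A = leb A.
Proof.
pose f : {mfun measurableTypeR R >-> measurableTypeR R} :=
  mfun_Sub (mem_set (measurable_shift h)).
move=> mA; apply/esym.
apply: (@lebesgue_measure_unique R (pushforward leb f)) => //= _ [[a b]] _ <-.
rewrite /pushforward shift_preimage_itv/= !lebesgue_measure_itv/=.
by rewrite !lte_fin ltrD2r -!EFinB; case: ifPn => // _; congr EFin; ring.
Qed.

Lemma ge0_integral_shift h (f : R -> \bar R) : measurable_fun `]h, +oo[ f ->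
  (forall s, h < s -> (0 <= f s)%E) ->
  (\int[leb]_(s in `]h, +oo[) f s = \int[leb]_(s in `]0%R, +oo[) f (s + h)%R)%E.
Proof.
move=> mf f0; rewrite (_ : `]0, +oo[%classic =
    (fun x : measurableTypeR R => (x : R) + h : measurableTypeR R) @^-1` `]h, +oo[); last first.
  by rewrite predeqE => x /=; rewrite !in_itv/= !andbT ltrDr.
rewrite -(@ge0_integral_pushforward _ _ _ _ _ _ (measurable_shift h) leb)//.
  apply: eq_measure_integral; first exact: measurable_shift.
  by move=> mh A mA AS; apply/esym; exact: lebesgue_measure_shift.
by move=> s; rewrite inE/= in_itv/= andbT; exact: f0.
Qed.

End shift.

Section weighted_integral.
Context (R : realType) (mu : R -> R).
Hypothesis hmu : admissible_kernel mu.
Local Notation leb := (@lebesgue_measure R).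
Local Notation halfline := (`]0, +oo[%classic : set R).
Implicit Types (F G : R -> R) (s t h c : R).

Lemma kernel_nincr s t : 0 <= s -> s <= t -> mu t <= mu s.
Proof.
have [d d0 hd] := kernel_decay hmu.
apply: (@ler0_derive1_nincry R mu 0).
- by move=> x; rewrite in_itv/= andbT => x0; exact: kernel_derivable.
- move=> x; rewrite in_itv/= andbT => x0; rewrite (le_trans (hd _ x0))//.
  by rewrite mulNr oppr_le0 mulr_ge0 ?(ltW d0)// kernel_ge0// ltW.
- exact: kernel_continuous.
Qed.

Lemma kernel_measurable : measurable_fun halfline mu.
Proof. by apply/measurable_EFinP; exact: measurable_int (kernel_L1 hmu). Qed.

Definition wintegrable F := leb.-integrable halfline (EFin \o (fun s => mu s * F s)).

Definition wint F := \int[leb]_(s in halfline) (mu s * F s).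

Lemma mass_ge0 : 0 <= kernel_mass mu.
Proof.
by apply: Rintegral_ge0 => s /=; rewrite in_itv/= andbT => /ltW; exact: kernel_ge0.
Qed.

Lemma mass_le1 : kernel_mass mu <= 1.
Proof. exact/ltW/kernel_mass_lt1. Qed.

Lemma wintegrable_cst c : wintegrable (fun=> c).
Proof.
apply: eq_integrable (integrableZl _ c (kernel_L1 hmu)) => //.
by move=> x _; rewrite /= mulrC EFinM.
Qed.

Lemma wint_cst c : wint (fun=> c) = kernel_mass mu * c.
Proof. by rewrite /wint RintegralZr//; exact: kernel_L1. Qed.

Lemma wintegrableD F G : wintegrable F -> wintegrable G ->
  wintegrable (fun s => F s + G s).
Proof.
move=> iF iG; apply: eq_integrable (integrableD _ iF iG) => //.
by move=> x _; rewrite /= mulrDr.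
Qed.

Lemma wintegrableZ c F : wintegrable F -> wintegrable (fun s => c * F s).
Proof.
move=> iF; apply: eq_integrable (integrableZl _ c iF) => //.
by move=> x _; rewrite /= mulrCA EFinM.
Qed.

Lemma wintegrableB F G : wintegrable F -> wintegrable G ->
  wintegrable (fun s => F s - G s).
Proof.
move=> iF iG; apply: eq_integrable (wintegrableD iF (wintegrableZ (-1) iG)) => //.
by move=> x _; rewrite /= mulN1r.
Qed.

Lemma wintD F G : wintegrable F -> wintegrable G ->
  wint (fun s => F s + G s) = wint F + wint G.
Proof.
move=> iF iG; rewrite /wint -RintegralD//; apply: eq_Rintegral => x _.
by rewrite mulrDr.
Qed.

Lemma wintZ c F : wintegrable F -> wint (fun s => c * F s) = c * wint F.
Proof.
move=> iF; rewrite /wint -RintegralZl//; apply: eq_Rintegral => x _.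
by rewrite mulrCA.
Qed.

Lemma wintB F G : wintegrable F -> wintegrable G ->
  wint (fun s => F s - G s) = wint F - wint G.
Proof.
move=> iF iG; rewrite /wint -RintegralB//; apply: eq_Rintegral => x _.
by rewrite mulrBr.
Qed.

Lemma wint_ge0 F : (forall s, 0 < s -> 0 <= F s) -> 0 <= wint F.
Proof.
move=> F0; apply: Rintegral_ge0 => s /=; rewrite in_itv/= andbT => s0.
by rewrite mulr_ge0 ?F0// kernel_ge0// ltW.
Qed.

Lemma le_wint F G : wintegrable F -> wintegrable G ->
  (forall s, 0 < s -> F s <= G s) -> wint F <= wint G.
Proof.
move=> iF iG FG; apply: le_Rintegral => // s /=; rewrite in_itv/= andbT => s0.
by rewrite ler_wpM2l ?FG// kernel_ge0// ltW.
Qed.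

Lemma le_wintegrable F G : measurable_fun halfline F ->
  (forall s, 0 < s -> `|F s| <= G s) -> wintegrable G -> wintegrable F.
Proof.
move=> mF FG iG; apply: le_integrable iG => //.
  by apply/measurable_EFinP; apply: measurable_funM => //; exact: kernel_measurable.
move=> s /=; rewrite in_itv/= andbT => s0; rewrite lee_fin !normrM.
by rewrite ler_wpM2l// (le_trans (FG _ s0))// ler_norm.
Qed.

Lemma normr_wint F : wintegrable F -> `|wint F| <= wint (fun s => `|F s|).
Proof.
move=> iF; rewrite (le_trans (le_normr_Rintegral _ iF))//.
rewrite /wint le_eqVlt; apply/orP; left; apply/eqP; apply: eq_Rintegral => s.
rewrite inE /= in_itv/= andbT => s0; rewrite normrM ger0_norm//.
by rewrite kernel_ge0// ltW.
Qed.

Lemma wintegrable_norm F : wintegrable F -> wintegrable (fun s => `|F s|).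
Proof.
move=> iF; apply: eq_integrable (integrable_norm iF) => //.
move=> s; rewrite inE /= in_itv/= andbT => s0; rewrite normrM ger0_norm//.
by rewrite kernel_ge0// ltW.
Qed.

Lemma wint_bound F (B : R) : wintegrable F ->
  (forall s, 0 < s -> `|F s| <= B) -> `|wint F| <= kernel_mass mu * B.
Proof.
move=> iF FB; rewrite (le_trans (normr_wint iF))// -wint_cst.
by apply: le_wint => //; [exact: wintegrable_norm|exact: wintegrable_cst].
Qed.

Lemma wintegrable_bounded F (B : R) : measurable_fun halfline F ->
  (forall s, 0 < s -> `|F s| <= B) -> wintegrable F.
Proof. by move=> mF FB; apply: (le_wintegrable mF FB); exact: wintegrable_cst. Qed.

(** The kernel has finite mass and [|F| <= 1 + F^2]. *)
Lemma wintegrable_sqr F : measurable_fun halfline F ->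
  wintegrable (fun s => F s ^+ 2) -> wintegrable F.
Proof.
move=> mF iF.
apply: (le_wintegrable mF) (wintegrableD (wintegrable_cst 1) iF) => s s0.
rewrite -(real_normK (num_real (F s))); have := sqr_ge0 (`|F s| - 1).
by have := normr_ge0 (F s); nra.
Qed.

Lemma wintegrable_sqrD F G : measurable_fun halfline F -> measurable_fun halfline G ->
  wintegrable (fun s => F s ^+ 2) -> wintegrable (fun s => G s ^+ 2) ->
  wintegrable (fun s => (F s + G s) ^+ 2).
Proof.
move=> mF mG iF iG.
have mFG : measurable_fun halfline (fun s => (F s + G s) ^+ 2).
  by apply: measurable_funX; exact: measurable_funD.
apply: (le_wintegrable mFG) (wintegrableZ 2 (wintegrableD iF iG)) => s s0.
rewrite ger0_norm ?sqr_ge0//; have := sqr_ge0 (F s - G s); nra.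
Qed.

(* Shifting back to [F] costs nothing beyond [0, h] because the kernel is
   nonincreasing. *)
Lemma wint_shift F h (B : R) : 0 <= h -> measurable_fun halfline F ->
  (forall s, 0 <= F s) -> (forall s, 0 < s -> s <= h -> F s <= B) -> 0 <= B ->
  wintegrable (fun s => F (s + h)) ->
  wintegrable F /\ wint F <= mu 0 * h * B + wint (fun s => F (s + h)).
Proof.
move=> h0 mF F0 FB B0 iF.
have mmF : measurable_fun halfline (fun s => (mu s * F s)%:E).
  by apply/measurable_EFinP; apply: measurable_funM => //; exact: kernel_measurable.
have muF0 s : halfline s -> (0 <= (mu s * F s)%:E)%E.
  by rewrite /= in_itv/= andbT => s0; rewrite lee_fin mulr_ge0// kernel_ge0// ltW.
have oc : halfline = `]0, h]%classic `|` `]h, +oo[%classic.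
  by rewrite -itv_bndbnd_setU// bnd_simp.
have sub1 : `]0, h]%classic `<=` halfline by rewrite oc; exact: subsetUl.
have sub2 : `]h, +oo[%classic `<=` halfline by rewrite oc; exact: subsetUr.
have E : (\int[leb]_(s in halfline) (mu s * F s)%:E =
  \int[leb]_(s in `]0%R, h]) (mu s * F s)%:E +
  \int[leb]_(s in halfline) (mu (s + h) * F (s + h))%:E)%E.
  rewrite {1}oc ge0_integral_setU//; first last.
  - apply/disj_setPS => y [/=]; rewrite !in_itv/= andbT => /andP[_ yx].
    by rewrite ltNge yx.
  - by rewrite -oc.
  - by rewrite -oc.
  congr (_ + _)%E; rewrite ge0_integral_shift//.
    exact: measurable_funS mmF.
  move=> s hs; apply: muF0; rewrite /= in_itv/= andbT; exact: le_lt_trans hs.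
have I1 : (\int[leb]_(s in `]0%R, h]) (mu s * F s)%:E <= (mu 0 * h * B)%:E)%E.
  rewrite (@le_trans _ _ (\int[leb]_(s in `]0%R, h]) (mu 0 * B)%:E)%E)//.
    apply: ge0_le_integral => //.
    - by move=> s /sub1/muF0.
    - exact: measurable_funS mmF.
    - move=> s; rewrite /= in_itv/= => /andP[s0 sh]; rewrite lee_fin.
      have mus : mu s <= mu 0 by apply: kernel_nincr => //; exact: ltW.
      by rewrite ler_pM// ?FB// (kernel_ge0 hmu)// ltW.
  rewrite integral_cst//= lebesgue_measure_itv/= lte_fin.
  case: ifPn => [_|]; first by rewrite -EFinD -EFinM lee_fin subr0 mulrAC.
  by move=> _; rewrite mule0 lee_fin !mulr_ge0// kernel_ge0.
have msh : measurable_fun halfline (fun s => F (s + h)).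
  have mF' := measurable_funS (E := halfline) _ sub2 mF.
  pose g := F \_ halfline.
  have mg : measurable_fun setT g by apply/(measurable_restrictT _ _).1.
  apply: (@eq_measurable_fun _ _ _ _ _ (g \o (fun s => s + h))).
    move=> s; rewrite inE/= in_itv/= andbT => s0; rewrite /g /= patchT//.
    by rewrite inE/= in_itv/= andbT ltr_wpDr.
  apply: measurable_funTS; apply: measurableT_comp => //.
  exact: measurable_funD.
have I2 : (\int[leb]_(s in halfline) (mu (s + h) * F (s + h))%:E <=
           \int[leb]_(s in halfline) (mu s * F (s + h))%:E)%E.
  have mk : measurable_fun halfline (fun s => mu (s + h)).
    pose g := mu \_ halfline.
    have mg : measurable_fun setT g.
      by apply/(measurable_restrictT _ _).1 => //; exact: kernel_measurable.
    apply: (@eq_measurable_fun _ _ _ _ _ (g \o (fun s => s + h))).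
      move=> s; rewrite inE/= in_itv/= andbT => s0; rewrite /g /= patchT//.
      by rewrite inE/= in_itv/= andbT ltr_wpDr.
    apply: measurable_funTS; apply: measurableT_comp => //.
    exact: measurable_funD.
  apply: ge0_le_integral => //.
  - move=> s; rewrite /= in_itv/= andbT => s0.
    by rewrite lee_fin mulr_ge0// kernel_ge0// addr_ge0// ltW.
  - by apply/measurable_EFinP; exact: measurable_funM.
  - by apply/measurable_EFinP; apply: measurable_funM => //; exact: kernel_measurable.
  - move=> s; rewrite /= in_itv/= andbT => s0; rewrite lee_fin ler_wpM2r//.
    by apply: kernel_nincr; [exact: ltW|rewrite lerDl].
have fin : (\int[leb]_(s in halfline) (mu s * F (s + h))%:E \is a fin_num)%E.
  exact: (integrable_fin_num _ iF).
have le : (\int[leb]_(s in halfline) (mu s * F s)%:E <=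
   (mu 0 * h * B + wint (fun s => F (s + h)))%:E)%E.
  rewrite E EFinD leeD//; rewrite /wint /Rintegral fineK//.
have iF' : wintegrable F.
  apply/integrableP; split; first exact: mmF.
  have -> : (\int[leb]_(s in halfline) `|(EFin \o (fun s => (mu s * F s)%R)) s| =
      \int[leb]_(s in halfline) (mu s * F s)%:E)%E.
    by apply: eq_integral => s; rewrite inE => /muF0 /gee0_abs.
  exact: le_lt_trans le (ltry _).
split=> //; rewrite -lee_fin (le_trans _ le)// /wint /Rintegral fineK//.
exact: (integrable_fin_num _ iF').
Qed.

End weighted_integral.

(** * The scalar delay equation *)

Section calculus.
Context (R : realType).
Local Notation leb := (@lebesgue_measure R).
Implicit Types (y z c g : R -> R) (t s : R).

Definition primitive y t := \int[leb]_(r in `[0, t]) y r.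

Let integrable_segment y (a b : R) : continuous y ->
  leb.-integrable `[a, b] (EFin \o y).
Proof.
move=> cy; apply: continuous_compact_integrable; first exact: segment_compact.
exact: continuous_subspaceT.
Qed.

Lemma primitive_le0 y t : t <= 0 -> primitive y t = 0.
Proof.
rewrite le_eqVlt => /predU1P[->|t0]; rewrite /primitive.
  by rewrite set_itv1 Rintegral_set1.
by rewrite set_itv_ge ?Rintegral_set0// bnd_simp -ltNge.
Qed.

Lemma primitive_derive y t : continuous y -> 0 < t -> is_derive t 1 (primitive y) (y t).
Proof.
move=> cy t0; have tt : t < t + 1 by rewrite ltrDl.
have [d1 d2] := continuous_FTC1_closed tt (integrable_segment 0 (t + 1) cy) t0 (cy t).
split; first exact: d1.
by rewrite -derive1E; exact: d2.
Qed.

Lemma primitive_continuous y : continuous y -> continuous (primitive y).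
Proof.
move=> cy t; have [t0|t0|->] := ltgtP t 0.
- rewrite /continuous_at (primitive_le0 _ (ltW t0)); apply: cvg_near_cst.
  near=> x; have x0 : x <= 0 by near: x; exact: (cvgr_le t).
  exact: primitive_le0.
- have [d _] := primitive_derive cy t0.
  exact/differentiable_continuous/derivable1_diffP.
- rewrite /continuous_at primitive_le0//.
  exact: parameterized_integral_cvg_left ltr01 (integrable_segment 0 1 cy).
Unshelve. all: by end_near. Qed.

Lemma primitiveB y z t : continuous y -> continuous z ->
  primitive (fun r => y r - z r) t = primitive y t - primitive z t.
Proof. by move=> cy cz; rewrite /primitive RintegralB//; exact: integrable_segment. Qed.

Lemma eq_primitive y z t : (forall r, 0 <= r <= t -> y r = z r) ->
  primitive y t = primitive z t.
Proof.
by move=> yz; apply: eq_Rintegral => r; rewrite inE/= in_itv/=; exact: yz.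
Qed.

Lemma primitive_sub y (a b : R) : continuous y -> 0 <= a -> a <= b ->
  primitive y b - primitive y a = \int[leb]_(r in `[a, b]) y r.
Proof.
move=> cy a0 ab; rewrite /primitive Rintegral_itvB//.
- rewrite Rintegral_itv_obnd_cbnd//.
  apply: integrableS (integrable_segment a b cy) => //.
  by move=> x /=; rewrite !in_itv/= => /andP[/ltW -> ->].
- exact: integrable_segment.
Qed.

Lemma nondecreasing_derive (f f' : R -> R) (a b : R) : a <= b ->
  (forall x, a < x < b -> is_derive x 1 f (f' x)) ->
  (forall x, a < x < b -> 0 <= f' x) ->
  {within `[a, b], continuous f} -> f a <= f b.
Proof.
move=> ab df f0 cf; apply: (@ger0_derive1_ndecr R f a b) => //.
- by move=> x; rewrite in_itv/= => xab; have [] := df _ xab.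
- move=> x; rewrite in_itv/= => xab; rewrite derive1E.
  by have [_ ->] := df _ xab; exact: f0.
Qed.

(** Comparison with [M / beta * exp (beta t)], whose derivative dominates [|y|]. Each integration
    thus gains a factor [1 / beta], from which the contraction below draws its strength. *)
Lemma primitive_expR_bound y (M beta t : R) : continuous y -> 0 <= M -> 0 < beta ->
  0 <= t -> (forall r : R, 0 <= r <= t -> `|y r| <= M * expR (beta * r)) ->
  `|primitive y t| <= M / beta * expR (beta * t).
Proof.
move=> cy M0 b0 t0 yM.
have Mb : 0 <= M / beta by rewrite divr_ge0// ltW.
have dE (r : R) : is_derive r 1 (fun r : R => M / beta * expR (beta * r) : R)
    (M * expR (beta * r)).
  apply: is_derive_eq; rewrite /= /GRing.scale /=.
  by field; rewrite gt_eqF.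
have cE : continuous (fun r : R => M / beta * expR (beta * r) : R).
  move=> x; have [d _] := dE x.
  exact/differentiable_continuous/derivable1_diffP.
have cJ := primitive_continuous cy.
rewrite ler_norml; apply/andP; split.
- rewrite -subr_ge0 opprK.
  pose F r := primitive y r + M / beta * expR (beta * r).
  apply: (@le_trans _ _ (F 0)).
    by rewrite /F primitive_le0// mulr0 expR0 mulr1 add0r.
  apply: (@nondecreasing_derive F (fun r => y r + M * expR (beta * r)) 0 t t0).
  + move=> x /andP[x0 _]; have := primitive_derive cy x0 => h.
    exact: is_deriveD.
  + move=> x /andP[x0 xt]; rewrite -lerBlDr sub0r.
    by have := yM x; rewrite (ltW x0) (ltW xt) ler_norml => /(_ isT)/andP[].
  + by apply: continuous_subspaceT => x; apply: cvgD; [exact: cJ|exact: cE].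
- rewrite -subr_ge0.
  pose F r := M / beta * expR (beta * r) - primitive y r.
  apply: (@le_trans _ _ (F 0)).
    by rewrite /F primitive_le0// mulr0 expR0 mulr1 subr0.
  apply: (@nondecreasing_derive F (fun r => M * expR (beta * r) - y r) 0 t t0).
  + move=> x /andP[x0 _]; have := primitive_derive cy x0 => h.
    exact: is_deriveB.
  + move=> x /andP[x0 xt]; rewrite subr_ge0.
    by have := yM x; rewrite (ltW x0) (ltW xt) ler_norml => /(_ isT)/andP[].
  + by apply: continuous_subspaceT => x; apply: cvgB; [exact: cE|exact: cJ].
Qed.

Record tame c g : Prop := {
  tame_past : forall t, t <= 0 -> c t = c 0 ;
  tame_derive : forall t, 0 < t -> is_derive t 1 c (g t) ;
  tame_continuous : continuous c ;
  tame_derivative : continuous g }.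

Lemma tame_lipschitz c g (N : R) : tame c g ->
  exists2 L, 0 <= L & forall s t, s <= N -> t <= N -> `|c t - c s| <= L * `|t - s|.
Proof.
move=> [cp cd cc cg].
have [L L0 hL] : exists2 L, 0 <= L & forall r, 0 <= r <= N -> `|g r| <= L.
  have cn : compact (g @` `[0, N]).
    apply: continuous_compact; last exact: segment_compact.
    exact: continuous_subspaceT.
  have [M [_ hM0]] := compact_bounded cn.
  have MM : M < `|M| + 1 by rewrite (le_lt_trans (ler_norm _))// ltrDl.
  have hM := hM0 _ MM.
  exists (`|M| + 1); first by rewrite addr_ge0.
  by move=> r r0; apply: hM; exists r => //=; rewrite in_itv.
have key s t : 0 <= s -> s < t -> t <= N -> `|c t - c s| <= L * (t - s).
  move=> s0 st tN.
  have dcg x : x \in `]s, t[ -> is_derive x 1 c (g x).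
    by rewrite in_itv/= => /andP[sx _]; apply: cd; exact: le_lt_trans sx.
  have [x] := MVT st dcg (continuous_subspaceT cc).
  rewrite in_itv/= => /andP[sx xt] ->; rewrite normrM [`|t - s|]gtr0_norm ?subr_gt0//.
  rewrite ler_wpM2r ?subr_ge0 ?(ltW st)// hL//.
  by rewrite (le_trans s0 (ltW sx)) (le_trans (ltW xt)).
have key2 s t : s < t -> t <= N -> `|c t - c s| <= L * (t - s).
  move=> st tN; have [s0|s0] := leP 0 s; first exact: key.
  rewrite (cp _ (ltW s0)); have [t0|t0] := leP t 0.
    by rewrite (cp _ t0) subrr normr0 mulr_ge0// subr_ge0 ltW.
  rewrite (le_trans (key _ _ (lexx 0) t0 tN))// ler_wpM2l// lerB//.
  exact: ltW.
exists L => // s t sN tN; have [st|ts|->] := ltgtP s t.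
- by rewrite [`|t - s|]gtr0_norm ?subr_gt0//; exact: key2.
- by rewrite distrC [`|t - s|]distrC [`|s - t|]gtr0_norm ?subr_gt0//; exact: key2.
- by rewrite !subrr normr0 mulr0.
Qed.

Lemma geometric_limit (u : nat -> R) (B : R) :
  (forall n, `|u n.+1 - u n| <= B * 2^-1 ^+ n) ->
  (u @ \oo --> limn u) /\ forall n, `|limn u - u n| <= 2 * B * 2^-1 ^+ n.
Proof.
move=> uB.
have B0 : 0 <= B by have := le_trans (normr_ge0 _) (uB 0%N); rewrite expr0 mulr1.
have h n k : `|u (n + k)%N - u n| <= 2 * B * 2^-1 ^+ n.
  suff : `|u (n + k)%N - u n| <= 2 * B * 2^-1 ^+ n - 2 * B * 2^-1 ^+ (n + k).
    move=> /le_trans; apply; rewrite gerBl !mulr_ge0// exprn_ge0//.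
  elim: k => [|k IH]; first by rewrite addn0 !subrr normr0.
  rewrite addnS -(subrKA (u (n + k)%N)) (le_trans (ler_normD _ _))//.
  rewrite (le_trans (lerD (uB _) IH))// exprS.
  by move: (2^-1 ^+ n) (2^-1 ^+ (n + k)) => a b; lra.
have cu : cvgn u.
  apply/cauchy_cvgP/cauchy_exP => e e0.
  have : (fun n => 2 * B * 2^-1 ^+ n) @ \oo --> (2 * B * 0 : R).
    apply: cvgM; first exact: cvg_cst.
    by apply: cvg_expr; rewrite gtr0_norm ?invr_gt0// invf_lt1// ltr1n.
  rewrite mulr0 => /cvgrPdist_lt/(_ _ e0)[N _ hN].
  exists (u N); exists N => // n /= Nn; rewrite -ball_normE /=.
  rewrite distrC -(subnKC Nn) (le_lt_trans (h _ _))//.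
  have := hN N (leqnn N); rewrite sub0r normrN; apply: le_lt_trans.
  exact: ler_norm.
split=> // n; rewrite -[X in `|X|]opprB normrN.
have : (fun m => `|u n - u m|) @ \oo --> `|u n - limn u|.
  by apply: cvg_norm; apply: cvgB => //; exact: cvg_cst.
move=> /cvg_lim <- //; apply: limr_le.
  by apply/cvg_ex; eexists; apply: cvg_norm; apply: cvgB cu; exact: cvg_cst.
by exists n => // m /= nm; rewrite distrC -(subnKC nm); exact: h.
Qed.

End calculus.

(** * Fixed points in an exponentially weighted norm *)

Section weighted_fixpoint.
Context (R : realType).
Implicit Types (y z : R -> R) (t r T M : R).
Variables (Phi : (R -> R) -> R -> R) (beta M0 : R).
Hypothesis beta_gt0 : 0 < beta.
Hypothesis Phi_continuous : forall y, continuous y -> continuous (Phi y).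
Hypothesis Phi_past : forall y t, t <= 0 -> Phi y t = Phi y 0.
Hypothesis Phi_contract : forall y z M T, continuous y -> continuous z -> 0 <= M ->
  (forall r, 0 <= r <= T -> `|y r - z r| <= M * expR (beta * r)) ->
  forall r, 0 <= r <= T -> `|Phi y r - Phi z r| <= M / 2 * expR (beta * r).
Hypothesis Phi_start : forall r, 0 <= r -> `|Phi (fun=> 0) r| <= M0 * expR (beta * r).

Let u n := iter n Phi (fun=> 0).

Let M0_ge0 : 0 <= M0.
Proof. by have := le_trans (normr_ge0 _) (Phi_start (lexx 0)); rewrite mulr0 expR0 mulr1. Qed.

Let cu n : continuous (u n).
Proof. by elim: n => [|n IH]; [move=> x; exact: cvg_cst|exact: Phi_continuous]. Qed.

Let u_past n t : t <= 0 -> u n t = u n 0.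
Proof. by case: n => [//|n] t0; exact: Phi_past. Qed.

Let u_step n t : 0 <= t -> `|u n.+1 t - u n t| <= M0 * 2^-1 ^+ n * expR (beta * t).
Proof.
elim: n t => [|n IH] t t0; first by rewrite /= subr0 expr0 mulr1; exact: Phi_start.
have := @Phi_contract (u n.+1) (u n) (M0 * 2^-1 ^+ n) t (@cu n.+1) (@cu n).
rewrite mulr_ge0 ?exprn_ge0// => /(_ isT) h.
rewrite exprS [2^-1 * _]mulrC mulrA; apply: h; last by rewrite t0 lexx.
by move=> r /andP[r0 _]; exact: IH.
Qed.

Let y t := limn (fun n => u n t).

Let y_lim n t : 0 <= t -> `|y t - u n t| <= 2 * M0 * 2^-1 ^+ n * expR (beta * t).
Proof.
move=> t0; have h k : `|u k.+1 t - u k t| <= M0 * expR (beta * t) * 2^-1 ^+ k.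
  by rewrite mulrAC; exact: u_step.
have [_ /(_ n)] := geometric_limit h.
by rewrite (_ : 2 * (M0 * _) * _ = 2 * M0 * 2^-1 ^+ n * expR (beta * t))//; ring.
Qed.

Let y_past t : t <= 0 -> y t = y 0.
Proof. by move=> t0; congr (limn _); apply/funext => n; exact: u_past. Qed.

Let half_small (B e : R) : 0 < e -> exists n, B * 2^-1 ^+ n < e.
Proof.
move=> e0; have : (fun n => B * 2^-1 ^+ n) @ \oo --> (B * 0 : R).
  apply: cvgM; first exact: cvg_cst.
  by apply: cvg_expr; rewrite gtr0_norm ?invr_gt0// invf_lt1// ltr1n.
rewrite mulr0 => /cvgrPdist_lt/(_ _ e0)[N _ hN]; exists N.
have := hN N (leqnn N); rewrite sub0r normrN; apply: le_lt_trans.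
exact: ler_norm.
Qed.

Let cy : continuous y.
Proof.
move=> t; apply/cvgrPdist_lt => e e0.
pose m := `|t| + 1.
have e3 : 0 < e / 3 by rewrite divr_gt0.
have [n hn] := half_small (2 * M0 * expR (beta * m)) e3.
have close s : s <= m -> `|y s - u n s| < e / 3.
  move=> sm; wlog s0 : s sm / 0 <= s.
    move=> h; have [/h|s0] := leP 0 s; first exact.
    rewrite (y_past (ltW s0)) (u_past _ (ltW s0)); apply: h => //.
    by rewrite addr_ge0.
  apply: le_lt_trans hn; rewrite (le_trans (y_lim _ s0))// mulrAC.
  by rewrite ler_wpM2r ?exprn_ge0// ler_wpM2l ?mulr_ge0// ler_expR ler_pM2l.
near=> s.
have sm : s <= m.
  near: s; apply: (cvgr_le t) => //.
  by rewrite (le_lt_trans (ler_norm _))// ltrDl.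
have tm : t <= m by rewrite (le_trans (ler_norm _))// lerDl.
have st : `|u n t - u n s| < e / 3.
  by near: s; apply: cvgr_dist_lt => //; exact: cu.
have -> : y t - y s = (y t - u n t) + (u n t - u n s) - (y s - u n s) by ring.
rewrite (le_lt_trans (ler_normB _ _))// (le_lt_trans (lerD (ler_normD _ _) (lexx _)))//.
have := close _ sm; have := close _ tm; lra.
Unshelve. all: by end_near. Qed.

(** Picard iteration from 0: in the norm [sup e^(- beta t) |y t|] successive differences are halved,
    so the iterates converge uniformly on bounded sets of times, the past being constant. *)
Lemma weighted_fixpoint : exists2 y, continuous y &
  (forall t, t <= 0 -> y t = y 0) /\ forall t, 0 <= t -> Phi y t = y t.
Proof.
exists y => //; split=> // t t0.
apply/eqP; rewrite -subr_eq0 -normr_eq0 eq_le normr_ge0 andbT.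
apply/ler_addgt0Pl => e e0; rewrite addr0.
have [n hn] := half_small (2 * M0 * expR (beta * t)) e0.
have h1 : `|Phi y t - u n.+1 t| <= 2 * M0 * 2^-1 ^+ n / 2 * expR (beta * t).
  apply: (Phi_contract (T := t) cy (@cu n)).
  - by rewrite !mulr_ge0// exprn_ge0.
  - by move=> r /andP[r0 _]; exact: y_lim.
  - by rewrite t0 lexx.
have h2 := y_lim n.+1 t0.
have -> : Phi y t - y t = (Phi y t - u n.+1 t) - (y t - u n.+1 t) by ring.
rewrite (le_trans (ler_normB _ _))// (le_trans (lerD h1 h2))//.
apply: le_trans (ltW hn); rewrite exprS le_eqVlt; apply/orP; left; apply/eqP.
by field.
Qed.

(** Iterating the contraction on an initial bound [B] gives [|x - z| <= B 2^-n e^(beta t)]. It is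
    local to [[0, T]] because a mode satisfies the equation with [k = 0] only during one
    interval. *)
Lemma weighted_fixpoint_unique x z T : continuous x -> continuous z ->
  (forall t, 0 <= t <= T -> Phi x t = x t) ->
  (forall t, 0 <= t <= T -> Phi z t = z t) ->
  forall t, 0 <= t <= T -> x t = z t.
Proof.
move=> cx cz xP zP.
have [B B0 hB] : exists2 B : R, 0 <= B & forall r, 0 <= r <= T -> `|x r - z r| <= B.
  have cn : compact ((fun r => x r - z r) @` `[0, T]).
    apply: continuous_compact; last exact: segment_compact.
    by apply: continuous_subspaceT => w; apply: cvgB; [exact: cx|exact: cz].
  have [M [_ hM0]] := compact_bounded cn.
  have MM : M < `|M| + 1 by rewrite (le_lt_trans (ler_norm _))// ltrDl.
  have hM := hM0 _ MM; exists (`|M| + 1); first by rewrite addr_ge0.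
  by move=> r r0; apply: hM; exists r => //=; rewrite in_itv.
have step n : forall r, 0 <= r <= T -> `|x r - z r| <= B * 2^-1 ^+ n * expR (beta * r).
  elim: n => [|n IH] r rT.
    rewrite expr0 mulr1 (le_trans (hB _ rT))// ler_peMr// -expR0 ler_expR.
    by rewrite mulr_ge0// ?(ltW beta_gt0)//; case/andP: rT.
  rewrite -(xP _ rT) -(zP _ rT) exprS [2^-1 * _]mulrC mulrA.
  apply: (Phi_contract (T := T)) => //.
  by rewrite mulr_ge0// exprn_ge0.
move=> t tT; apply/eqP; rewrite -subr_eq0 -normr_eq0 eq_le normr_ge0 andbT.
apply/ler_addgt0Pl => e e0; rewrite addr0.
have [n hn] := half_small (B * expR (beta * t)) e0.
by rewrite (le_trans (step n t tT))// mulrAC ltW.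
Qed.

End weighted_fixpoint.

Lemma continuous_dist (R : realType) (f : R -> R) :
  (forall (t e : R), 0 < e -> exists2 d : R, 0 < d &
    forall x, `|t - x| < d -> `|f t - f x| < e) -> continuous f.
Proof.
move=> h t; apply/(@cvgrPdist_lt R R^o) => e e0; have [d d0 hd] := h t e e0.
by exists d => // x /= tx; exact: hd.
Qed.

Lemma dist_continuous (R : realType) (f : R -> R) (t e : R) :
  {for t, continuous f} -> 0 < e ->
  exists2 d : R, 0 < d & forall x, `|t - x| < d -> `|f t - f x| < e.
Proof.
move=> cf e0; have /(@cvgrPdist_lt R R^o)/(_ e e0)[d /= d0 hd] := cf.
by exists d => // x; exact: hd.
Qed.

Lemma max0_lipschitz (R : realType) (t x : R) :
  `|Num.max t 0 - Num.max x 0| <= `|t - x|.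
Proof.
have := ler_norm (t - x); have := ler_norm (x - t); rewrite distrC ler_norml.
by case: (leP t 0); case: (leP x 0); lra.
Qed.

(** * Delay terms: square integrable histories and tame trajectories *)

Section history.
Context (R : realType) (mu : R -> R).
Hypothesis hmu : admissible_kernel mu.
Local Notation halfline := (`]0, +oo[%classic : set R).
Local Notation wintegrable := (wintegrable mu).
Local Notation wint := (wint mu).
Implicit Types (F G p c g : R -> R) (s t r h : R).

Definition delay F t := wint (fun s => F (t - s)).

Lemma measurable_delay F t : measurable_fun setT F ->
  measurable_fun halfline (fun s => F (t - s)).
Proof.
move=> mF; apply: measurable_funTS; apply: (measurableT_comp mF).
exact: measurable_funB.
Qed.

(** Plays the role of the Cauchy-Schwarz inequality: [|G| <= e + G^2 / e] pointwise, and the kernel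
    has mass at most 1. *)
Lemma wint_small G (e : R) : measurable_fun halfline G ->
  wintegrable (fun s => G s ^+ 2) -> 0 < e ->
  `|wint G| <= e + wint (fun s => G s ^+ 2) / e.
Proof.
move=> mG iG e0; have iG1 := wintegrable_sqr hmu mG iG.
rewrite (le_trans (normr_wint hmu iG1))//.
have i1 := wintegrable_cst hmu e; have i2 := wintegrableZ e^-1 iG.
apply: (@le_trans _ _ (wint (fun s => e + e^-1 * G s ^+ 2))).
  apply: le_wint => //; [exact: wintegrable_norm|exact: wintegrableD|].
  move=> s s0; rewrite -(real_normK (num_real (G s))).
  rewrite -subr_ge0.
  have -> : e + e^-1 * `|G s| ^+ 2 - `|G s| =
     e^-1 * ((`|G s| - e / 2) ^+ 2 + 3 / 4 * e ^+ 2) by field; rewrite gt_eqF.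
  rewrite mulr_ge0 ?invr_ge0 ?(ltW e0)// addr_ge0 ?sqr_ge0// mulr_ge0 ?sqr_ge0//.
rewrite (wintD i1 i2) wint_cst// wintZ// [_ / e]mulrC lerD2r.
by rewrite ler_piMl ?(ltW e0)// mass_le1.
Qed.

(** The part of the past that remains once the value at the initial time is subtracted. Its only
    regularity is the continuity at [0+] of its translates in the weighted [L^2] space. *)
Record history p : Prop := {
  history_measurable : measurable_fun setT p ;
  history_future : forall t, 0 <= t -> p t = 0 ;
  history_integrable : wintegrable (fun s => p (- s) ^+ 2) ;
  history_continuous : forall e, 0 < e -> exists2 d, 0 < d & forall h, 0 <= h -> h < d ->
    wint (fun s => (p (h - s) - p (- s)) ^+ 2) < e }.

(** Right translation is a contraction for this weight: [p (t - s)] vanishes for [s <= t] and the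
    kernel is nonincreasing. *)
Lemma history_delay p t : history p -> 0 <= t ->
  wintegrable (fun s => p (t - s) ^+ 2) /\
  wint (fun s => p (t - s) ^+ 2) <= wint (fun s => p (- s) ^+ 2).
Proof.
move=> [mp fp ip _] t0.
have E s : t - (s + t) = - s by ring.
have := @wint_shift R mu hmu (fun s => p (t - s) ^+ 2) t 0 t0.
have mpt : measurable_fun halfline (fun s => p (t - s) ^+ 2).
  by apply: measurable_funX; exact: measurable_delay.
move=> /(_ mpt (fun s => sqr_ge0 _)).
have z s : 0 < s -> s <= t -> p (t - s) ^+ 2 <= 0.
  by move=> _ st; rewrite fp ?subr_ge0// expr0n.
move=> /(_ z (lexx 0)) /=.
have -> : (fun s => p (t - (s + t)) ^+ 2) = (fun s => p (- s) ^+ 2).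
  by apply/funext => s; rewrite E.
by rewrite mulr0 add0r; apply.
Qed.

Lemma history_delayB_integrable p r t : history p -> 0 <= r -> 0 <= t ->
  wintegrable (fun s => (p (r - s) - p (t - s)) ^+ 2).
Proof.
move=> hp r0 t0; have [i1 _] := history_delay hp r0; have [i2 _] := history_delay hp t0.
have mp := history_measurable hp.
have mN : measurable_fun halfline (fun s => - p (t - s)).
  by apply: measurableT_comp => //; exact: measurable_delay.
apply: (wintegrable_sqrD hmu (measurable_delay _ mp) mN i1).
by under eq_fun do rewrite sqrrN.
Qed.

(** Translating both delays back by [t] turns the modulus of continuity at the origin into one that
    is uniform in time. *)
Lemma history_delayB p r t : history p -> 0 <= t -> t <= r ->
  wint (fun s => (p (r - s) - p (t - s)) ^+ 2) <=
  wint (fun s => (p (r - t - s) - p (- s)) ^+ 2).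
Proof.
move=> hp t0 tr; have [mp fp ip _] := hp.
have E1 s : r - (s + t) = r - t - s by ring.
have E2 s : t - (s + t) = - s by ring.
have mpt : measurable_fun halfline (fun s => (p (r - s) - p (t - s)) ^+ 2).
  by apply: measurable_funX; apply: measurable_funB; exact: measurable_delay.
have := @wint_shift R mu hmu (fun s => (p (r - s) - p (t - s)) ^+ 2) t 0 t0 mpt
  (fun s => sqr_ge0 _).
have z s : 0 < s -> s <= t -> (p (r - s) - p (t - s)) ^+ 2 <= 0.
  move=> _ st; rewrite !fp ?subr_ge0// ?subrr ?expr0n//.
  exact: le_trans tr.
move=> /(_ z (lexx 0)) /=.
have -> : (fun s => (p (r - (s + t)) - p (t - (s + t))) ^+ 2) =
          (fun s => (p (r - t - s) - p (- s)) ^+ 2).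
  by apply/funext => s; rewrite E1 E2.
rewrite mulr0 add0r => h; apply: (h _).2.
have rt : 0 <= r - t by rewrite subr_ge0.
have := history_delayB_integrable hp rt (lexx 0).
by under eq_fun do rewrite sub0r.
Qed.

Lemma history_uniform p e : history p -> 0 < e -> exists2 d, 0 < d &
  forall r t, 0 <= r -> 0 <= t -> `|r - t| < d ->
    wint (fun s => (p (r - s) - p (t - s)) ^+ 2) < e.
Proof.
move=> hp e0; have [d d0 hd] := history_continuous hp e0; exists d => // r t.
wlog tr : r t / t <= r.
  move=> h r0 t0 rt; have [tr|/ltW tr] := leP t r; first exact: h.
  have -> : (fun s => (p (r - s) - p (t - s)) ^+ 2) =
            (fun s => (p (t - s) - p (r - s)) ^+ 2).
    by apply/funext => s; rewrite -sqrrN opprB.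
  by apply: h => //; rewrite distrC.
move=> r0 t0; rewrite ger0_norm ?subr_ge0// => rt.
by apply: (le_lt_trans (history_delayB hp t0 tr)); apply: hd; rewrite ?subr_ge0.
Qed.

Lemma delay_history_continuous p : history p ->
  continuous (fun t => delay p (Num.max t 0)).
Proof.
move=> hp; apply: continuous_dist => t e e0.
have e2 : 0 < e / 2 by rewrite divr_gt0.
(* The modulus is the square of [e / 2], so that [wint_small] used with [e / 2] yields
   [e / 2 + e / 2]. *)
have [d d0 hd] := history_uniform hp (mulr_gt0 e2 e2).
have m0 x : 0 <= Num.max x 0 :> R by rewrite le_max lexx orbT.
exists d => // x tx.
have xd : `|Num.max t 0 - Num.max x 0| < d.
  by rewrite (@le_lt_trans _ _ `|t - x|)//; exact: max0_lipschitz.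
have [i1 _] := history_delay hp (m0 t); have [i2 _] := history_delay hp (m0 x).
have mp := history_measurable hp.
rewrite /delay -wintB; last 2 first.
- exact: (wintegrable_sqr hmu (measurable_delay _ mp) i1).
- exact: (wintegrable_sqr hmu (measurable_delay _ mp) i2).
have iB := history_delayB_integrable hp (m0 t) (m0 x).
have mB : measurable_fun halfline (fun s => p (Num.max t 0 - s) - p (Num.max x 0 - s)).
  by apply: measurable_funB; exact: measurable_delay.
rewrite (le_lt_trans (wint_small mB iB e2))//.
rewrite [ltRHS](splitr e) ltrD2l ltr_pdivrMr//.
exact: hd.
Qed.

Lemma tame_measurable c g : tame c g -> measurable_fun setT c.
Proof. by move=> hc; apply: continuous_measurable_fun; exact: tame_continuous hc. Qed.

Lemma tame_bounded c g t : tame c g -> 0 <= t ->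
  exists B, forall x, x <= t -> `|c x| <= B.
Proof.
move=> hc t0; have [L L0 hL] := tame_lipschitz t hc; exists (`|c 0| + L * t) => x xt.
have [x0|x0] := leP x 0.
  by rewrite (tame_past hc x0) lerDl mulr_ge0.
rewrite -lerBlDl (le_trans (lerB_dist _ _))//.
have := hL 0 x t0 xt; rewrite subr0 (gtr0_norm x0) => h.
by rewrite (le_trans h)// ler_wpM2l.
Qed.

Lemma tame_delay_integrable c g t : tame c g -> 0 <= t ->
  wintegrable (fun s => c (t - s)) /\ wintegrable (fun s => c (t - s) ^+ 2).
Proof.
move=> hc t0; have [B hB] := tame_bounded hc t0; have mc := tame_measurable hc.
have hB' s : 0 < s -> `|c (t - s)| <= B by move=> s0; rewrite hB// gerBl ltW.
split; first exact: (wintegrable_bounded hmu (measurable_delay t mc) hB').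
apply: (wintegrable_bounded hmu (B := B ^+ 2)).
  by apply: measurable_funX; exact: measurable_delay.
move=> s s0; rewrite normrX ler_sqr ?nnegrE ?hB'//.
exact: le_trans (hB' _ s0).
Qed.

Lemma tame_delay_continuous c g : tame c g ->
  continuous (fun t => delay c (Num.max t 0)).
Proof.
move=> hc; apply: continuous_dist => t e e0.
have m0 x : 0 <= Num.max x 0 :> R by rewrite le_max lexx orbT.
have [L L0 hL] := tame_lipschitz (`|t| + 1) hc.
have L1 : 0 < L + 1 by rewrite ltr_wpDl.
exists (Num.min 1 (e / (L + 1))); first by rewrite lt_min ltr01 divr_gt0.
move=> x; rewrite lt_min => /andP[x1 tx].
have mt : Num.max t 0 <= `|t| + 1.
  by rewrite ge_max addr_ge0// andbT (le_trans (ler_norm _))// lerDl.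
have mx : Num.max x 0 <= `|t| + 1.
  rewrite ge_max addr_ge0// andbT.
  by have := ler_norm (x - t); have := ler_norm t; rewrite distrC; lra.
have xd : `|Num.max t 0 - Num.max x 0| <= `|t - x| by exact: max0_lipschitz.
have [i1 _] := tame_delay_integrable hc (m0 t).
have [i2 _] := tame_delay_integrable hc (m0 x).
rewrite /delay -wintB//.
have bd s : 0 < s -> `|c (Num.max t 0 - s) - c (Num.max x 0 - s)| <= L * `|t - x|.
  move=> s0; rewrite (le_trans (hL _ _ _ _))//.
  - by rewrite lerBlDr (le_trans mx)// lerDl ltW.
  - by rewrite lerBlDr (le_trans mt)// lerDl ltW.
  - by rewrite ler_wpM2l// (_ : _ - _ - (_ - _) = Num.max t 0 - Num.max x 0)//; ring.
rewrite (le_lt_trans (wint_bound hmu (wintegrableB i1 i2) bd))//.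
rewrite (@le_lt_trans _ _ (1 * (L * `|t - x|)))//.
  by rewrite ler_wpM2r ?mulr_ge0// mass_le1.
rewrite mul1r (@le_lt_trans _ _ ((L + 1) * `|t - x|))//.
  by rewrite ler_wpM2r// lerDl.
by rewrite mulrC -ltr_pdivlMr.
Qed.

End history.

Section dini.
Context (R : realType).

(* A one-sided comparison principle: only an upper right Dini bound and lower
   semicontinuity from the left are required, because the memory part of the
   energy need not be differentiable. *)
Lemma dini_gronwall (E : R -> R) (a b kap : R) : 0 <= kap -> a <= b -> 0 <= E a ->
  (forall t e, a <= t -> t < b -> 0 < e -> exists2 d, 0 < d &
    forall h, 0 < h -> h < d -> E (t + h) <= E t + h * (kap * E t + e)) ->
  (forall t e, a < t -> t <= b -> 0 < e -> exists2 d, 0 < d &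
    forall s, t - d < s -> s < t -> E t <= E s + e) ->
  forall t, a <= t <= b -> E t <= expR (kap * (t - a)) * E a.
Proof.
move=> k0 ab Ea0 right left t0 t0ab.
suff key e : 0 < e -> E t0 <= (E a + e * (1 + (t0 - a))) * expR (kap * (t0 - a)).
  apply/ler_addgt0Pl => e e0.
  pose D := (1 + (t0 - a)) * expR (kap * (t0 - a)).
  have D0 : 0 < D.
    by rewrite mulr_gt0 ?expR_gt0// ltr_pwDl// subr_ge0; case/andP: t0ab.
  have := key (e / D) (divr_gt0 e0 D0).
  rewrite mulrDl -mulrA -/D mulfVK ?gt_eqF//.
  by rewrite addrC [E a * _]mulrC.
move=> e0.
(* A barrier strictly above [E a] at time [a]. By [Bstep] it grows at least at the rate [kap B + e],
   the extra [e] absorbing the error in the Dini bound. *)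
pose B t := (E a + e * (1 + (t - a))) * expR (kap * (t - a)).
have Bmono s t : a <= s -> s <= t -> B s <= B t.
  move=> as_ st; rewrite /B ler_pM ?expR_ge0//.
  - by rewrite addr_ge0// mulr_ge0 ?(ltW e0)// addr_ge0// subr_ge0.
  - by rewrite lerD2l ler_pM2l// lerD2l lerB.
  - by rewrite ler_expR ler_wpM2l// lerB.
have Bge0 s : a <= s -> 0 <= B s.
  move=> as_; rewrite mulr_ge0 ?expR_ge0// addr_ge0// mulr_ge0 ?(ltW e0)//.
  by rewrite addr_ge0// subr_ge0.
have Bstep s h : a <= s -> 0 <= h -> B s * (1 + kap * h) + e * h <= B (s + h).
  move=> as_ h0; rewrite /B.
  have -> : kap * (s + h - a) = kap * (s - a) + kap * h by ring.
  rewrite expRD; set X := expR (kap * (s - a)).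
  have X1 : 1 <= X by rewrite /X -expR0 ler_expR mulr_ge0// subr_ge0.
  have Y1 : 1 + kap * h <= expR (kap * h) by exact: expR_ge1Dx.
  have kh0 : 0 <= kap * h by rewrite mulr_ge0.
  set Y := expR (kap * h) in Y1 *; set P := E a + e * (1 + (s - a)).
  have P0 : 0 <= P.
    by rewrite /P addr_ge0// mulr_ge0 ?(ltW e0)// addr_ge0// subr_ge0.
  have -> : E a + e * (1 + (s + h - a)) = P + e * h by rewrite /P; ring.
  have h1 : P * X * (1 + kap * h) <= P * X * Y by rewrite ler_wpM2l// mulr_ge0// (le_trans ler01).
  have XY : 1 <= X * Y.
    by rewrite -[leLHS]mulr1 ler_pM// (le_trans _ Y1)// lerDl.
  have h2 : e * h * 1 <= e * h * (X * Y) by rewrite ler_wpM2l// mulr_ge0// ltW.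
  by nra.
(* Continuation argument: semicontinuity from the left gives the inequality at [c = sup S], and the
   Dini bound then carries it beyond [c] unless [c = b]. *)
pose S := [set t | a <= t <= b /\ forall r, a <= r <= t -> E r <= B r].
have Sa : S a.
  split; first by rewrite lexx ab.
  move=> r; rewrite -eq_le => /eqP <-; rewrite /B subrr mulr0 expR0 mulr1 addr0 mulr1.
  by rewrite lerDl ltW.
have hS : has_sup S.
  by split; [exists a|exists b => t [/andP[]]].
pose c := sup S.
have ac : a <= c by apply: sup_ubound => //; exact: hS.2.
have cb : c <= b.
  by apply: ge_sup; [exists a|move=> t [/andP[]]].
have below r : a <= r -> r < c -> E r <= B r.
  move=> ar rc; have [s [_ hs] rs] := sup_gt (ex_intro _ a Sa) rc.
  by apply: hs; rewrite ar ltW.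
have Ec : E c <= B c.
  move: ac; rewrite le_eqVlt => /predU1P[<-|ac].
    by have [_] := Sa; apply; rewrite lexx.
  apply/ler_addgt0Pr => eta eta0.
  have [d d0 hd] := left c eta ac cb eta0.
  pose s := Num.max a (c - d / 2).
  have sc : s < c by rewrite /s gt_max ac ltrBlDr ltrDl divr_gt0.
  have as_ : a <= s by rewrite /s le_max lexx.
  rewrite (le_trans (hd s _ sc))//.
    by rewrite /s lt_max; apply/orP; right; rewrite ltrD2l ltrN2 ltr_pdivrMr// ltr_pMr// ltr1n.
  by rewrite lerD2r (le_trans (below _ as_ sc))// Bmono// ltW.
have upto r : a <= r <= c -> E r <= B r.
  move=> /andP[ar]; rewrite le_eqVlt => /predU1P[->//|]; exact: below.
have -> : (E a + e * (1 + (t0 - a))) * expR (kap * (t0 - a)) = B t0 by [].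
suff cE : c = b by apply: upto; rewrite cE.
apply/eqP; rewrite eq_le cb leNgt; apply/negP => cb'.
have [d d0 hd] := right c e ac cb' e0.
pose u := Num.min (c + d / 2) b.
have cu : c < u by rewrite lt_min cb' ltrDl divr_gt0.
have : S u.
  split; first by rewrite (le_trans ac (ltW cu)) /u ge_min lexx orbT.
  move=> r /andP[ar ru]; have [rc|cr] := leP r c; first by apply: upto; rewrite ar.
  have -> : r = c + (r - c) by ring.
  have rc0 : 0 < r - c by rewrite subr_gt0.
  have rd : r - c < d.
    rewrite ltrBlDl (le_lt_trans ru)// /u gt_min ltrD2l ltr_pdivrMr//.
    by rewrite ltr_pMr// ltr1n.
  rewrite (le_trans (hd _ rc0 rd))// (le_trans _ (Bstep c _ ac (ltW rc0)))//.
  rewrite mulrDr addrA [(r - c) * e]mulrC lerD2r.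
  have -> : E c + (r - c) * (kap * E c) = E c * (1 + kap * (r - c)) by ring.
  by rewrite ler_wpM2r// addr_ge0// mulr_ge0// ltW.
by move=> /(sup_ubound hS.2); rewrite leNgt cu.
Qed.

End dini.

(** * The Volterra equation for the acceleration *)

Section scalar_equation.
Context (R : realType) (mu : R -> R) (lam : R).
Hypothesis hmu : admissible_kernel mu.
Hypothesis lam_gt0 : 0 < lam.
Local Notation history := (history mu).
Implicit Types (p c g y z : R -> R) (t r x a b : R).

(** Position with initial value [a], initial velocity [b] and acceleration [y]. The maximum freezes
    it at [a] in the past, which makes it tame. *)
Definition twice_primitive a b y t := a + b * Num.max t 0 + primitive (primitive y) t.

Lemma max0_continuous : continuous (fun t : R => Num.max t 0).
Proof.
apply: continuous_dist => t e e0; exists e => // x; apply: le_lt_trans.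
exact: max0_lipschitz.
Qed.

Lemma tame_twice_primitive a b y : continuous y ->
  tame (twice_primitive a b y) (fun t => b + primitive y t).
Proof.
move=> cy; have cJ := primitive_continuous cy; have cJJ := primitive_continuous cJ.
split.
- move=> t t0; rewrite /twice_primitive !primitive_le0//.
  by rewrite !max_r.
- move=> t t0.
  have d1 := primitive_derive cJ t0.
  have d2 : is_derive t 1 (fun x : R => a + b * x + primitive (primitive y) x : R)
      (b + primitive y t).
    apply: is_derive_eq; rewrite /GRing.scale /=; ring.
  apply: (near_eq_is_derive _ d2).
  near=> x; rewrite /twice_primitive max_l//; apply: ltW.
  by near: x; exact: (cvgr_gt t).
- move=> t; apply: cvgD; last exact: cJJ.
  apply: cvgD; first exact: cvg_cst.
  by apply: cvgM; [exact: cvg_cst|exact: max0_continuous].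
- by move=> t; apply: cvgD; [exact: cvg_cst|exact: cJ].
Unshelve. all: by end_near. Qed.

(** This is [lam (mu * F - F)] for [F = p + c], as [p] vanishes at nonnegative times; it equals
    [- lam ((1 - mass) F + memory force)]. Clamping the time at 0 makes it continuous on the whole
    line, as the fixed point lemma requires. *)
Definition acceleration p c t : R :=
  lam * (delay mu p (Num.max t 0) + delay mu c (Num.max t 0) - c (Num.max t 0)).

Lemma acceleration_continuous p c g : history p -> tame c g ->
  continuous (acceleration p c).
Proof.
move=> hp hc t; apply: cvgM; first exact: cvg_cst.
apply: cvgB; last first.
  exact: (continuous_comp (@max0_continuous t) (@tame_continuous _ _ _ hc _)).
apply: cvgD; [exact: delay_history_continuous|exact: tame_delay_continuous hc _].
Qed.

Lemma delay_bound c g t (B : R) : tame c g -> 0 <= t -> 0 <= B ->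
  (forall r, r <= t -> `|c r| <= B) -> `|delay mu c t| <= B.
Proof.
move=> hc t0 B0 cB; have [ic _] := tame_delay_integrable hmu hc t0.
rewrite (le_trans (wint_bound hmu ic (B := B) _))//.
  by move=> s s0; rewrite cB// gerBl ltW.
by rewrite ler_piMl// mass_le1.
Qed.

Lemma eq_delay c c' t : (forall r, r <= t -> c r = c' r) -> delay mu c t = delay mu c' t.
Proof.
move=> cc; apply: eq_Rintegral => s; rewrite inE/= in_itv/= andbT => s0.
by rewrite cc// gerBl ltW.
Qed.

Variables (p : R -> R) (a b : R).
Hypothesis hp : history p.

Let Phi y := acceleration p (twice_primitive a b y).
(** Two integrations divide by [beta^2 = 4 lam], and delay plus value contribute [2 lam]: the
    contraction factor is 1/2. *)
Let beta := 2 * Num.sqrt lam.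
Let Q := wint mu (fun s => p (- s) ^+ 2).
(** Weighted bound of the first iterate: [1 + Q] bounds the history term, and [|a| + |b| r], with
    [r <= e^(beta r) / beta], occurs once in the delay and once in the value. *)
Let M0 := lam * (1 + Q + 2 * `|a| + 2 * `|b| / beta).

Let beta_gt0 : 0 < beta.
Proof. by rewrite mulr_gt0// sqrtr_gt0. Qed.

Let beta2 : beta ^+ 2 = 4 * lam.
Proof. by rewrite /beta exprMn sqr_sqrtr ?ltW//; ring. Qed.

Let Phi_continuous y : continuous y -> continuous (Phi y).
Proof. by move=> cy; apply: acceleration_continuous => //; exact: tame_twice_primitive. Qed.

Let Phi_past y t : t <= 0 -> Phi y t = Phi y 0.
Proof. by move=> t0; rewrite /Phi /acceleration !(max_r t0) maxxx. Qed.

Let Phi_contract y z M T : continuous y -> continuous z -> 0 <= M ->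
  (forall r, 0 <= r <= T -> `|y r - z r| <= M * expR (beta * r)) ->
  forall r, 0 <= r <= T -> `|Phi y r - Phi z r| <= M / 2 * expR (beta * r).
Proof.
move=> cy cz MM yz r /andP[r0 rT].
(* The history and the data [a], [b] cancel in the difference, which leaves a trajectory with zero
   initial data and zero past. *)
pose w t := y t - z t.
have cw : continuous w by move=> t; apply: cvgB; [exact: cy|exact: cz].
have cJw := primitive_continuous cw.
have Mb : 0 <= M / beta by rewrite divr_ge0// ltW.
have b1 x : 0 <= x <= T -> `|primitive w x| <= M / beta * expR (beta * x).
  move=> /andP[x0 xT]; apply: primitive_expR_bound => // s /andP[s0 sx].
  by apply: yz; rewrite s0 (le_trans sx).
have b2 x : 0 <= x <= T -> `|primitive (primitive w) x| <= M / beta / beta * expR (beta * x).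
  move=> /andP[x0 xT]; apply: primitive_expR_bound => // s /andP[s0 sx].
  by apply: b1; rewrite s0 (le_trans sx).
pose B := M / beta / beta * expR (beta * r).
have Bge0 : 0 <= B by rewrite mulr_ge0 ?expR_ge0// divr_ge0// ltW.
have b3 x : x <= r -> `|twice_primitive 0 0 w x| <= B.
  move=> xr; rewrite /twice_primitive mul0r !add0r; have [x0|x0] := leP x 0.
    by rewrite primitive_le0// normr0.
  rewrite (le_trans (b2 _ _))// ?(ltW x0)/= ?(le_trans xr)//.
  by rewrite ler_wpM2l ?divr_ge0 ?(ltW beta_gt0)// ler_expR ler_pM2l.
have hw := tame_twice_primitive 0 0 cw.
have hy := tame_twice_primitive a b cy; have hz := tame_twice_primitive a b cz.
have ewyz x : twice_primitive 0 0 w x = twice_primitive a b y x - twice_primitive a b z x.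
  rewrite /twice_primitive.
  have -> : primitive (primitive w) x = primitive (primitive y) x - primitive (primitive z) x.
    rewrite -primitiveB; [|exact: primitive_continuous..].
    by apply: eq_primitive => s _; rewrite primitiveB.
  move: (primitive (primitive y) x) (primitive (primitive z) x) (Num.max x 0).
  by move=> q1 q2 q3; ring.
have dw : delay mu (twice_primitive 0 0 w) r =
    delay mu (twice_primitive a b y) r - delay mu (twice_primitive a b z) r.
  rewrite /delay -wintB; last 2 first.
  - by have [] := tame_delay_integrable hmu hy r0.
  - by have [] := tame_delay_integrable hmu hz r0.
  by congr wint; apply/funext => s.
have alg (P y1 z1 y2 z2 : R) : lam * (P + y1 - y2) - lam * (P + z1 - z2) =
    lam * ((y1 - z1) - (y2 - z2)) by ring.
have -> : Phi y r - Phi z r =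
    lam * (delay mu (twice_primitive 0 0 w) r - twice_primitive 0 0 w r).
  transitivity (lam * ((delay mu (twice_primitive a b y) r -
      delay mu (twice_primitive a b z) r) -
      (twice_primitive a b y r - twice_primitive a b z r))).
    by rewrite /Phi /acceleration (max_l r0); exact: alg.
  by congr (lam * (_ - _)); [exact: esym dw|exact: esym (ewyz r)].
rewrite normrM (gtr0_norm lam_gt0).
apply: (@le_trans _ _ (lam * (B + B))).
  rewrite ler_pM2l// (le_trans (ler_normB _ _))// lerD//; last exact: b3.
  exact: (delay_bound hw).
rewrite /B; have -> : lam = beta ^+ 2 / 4 by rewrite beta2; field.
rewrite le_eqVlt; apply/orP; left; apply/eqP; field.
by rewrite gt_eqF.
Qed.

Let Phi_start r : 0 <= r -> `|Phi (fun=> 0) r| <= M0 * expR (beta * r).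
Proof.
move=> r0; rewrite /Phi /acceleration max_l// normrM (gtr0_norm lam_gt0) /M0 -mulrA.
rewrite ler_pM2l//.
have e1 : 1 <= expR (beta * r) by rewrite -expR0 ler_expR mulr_ge0// ltW.
have e2 : r <= expR (beta * r) / beta.
  rewrite ler_pdivlMr// mulrC (le_trans _ (expR_ge1Dx _))//.
  by rewrite lerDr ler01.
have c0 : continuous (fun _ : R => 0 : R) by move=> x; exact: cvg_cst.
have z x : primitive (fun _ : R => 0 : R) x = 0 by rewrite /primitive Rintegral_cst// mul0r.
have hc x : x <= r -> `|twice_primitive a b (fun=> 0) x| <= `|a| + `|b| * r.
  move=> xr; rewrite /twice_primitive.
  have -> : primitive (primitive (fun=> 0)) x = 0.
    by rewrite (_ : primitive (fun=> 0) = fun=> 0)//; apply/funext.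
  rewrite addr0 (le_trans (ler_normD _ _))// lerD2l normrM ler_wpM2l//.
  by rewrite ger0_norm ?le_max ?lexx ?orbT// ge_max xr.
have abr : 0 <= `|a| + `|b| * r by rewrite addr_ge0// mulr_ge0.
have h1 := delay_bound (tame_twice_primitive a b c0) r0 abr hc.
have h2 := hc r (lexx r).
have [i1 i2] := history_delay hmu hp r0.
have h3 := wint_small hmu (measurable_delay r (history_measurable hp)) i1 ltr01.
rewrite divr1 in h3; have {i2}h3 := le_trans h3 (lerD (lexx 1) i2).
rewrite (le_trans (ler_normB _ _))// (le_trans (lerD (ler_normD _ _) (lexx _)))//.
rewrite (le_trans (lerD (lerD h3 h1) h2))// -/Q.
have Q0 : 0 <= Q by apply: wint_ge0 => // s _; exact: sqr_ge0.
have hA : (1 + Q + 2 * `|a|) * 1 <= (1 + Q + 2 * `|a|) * expR (beta * r).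
  by rewrite ler_wpM2l// !addr_ge0// mulr_ge0.
have hb : `|b| * r <= `|b| / beta * expR (beta * r).
  by rewrite mulrAC -mulrA ler_wpM2l.
rewrite -[2 * `|b| / beta]mulrA mulrDl; move: hA hb.
move: (expR (beta * r)) (`|b| / beta) (`|b| * r) => x1 x2 x3.
lra.
Qed.

Lemma scalar_existence : exists y, [/\ continuous y,
  forall t, t <= 0 -> y t = y 0 &
  forall t, 0 <= t -> acceleration p (twice_primitive a b y) t = y t].
Proof.
have [y cy [yp yP]] := weighted_fixpoint beta_gt0 Phi_continuous Phi_past Phi_contract Phi_start.
by exists y.
Qed.

(** The delay at time [t] sees only positions up to [t], so the acceleration of [c] is a fixed point
    on [[0, T]] even though the equation for [c] stops at [T]. *)
Lemma scalar_uniqueness y c g T : 0 <= T -> continuous y -> tame c g ->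
  (forall t, 0 <= t <= T -> acceleration p (twice_primitive a b y) t = y t) ->
  (forall t, t <= T -> c t = twice_primitive a b (acceleration p c) t) ->
  forall t, t <= T -> c t = twice_primitive a b y t /\ acceleration p c t = y (Num.max t 0).
Proof.
move=> T0 cy hc yP cP t tT.
have cq := acceleration_continuous hp hc.
have qP r : 0 <= r <= T -> Phi (acceleration p c) r = acceleration p c r.
  move=> /andP[r0 rT]; rewrite /Phi /acceleration max_l//.
  have E x : x <= r -> twice_primitive a b (acceleration p c) x = c x.
    by move=> xr; rewrite cP// (le_trans xr).
  by rewrite (eq_delay E) E.
have yq r : 0 <= r <= T -> y r = acceleration p c r.
  by apply: (weighted_fixpoint_unique beta_gt0 Phi_contract cy cq).
split.
  rewrite (cP _ tT) /twice_primitive.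
  apply: (congr1 (fun x => _ + x)); apply: eq_primitive => r /andP[r0 rt]; apply: eq_primitive => s /andP[s0 sr].
  by rewrite yq// s0 (le_trans sr)// (le_trans rt).
rewrite yq; last by rewrite le_max lexx orbT ge_max tT T0.
by rewrite /acceleration (max_l (x := Num.max t 0))// le_max lexx orbT.
Qed.

End scalar_equation.

(** * Energy of a scalar solution *)

(** Takes the place of the mean value theorem for the velocity, whose derivative is known only
    almost everywhere and under the integral sign. *)
Lemma ae_Rintegral_bound (R : realType) (p : R -> R) (a b q C : R) :
  a <= b -> 0 <= C ->
  lebesgue_measure.-integrable `[a, b] (EFin \o p) ->
  {ae lebesgue_measure, forall r, a <= r <= b -> `|p r - q| <= C} ->
  `|\int[lebesgue_measure]_(r in `[a, b]) p r - (b - a) * q| <= (b - a) * C.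
Proof.
move=> ab C0 ip pq.
have mab : lebesgue_measure `[a, b]%classic = (b - a)%:E :> \bar R.
  rewrite lebesgue_measure_itv/= lte_fin; case: ltP => // ba.
  by have -> : a = b; [apply/eqP; rewrite eq_le ab ba|rewrite subrr].
have iq : lebesgue_measure.-integrable `[a, b] (EFin \o (fun _ : R => q)).
  apply: continuous_compact_integrable; first exact: segment_compact.
  by apply: continuous_subspaceT => x; exact: cvg_cst.
have -> : (b - a) * q = \int[lebesgue_measure]_(r in `[a, b]) q.
  rewrite Rintegral_cst// mulrC; congr (q * _).
  exact: (esym (congr1 fine mab)).
rewrite -RintegralB//.
have ipq : lebesgue_measure.-integrable `[a, b] (EFin \o (fun r => p r - q)).
  by apply: eq_integrable (integrableB _ ip iq).
rewrite -lee_fin EFin_normr_Rintegral// (le_trans (le_abse_integral _ _ _))//.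
  exact: measurable_int ipq.
apply: (@le_trans _ _ (\int[lebesgue_measure]_(r in `[a, b]) C%:E)%E); last first.
  rewrite integral_cst//; apply: (@le_trans _ _ (C%:E * (b - a)%:E)%E).
    by rewrite -mab.
  by rewrite -EFinM mulrC.
apply: ae_ge0_le_integral => //.
by apply: measurableT_comp => //; exact: measurable_int ipq.
Qed.

Section scalar_energy.
Context (R : realType) (mu : R -> R) (lam : R).
Hypothesis hmu : admissible_kernel mu.
Hypothesis lam_gt0 : 0 < lam.
Local Notation leb := (@lebesgue_measure R).
Local Notation halfline := (`]0, +oo[%classic : set R).
Implicit Types (f g k p : R -> R) (t r s h a b : R).

Definition memory_force f t := wint mu (fun s => f t - f (t - s)).

Definition memory_energy f t := wint mu (fun s => (f t - f (t - s)) ^+ 2).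

Definition scalar_energy f g t :=
  2^-1 * g t ^+ 2 + (1 - kernel_mass mu) / 2 * lam * f t ^+ 2 +
  lam / 2 * memory_energy f t.

(* The coordinate [f = <u, e>] of a solution along an eigenvector of [A] with
   eigenvalue [lam]; the acceleration [p] exists only in the weak sense. *)
Record scalar_solution k f g : Prop := {
  scalar_measurable : measurable_fun setT f ;
  scalar_integrable : forall t, 0 <= t ->
    wintegrable mu (fun s => (f t - f (t - s)) ^+ 2) ;
  scalar_derive : forall t, 0 < t -> is_derive t 1 f (g t) ;
  scalar_velocity : forall t, 0 < t -> {for t, continuous g} ;
  scalar_force : forall t, 0 < t -> {for t, continuous (memory_force f)} ;
  scalar_wave : exists2 p : R -> R,
    (forall a b, 0 < a -> a < b -> leb.-integrable `[a, b] (EFin \o p) /\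
       g b - g a = \int[leb]_(t in `[a, b]) p t) &
    {ae leb, forall t, 0 < t ->
      p t = - lam * ((1 - kernel_mass mu) * f t + memory_force f t) + k t * g t} }.

Variables (k f g : R -> R).
Hypothesis sol : scalar_solution k f g.
Let E := scalar_energy f g.
Let m := memory_force f.
Let mass := kernel_mass mu.

Let mass01 : 0 <= mass <= 1.
Proof. by rewrite mass_ge0// mass_le1. Qed.

Let measurable_delta t : measurable_fun halfline (fun s => f t - f (t - s)).
Proof.
apply: measurable_funB; first exact: measurable_cst.
exact: measurable_delay (scalar_measurable sol).
Qed.

Lemma memory_energy_ge0 t : 0 <= memory_energy f t.
Proof. by apply: wint_ge0 => // s _; exact: sqr_ge0. Qed.

Lemma scalar_energy_ge0 t : 0 <= E t.
Proof.
have /andP[m0 m1] := mass01.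
have mE := memory_energy_ge0 t; have l0 := ltW lam_gt0.
rewrite /E /scalar_energy; apply: addr_ge0; last first.
  by apply: mulr_ge0 => //; rewrite divr_ge0.
apply: addr_ge0; first by apply: mulr_ge0; rewrite ?sqr_ge0// invr_ge0.
have mm : 0 <= 1 - kernel_mass mu by rewrite subr_ge0.
apply: mulr_ge0; last exact: sqr_ge0.
by apply: mulr_ge0 => //; rewrite divr_ge0.
Qed.

(** The integral at time [t + h] is shifted by [h] in the delay variable. The part [s <= h] costs
    [mu 0 * h * B^2]; elsewhere the kernel can only have increased, and the square is expanded
    around [f t]. No derivative of the memory is taken, and the monotone kernel yields the
    dissipation as an inequality. *)
Lemma memory_energy_increment t h (B : R) : 0 <= t -> 0 <= h -> 0 <= B ->
  (forall r, t <= r <= t + h -> `|f (t + h) - f r| <= B) ->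
  memory_energy f (t + h) <= mu 0 * h * B ^+ 2 + memory_energy f t +
    2 * (f (t + h) - f t) * m t + (f (t + h) - f t) ^+ 2.
Proof.
move=> t0 h0 B0 fB; set df := f (t + h) - f t.
have iM := scalar_integrable sol t0.
have im := wintegrable_sqr hmu (measurable_delta t) iM.
have E1 s : t + h - (s + h) = t - s by ring.
have i1 := wintegrableZ (2 * df) im.
have i2 := wintegrable_cst hmu (df ^+ 2).
have i3 := wintegrableD (wintegrableD iM i1) i2.
have Ef : (fun s => (f (t + h) - f (t - s)) ^+ 2) =
    (fun s => (f t - f (t - s)) ^+ 2 + 2 * df * (f t - f (t - s)) + df ^+ 2).
  by apply/funext => s; rewrite /df; ring.
have mF : measurable_fun halfline (fun s => (f (t + h) - f (t + h - s)) ^+ 2).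
  by apply: measurable_funX; exact: measurable_delta.
have := @wint_shift R mu hmu _ h (B ^+ 2) h0 mF (fun s => sqr_ge0 _).
have zz s : 0 < s -> s <= h -> (f (t + h) - f (t + h - s)) ^+ 2 <= B ^+ 2.
  move=> s0 sh; rewrite -(real_normK (num_real (_ - _))) ler_sqr ?nnegrE//.
  by apply: fB; rewrite gerBl (ltW s0) andbT -addrA lerDl subr_ge0.
move=> /(_ zz (sqr_ge0 _)) /=.
have -> : (fun s => (f (t + h) - f (t + h - (s + h))) ^+ 2) =
          (fun s => (f (t + h) - f (t - s)) ^+ 2).
  by apply/funext => s; rewrite E1.
rewrite Ef => /(_ i3)[_]; rewrite /memory_energy => /le_trans; apply.
rewrite (wintD (wintegrableD iM i1) i2) (wintD iM i1) wintZ// wint_cst//.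
rewrite -!addrA lerD2l lerD2l lerD2l ler_piMl ?sqr_ge0//.
by case/andP: mass01.
Qed.

Let continuous_f t : 0 < t -> {for t, continuous f}.
Proof.
move=> t0; have [d _] := scalar_derive sol t0.
exact/differentiable_continuous/derivable1_diffP.
Qed.

(** The increment estimate, applied from [s] to [t], bounds the later memory energy by the earlier
    one and not conversely, which is exactly semicontinuity from the left. *)
Lemma scalar_energy_left t e : 0 < t -> 0 < e -> exists2 d, 0 < d &
  forall s, t - d < s -> s < t -> E t <= E s + e.
Proof.
move=> t0 e0; have /andP[ma0 ma1] := mass01.
have mu0 := kernel_ge0 hmu (lexx 0).
(* Each term of [E t - E s] is at most [e1] times a constant; [Q] adds these constants, plus 1 to be
   positive. *)
pose Q := 2^-1 * (2 * `|g t| + 1) + 2^-1 * lam * (2 * `|f t| + 1)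
          + lam / 2 * (mu 0 + 2 * (`|m t| + 1) + 1) + 1.
have Q0 : 0 < Q.
  have := normr_ge0 (g t); have := normr_ge0 (f t); have := normr_ge0 (m t).
  move: (`|g t|) (`|f t|) (`|m t|) => x y z z0 y0 x0.
  by rewrite /Q ltr_wpDl// !addr_ge0// !mulr_ge0 ?addr_ge0 ?mulr_ge0// ltW.
pose e1 := Num.min 1 (e / Q).
have e10 : 0 < e1 by rewrite lt_min ltr01 divr_gt0.
have [d1 d10 h1] := dist_continuous (continuous_f t0) e10.
have [d2 d20 h2] := dist_continuous (scalar_velocity sol t0) e10.
have [d3 d30 h3] := dist_continuous (scalar_force sol t0) e10.
exists (Num.min (Num.min 1 t) (Num.min d1 (Num.min d2 d3))).
  by rewrite !lt_min ltr01 t0 d10 d20 d30.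
move=> s ds st.
have {ds} : t - s < Num.min (Num.min 1 t) (Num.min d1 (Num.min d2 d3)) by lra.
rewrite !lt_min => /andP[/andP[ts1 tst] /and3P[td1 td2 td3]].
have ts0 : 0 < t - s by rewrite subr_gt0.
have ats : `|t - s| = t - s by rewrite gtr0_norm.
have s0 : 0 <= s by lra.
have f1 : `|f t - f s| < e1 by apply: h1; rewrite ats.
have g1 : `|g t - g s| < e1 by apply: h2; rewrite ats.
have m1 : `|m t - m s| < e1 by apply: h3; rewrite ats.
have ess : s + (t - s) = t by ring.
have fr r : s <= r <= s + (t - s) -> `|f (s + (t - s)) - f r| <= e1.
  rewrite ess => /andP[sr rt]; apply: ltW; apply: h1.
  by rewrite ger0_norm ?subr_ge0//; lra.
have := memory_energy_increment s0 (ltW ts0) (ltW e10) fr.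
rewrite ess => Minc.
have e1le1 : e1 <= 1 by rewrite /e1 ge_min lexx.
have e1Q : e1 * Q <= e by rewrite -ler_pdivlMr// /e1 ge_min lexx orbT.
have sq (x y : R) : `|x - y| < e1 -> x ^+ 2 - y ^+ 2 <= e1 * (2 * `|x| + 1).
  move=> xy; have -> : x ^+ 2 - y ^+ 2 = (x - y) * (2 * x - (x - y)) by ring.
  rewrite (le_trans (ler_norm _))// normrM ler_pM ?(ltW xy)//.
  rewrite (le_trans (ler_normB _ _))// normrM ger0_norm// lerD2l.
  by rewrite (le_trans (ltW xy)).
have gg := sq _ _ g1; have ff := sq _ _ f1.
have mt0 : 0 <= `|m t| by [].
have mm : 2 * (f t - f s) * m s <= e1 * (2 * (`|m t| + 1)).
  have ms : `|m s| <= `|m t| + 1.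
    have -> : m s = m t - (m t - m s) by ring.
    by rewrite (le_trans (ler_normB _ _))// lerD2l (le_trans (ltW m1)).
  have -> : e1 * (2 * (`|m t| + 1)) = 2 * (e1 * (`|m t| + 1)) by ring.
  rewrite -mulrA ler_pM2l// (le_trans (ler_norm _))// normrM.
  by rewrite ler_pM// ltW.
have ff0 : 0 <= `|f t| by []. have gg0 : 0 <= `|g t| by [].
have q1 : (f t - f s) ^+ 2 <= e1.
  rewrite -(real_normK (num_real (_ - _))) expr2.
  by rewrite -[leRHS]mulr1 ler_pM// ?ltW// (lt_le_trans f1).
have q2 : mu 0 * (t - s) * e1 ^+ 2 <= e1 * mu 0.
  rewrite -mulrA [e1 * _]mulrC ler_wpM2l// expr2 mulrA -[leRHS]mul1r ler_wpM2r ?(ltW e10)//.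
  by rewrite -[leRHS]mulr1 ler_pM// ltW.
have q3 : lam / 2 * (memory_energy f t - memory_energy f s) <=
          lam / 2 * (e1 * (mu 0 + 2 * (`|m t| + 1) + 1)).
  rewrite ler_wpM2l//; last by move: Minc mm q1 q2; lra.
  by rewrite divr_ge0// ltW.
have q4 : (1 - mass) / 2 * lam * (f t ^+ 2 - f s ^+ 2) <=
          2^-1 * lam * (e1 * (2 * `|f t| + 1)).
  apply: (@le_trans _ _ ((1 - mass) / 2 * lam * (e1 * (2 * `|f t| + 1)))).
    by rewrite ler_wpM2l// mulr_ge0 ?(ltW lam_gt0)// divr_ge0// subr_ge0.
  rewrite ler_wpM2r//; first by rewrite mulr_ge0 ?(ltW e10)// addr_ge0// mulr_ge0.
  by rewrite ler_wpM2r ?(ltW lam_gt0)// ler_pdivrMr// mulVf// gerBl.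
rewrite /E /scalar_energy -lerBlDl (le_trans _ e1Q)//.
rewrite /Q; have := ltW e10; move: q3 q4 gg; rewrite -/mass.
move: e1 (memory_energy f t) (memory_energy f s) {h1 h2 h3 e10 f1 g1 m1 fr Minc e1le1 e1Q sq ff mm q1 q2} => e1 Mt Ms.
lra.
Qed.

(** To first order [df] is [h g] and [dg] is [h q], up to the term in [k]. The powers of the elastic
    and memory forces cancel in [E], and there remains [h K g^2 <= h (2 K E)]. *)
Lemma scalar_energy_right t e (K h0 : R) : 0 < t -> 0 < e -> 0 <= K -> 0 < h0 ->
  (forall r, t <= r < t + h0 -> `|k r| <= K) -> exists2 d, 0 < d &
  forall h, 0 < h -> h < d -> E (t + h) <= E t + h * (2 * K * E t + e).
Proof.
move=> t0 e0 K0 h00 kK; have /andP[ma0 ma1] := mass01.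
have mu0 := kernel_ge0 hmu (lexx 0); have l0 := ltW lam_gt0.
(* The acceleration at [t] without the term in [k], which has no limit in general and is only
   bounded by [K |g|]. *)
pose q := - lam * ((1 - mass) * f t + m t).
pose c1 := 2 * lam + K.
pose Cg := `|q| + K * `|g t| + c1.
(* Total of the coefficients of [h e1] in the error terms below, with 1 added for positivity. *)
pose Q := c1 * `|g t| + lam * `|f t| + lam * `|m t| + 2 * lam * mu 0 +
          2^-1 * Cg ^+ 2 + lam * (`|g t| + 1) ^+ 2 + 1.
have c10 : 0 <= c1 by rewrite addr_ge0// mulr_ge0.
have Cg0 : 0 <= Cg by rewrite /Cg !addr_ge0// mulr_ge0.
have Q0 : 0 < Q.
  have a1 : 0 <= c1 * `|g t| by rewrite mulr_ge0.
  have a2 : 0 <= lam * `|f t| by rewrite mulr_ge0.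
  have a3 : 0 <= lam * `|m t| by rewrite mulr_ge0.
  have a4 : 0 <= lam * mu 0 by rewrite mulr_ge0.
  have a5 := sqr_ge0 Cg.
  have a6 : 0 <= lam * (`|g t| + 1) ^+ 2 by rewrite mulr_ge0// sqr_ge0.
  by rewrite /Q; lra.
have [e1 [e10 e1le1 e1Q]] : exists e1 : R, [/\ 0 < e1, e1 <= 1 & e1 * Q <= e].
  exists (Num.min 1 (e / Q)); split.
  - by rewrite lt_min ltr01 divr_gt0.
  - by rewrite ge_min lexx.
  - by rewrite -ler_pdivlMr// ge_min lexx orbT.
have [d1 d10 h1] := dist_continuous (continuous_f t0) e10.
have [d2 d20 h2] := dist_continuous (scalar_velocity sol t0) e10.
have [d3 d30 h3] := dist_continuous (scalar_force sol t0) e10.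
exists (Num.min (Num.min e1 h0) (Num.min d1 (Num.min d2 d3))).
  by rewrite !lt_min e10 h00 d10 d20 d30.
move=> h hh; rewrite !lt_min => /andP[/andP[he1 hh0] /and3P[hd1 hd2 hd3]].
have near (r : R) : t <= r <= t + h -> `|t - r| <= h.
  by move=> /andP[tr rth]; rewrite distrC ger0_norm ?subr_ge0// lerBlDl.
have fr r : t <= r <= t + h -> `|f t - f r| <= e1.
  by move=> /near rh; apply/ltW/h1; exact: le_lt_trans hd1.
have gr r : t <= r <= t + h -> `|g t - g r| <= e1.
  by move=> /near rh; apply/ltW/h2; exact: le_lt_trans hd2.
have mr r : t <= r <= t + h -> `|m t - m r| <= e1.
  by move=> /near rh; apply/ltW/h3; exact: le_lt_trans hd3.
have tth : t < t + h by rewrite ltrDl.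
pose df := f (t + h) - f t; pose dg := g (t + h) - g t.
have dfE : `|df - h * g t| <= h * e1.
  have dfg x : x \in `]t, (t + h)[ -> is_derive x 1 f (g x).
    by rewrite in_itv/= => /andP[tx _]; apply: (scalar_derive sol); exact: lt_trans tx.
  have cf : {within `[t, t + h], continuous f}.
    apply: continuous_in_subspaceT => x; rewrite inE/= in_itv/= => /andP[tx _].
    by apply: continuous_f; exact: lt_le_trans tx.
  have [x] := MVT tth dfg cf.
  rewrite in_itv/= addrAC subrr add0r => /andP[tx xth] Edf.
  rewrite /df Edf mulrC -mulrBr normrM (gtr0_norm hh) ler_pM2l// distrC.
  by apply: gr; rewrite !ltW.
have dgE : `|dg - h * q| <= h * (K * `|g t| + c1 * e1).
  have [p ip wp] := scalar_wave sol.
  have [ipt Edg] := ip t (t + h) t0 tth.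
  have C0 : 0 <= K * `|g t| + c1 * e1 by rewrite addr_ge0// mulr_ge0// ltW.
  have := @ae_Rintegral_bound R p t (t + h) q (K * `|g t| + c1 * e1) (ltW tth) C0 ipt.
  rewrite -Edg (_ : t + h - t = h); last by ring.
  apply; move: wp; apply: (@filterS _ (almost_everywhere leb)) => r wr /andP[tr rth].
  have rt : t <= r <= t + h by rewrite tr.
  rewrite wr ?(lt_le_trans t0)// -/(m r) -/mass /q.
  have -> : - lam * ((1 - mass) * f r + m r) + k r * g r - - lam * ((1 - mass) * f t + m t) =
     lam * ((1 - mass) * (f t - f r) + (m t - m r)) + k r * (g t - (g t - g r)) by ring.
  have kr : `|k r| <= K by apply: kK; rewrite tr (le_lt_trans rth)// ltrD2l.
  rewrite (le_trans (ler_normD _ _))// !normrM (gtr0_norm lam_gt0).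
  have b1 : `|(1 - mass) * (f t - f r) + (m t - m r)| <= 2 * e1.
    rewrite (le_trans (ler_normD _ _))// mulr_natl mulr2n lerD ?mr//.
    rewrite normrM ger0_norm ?subr_ge0// (le_trans _ (fr _ rt))//.
    by rewrite ler_piMl// gerBl.
  have b2 : `|k r| * `|g t - (g t - g r)| <= K * (`|g t| + e1).
    by rewrite ler_pM// (le_trans (ler_normB _ _))// lerD2l gr.
  have b3 : lam * `|(1 - mass) * (f t - f r) + (m t - m r)| <= lam * (2 * e1).
    by rewrite ler_pM2l.
  rewrite (le_trans (lerD b3 b2))// /c1 le_eqVlt; apply/orP; left; apply/eqP; ring.
have fB r : t <= r <= t + h -> `|f (t + h) - f r| <= 2 * e1.
  move=> rt; have -> : f (t + h) - f r = (f t - f r) - (f t - f (t + h)) by ring.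
  rewrite (le_trans (ler_normB _ _))// mulr_natl mulr2n lerD ?fr//.
  by rewrite (ltW tth) lexx.
have e20 : 0 <= 2 * e1 by rewrite mulr_ge0// ltW.
have := memory_energy_increment (ltW t0) (ltW hh) e20 fB; rewrite -/df => Minc.
have dg1 : `|dg| <= h * Cg.
  have -> : dg = (dg - h * q) + h * q by ring.
  rewrite (le_trans (ler_normD _ _))// [`|h * q|]normrM (gtr0_norm hh).
  rewrite (le_trans (lerD dgE (lexx _)))// -mulrDr ler_pM2l// /Cg.
  have : c1 * e1 <= c1 by rewrite ler_piMr.
  by lra.
have df1 : `|df| <= h * (`|g t| + 1).
  have -> : df = (df - h * g t) + h * g t by ring.
  rewrite (le_trans (ler_normD _ _))// [`|h * g t|]normrM (gtr0_norm hh).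
  rewrite (le_trans (lerD dfE (lexx _)))// -mulrDr ler_pM2l//; lra.
(* The condition [h <= e1] turns the quadratic terms, of order [h^2], into errors of order
   [h e1]. *)
have sqb (x B : R) : `|x| <= h * B -> x ^+ 2 <= h * (e1 * B ^+ 2).
  move=> xB; have hB : 0 <= h * B := le_trans (normr_ge0 _) xB.
  have B0 : 0 <= B by rewrite -(pmulr_rge0 _ hh).
  rewrite -(real_normK (num_real x)).
  apply: (@le_trans _ _ ((h * B) ^+ 2)); first by rewrite ler_sqr ?nnegrE.
  rewrite exprMn expr2 -mulrA ler_pM2l// ler_wpM2r ?sqr_ge0// ltW//.
have dg2 := sqb _ _ dg1; have df2 := sqb _ _ df1.
have prod (x y z B : R) : `|y - h * z| <= h * B -> x * y <= h * (x * z) + h * (`|x| * B).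
  move=> yz; have -> : x * y = h * (x * z) + x * (y - h * z) by ring.
  have -> : h * (`|x| * B) = `|x| * (h * B) by ring.
  by rewrite lerD2l (le_trans (ler_norm _))// normrM ler_wpM2l.
have p1 := prod (g t) dg q _ dgE.
have p2 := prod (f t) df (g t) _ dfE.
have p3 := prod (m t) df (g t) _ dfE.
have gK : K * g t ^+ 2 <= 2 * K * E t.
  rewrite [2 * K]mulrC -mulrA ler_wpM2l// /E /scalar_energy.
  have := memory_energy_ge0 t; have := sqr_ge0 (f t) => F0 M0.
  have x1 : 0 <= (1 - mass) * lam * f t ^+ 2.
    by rewrite mulr_ge0// mulr_ge0// subr_ge0.
  have x2 : 0 <= lam * memory_energy f t by rewrite mulr_ge0.
  by move: x1 x2; rewrite -/mass; lra.
have p2' : (1 - mass) * lam * (f t * df) <=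
    (1 - mass) * lam * (h * (f t * g t)) + lam * (h * (`|f t| * e1)).
  have w0 : 0 <= (1 - mass) * lam by rewrite mulr_ge0// subr_ge0.
  rewrite (le_trans (ler_wpM2l w0 p2))// mulrDr lerD2l ler_wpM2r//.
    by rewrite !mulr_ge0 ?(ltW hh)// ltW.
  by rewrite ler_piMl// gerBl.
have p3' : lam * (m t * df) <= lam * (h * (m t * g t)) + lam * (h * (`|m t| * e1)).
  by rewrite -mulrDr ler_pM2l.
have df2' : (1 - mass) * lam * df ^+ 2 + lam * df ^+ 2 <=
    2 * (lam * (h * (e1 * (`|g t| + 1) ^+ 2))).
  have x1 : lam * df ^+ 2 <= lam * (h * (e1 * (`|g t| + 1) ^+ 2)) by rewrite ler_pM2l.
  have x2 : (1 - mass) * (lam * df ^+ 2) <= lam * df ^+ 2.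
    by rewrite ler_piMl ?gerBl// mulr_ge0// sqr_ge0.
  by move: x1 x2; lra.
have M1 : lam / 2 * memory_energy f (t + h) <= lam / 2 * (mu 0 * h * (2 * e1) ^+ 2 +
    memory_energy f t + 2 * df * m t + df ^+ 2).
  by rewrite ler_wpM2l// divr_ge0.
have M2 : lam * (mu 0 * h * e1 ^+ 2) <= lam * (mu 0 * h * e1).
  rewrite ler_pM2l// ler_wpM2l ?mulr_ge0// ?(ltW hh)// expr2.
  by rewrite ler_piMl// ltW.
have gg : `|g t| * (K * `|g t| + c1 * e1) = K * g t ^+ 2 + c1 * `|g t| * e1.
  by rewrite -(real_normK (num_real (g t))); ring.
have hQ : h * (e1 * Q) <= h * e by rewrite ler_pM2l.
(* The power of the internal forces: it cancels the first-order variation of the elastic and memory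
   energies. *)
have gq : g t * q = - ((1 - mass) * lam * (f t * g t)) - lam * (m t * g t).
  by rewrite /q; ring.
have hgK : h * (K * g t ^+ 2) <= h * (2 * K * E t) by rewrite ler_pM2l.
rewrite mulrDr; move: hgK; move: (h * (2 * K * E t)) => Z hgK.
have h1e : 0 <= h * e1 by rewrite mulr_ge0// ltW.
rewrite /E /scalar_energy -/mass.
have -> : g (t + h) = g t + dg by rewrite /dg; ring.
have -> : f (t + h) = f t + df by rewrite /df; ring.
rewrite gg gq in p1; rewrite /Q in hQ.
move: p1 p2' p3' df2' dg2 M1 M2 hgK hQ h1e.
move: (memory_energy f (t + h)) (memory_energy f t) => Mh Mt.
clearbody df dg Cg c1 mass; clear - lam_gt0.
lra.
Qed.

Lemma scalar_energy_growth a b (K : R) : 0 < a -> a <= b -> 0 <= K ->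
  (forall r, a <= r < b -> `|k r| <= K) ->
  forall t, a <= t <= b -> E t <= expR (2 * K * (t - a)) * E a.
Proof.
move=> a0 ab K0 kK; apply: dini_gronwall => //.
- by rewrite mulr_ge0.
- exact: scalar_energy_ge0.
- move=> t e at_ tb e0; apply: (@scalar_energy_right _ _ K (b - t)) => //.
  + exact: lt_le_trans at_.
  + by rewrite subr_gt0.
  + move=> r /andP[tr rb]; apply: kK; rewrite (le_trans at_ tr)/=.
    by move: rb; rewrite addrC subrK.
- by move=> t e at_ _; apply: scalar_energy_left; exact: lt_trans at_.
Qed.

End scalar_energy.

(** * Modes of a solution *)

Section almost_everywhere_kernel.
Context (R : realType) (mu : R -> R).
Hypothesis hmu : admissible_kernel mu.
Local Notation leb := (@lebesgue_measure R).
Local Notation halfline := (`]0, +oo[%classic : set R).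

Lemma mu_aeW (P Q : R -> Prop) : (forall s, 0 < s -> 0 < mu s -> P s -> Q s) ->
  mu_ae mu P -> mu_ae mu Q.
Proof.
move=> PQ; rewrite /mu_ae; apply: (@filterS _ (almost_everywhere leb)) => s h s0 ms.
by apply: PQ => //; exact: h.
Qed.

Lemma mu_aeI (P Q : R -> Prop) : mu_ae mu P -> mu_ae mu Q ->
  mu_ae mu (fun s => P s /\ Q s).
Proof.
rewrite /mu_ae; apply: (@filterS2 _ (almost_everywhere leb)) => s h1 h2 s0 ms.
by split; [exact: h1|exact: h2].
Qed.

Let kernel_weight_eq (F G : R -> R) s : 0 < s ->
  (0 < s -> 0 < mu s -> F s = G s) -> mu s * F s = mu s * G s.
Proof.
move=> s0 h; have := kernel_ge0 hmu (ltW s0).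
by rewrite le_eqVlt => /predU1P[<-|ms]; rewrite ?mul0r// h.
Qed.

Lemma mu_ae_wint (F G : R -> R) : mu_ae mu (fun s => F s = G s) ->
  wint mu F = wint mu G.
Proof.
move=> FG; apply: ae_eq_Rintegral; move: FG.
apply: (@filterS _ (almost_everywhere leb)) => s h; rewrite /= in_itv/= andbT => s0.
exact: kernel_weight_eq.
Qed.

Lemma mu_ae_integral (F G : R -> R) : mu_ae mu (fun s => F s = G s) ->
  (\int[leb]_(s in halfline) (mu s * F s)%:E = \int[leb]_(s in halfline) (mu s * G s)%:E)%E.
Proof.
move=> FG; apply: ae_eq_integral_any; move: FG.
apply: (@filterS _ (almost_everywhere leb)) => s h; rewrite /= in_itv/= andbT => s0.
by congr EFin; exact: kernel_weight_eq.
Qed.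

(** The kernel may vanish from some point on; being nonincreasing, it is positive at [s - t]
    whenever it is at [s], so the exceptional set is merely translated. *)
Lemma mu_ae_shift (P : R -> Prop) t : 0 <= t -> mu_ae mu P ->
  mu_ae mu (fun s => t < s -> P (s - t)).
Proof.
move=> t0 [N [mN N0 sub]].
pose N' := (fun x : measurableTypeR R => (x : R) + - t : measurableTypeR R) @^-1` N.
exists N'; split.
- by rewrite -[N']setTI; exact: (measurable_shift (- t)).
- by rewrite -N0 -(lebesgue_measure_shift (- t) mN).
- move=> s /= h; rewrite /N' /=; apply: sub => /= h2; apply: h => s0 ms ts.
  apply: h2; first by rewrite subr_gt0.
  apply: (lt_le_trans ms); apply: kernel_nincr => //; first by rewrite subr_ge0 ltW.
  by rewrite gerBl.
Qed.

Definition kernel_support := halfline `&` [set s | 0 < mu s].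

Lemma kernel_support_measurable : measurable kernel_support.
Proof.
have := kernel_measurable hmu (measurable_itv _) (measurable_itv `]0, +oo[).
congr measurable; rewrite predeqE => s; split=> -[h1 h2]; split=> //.
- by move: h2; rewrite /= in_itv/= andbT.
- by rewrite /= in_itv/= andbT.
Qed.

Context (H : completeNormedModType R).

Lemma simple_function_measurable (g : R -> H) (h : H -> R) :
  simple_function g -> measurable_fun setT (h \o g).
Proof.
move=> [fg mg] _ Y _; rewrite setTI.
have -> : (h \o g) @^-1` Y = \bigcup_(y in range g `&` h @^-1` Y) g @^-1` [set y].
  rewrite predeqE => s; split=> [hs|[y [_ hy] /= gs]]; last by rewrite /= gs.
  by exists (g s) => //; split=> //; exists s.
apply: fin_bigcup_measurable => [|y _]; last exact: mg.
exact: finite_setIl.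
Qed.

(** Off a single null set, [h (B w)] is a pointwise limit of real simple functions. Vector-valued
    measurability is thus used only through real functions. *)
Lemma mu_regular (B : operator H) (w : R -> H) :
  mu_ae mu (fun s => dom B (w s)) -> strongly_measurable mu (fun s => B (w s)) ->
  exists D : set R, [/\ measurable D, D `<=` kernel_support, mu_ae mu D,
    forall s, D s -> dom B (w s) &
    forall h : H -> R, continuous h -> measurable_fun D (fun s => h (B (w s)))].
Proof.
move=> dw [g sg gw].
have [N [mN N0 sub]] := mu_aeI dw gw.
have msupp := kernel_support_measurable.
exists (kernel_support `\` N); split.
- exact: measurableD.
- exact: subDsetl.
- exists N; split=> // s /= h; apply: contrapT => Ns; apply: h => s0 ms.
  by split=> //; split=> //; rewrite /= in_itv/= andbT.
- move=> s [[/= s0 ms] Ns]; apply: contrapT => nd; apply: Ns; apply: sub => /= h.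
  by move: s0; rewrite in_itv/= andbT => s0; have [] := h s0 ms.
- move=> h ch; apply: (@measurable_fun_cvg _ _ _ _ (fun n => h \o g n)).
    by move=> n; apply: measurable_funTS; exact: simple_function_measurable.
  move=> s [[/= s0 ms] Ns]; apply: continuous_cvg; first exact: ch.
  apply: contrapT => nd; apply: Ns; apply: sub => /= h2.
  by move: s0; rewrite in_itv/= andbT => s0; have [] := h2 s0 ms.
Qed.

Lemma mu_representative (B : operator H) (w : R -> H) (h : H -> R) :
  mu_ae mu (fun s => dom B (w s)) -> strongly_measurable mu (fun s => B (w s)) ->
  continuous h ->
  exists2 W : R -> R, measurable_fun setT W & mu_ae mu (fun s => W s = h (B (w s))).
Proof.
move=> dw /(mu_regular dw)[D [mD Dsub aD _ mh]] ch.
exists ((fun s => h (B (w s))) \_ D); first by apply/(measurable_restrictT _ mD); exact: mh.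
by apply: mu_aeW aD => s _ _ Ds; rewrite patchT// inE.
Qed.

Lemma sqr_norm_continuous : continuous (fun x : H => `|x| ^+ 2).
Proof. by move=> x; apply: cvgM; exact: norm_continuous. Qed.

(** The integrand in [L2mu] need not itself be measurable, so it is exchanged for a measurable
    representative before the comparison. *)
Lemma L2mu_wintegrable (B : operator H) (w : R -> H) (W : R -> R) :
  L2mu mu B w -> measurable_fun halfline W ->
  mu_ae mu (fun s => `|W s| <= `|B (w s)| ^+ 2) -> wintegrable mu W.
Proof.
move=> [dw sw fin] mW Wle.
have [Q mQ Qae] := mu_representative dw sw sqr_norm_continuous.
have mmu := kernel_measurable hmu.
apply/integrableP; split.
  by apply/measurable_EFinP; exact: measurable_funM.
apply: le_lt_trans fin.
rewrite -(mu_ae_integral Qae).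
have Q' : mu_ae mu (fun s => Q s = `|Q s|).
  by apply: mu_aeW Qae => s _ _ ->; rewrite ger0_norm// sqr_ge0.
rewrite (mu_ae_integral Q').
have mQ' : measurable_fun halfline Q by exact: measurable_funTS.
apply: ae_ge0_le_integral => //.
- by do 2 apply: measurableT_comp => //; exact: measurable_funM.
- move=> s; rewrite /= in_itv/= andbT => s0; rewrite lee_fin mulr_ge0//.
  by rewrite (kernel_ge0 hmu)// ltW.
- apply/measurable_EFinP; apply: measurable_funM => //.
  exact: measurableT_comp.
- move: (mu_aeI Qae Wle); rewrite /mu_ae.
  apply: (@filterS _ (almost_everywhere leb)) => s h; rewrite /= in_itv/= andbT => s0.
  rewrite lee_fin normrM; have := kernel_ge0 hmu (ltW s0).
  rewrite le_eqVlt => /predU1P[<-|ms]; first by rewrite normr0 !mul0r.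
  have [-> Wl] := h s0 ms.
  by rewrite gtr0_norm// ler_pM2l// [leRHS]ger0_norm// sqr_ge0.
Qed.

Lemma simple_functionB (g1 g2 : R -> H) : simple_function g1 -> simple_function g2 ->
  simple_function (fun s => g1 s - g2 s).
Proof.
move=> [f1 m1] [f2 m2]; split.
  apply: (@sub_finite_set _ _ [set x - y | x in range g1 & y in range g2]).
    by move=> _ [s _ <-]; exists (g1 s); [exists s|exists (g2 s) => //; exists s].
  exact: finite_image2.
move=> y.
have -> : (fun s => g1 s - g2 s) @^-1` [set y] =
    \bigcup_(z in range g1) (g1 @^-1` [set z] `&` g2 @^-1` [set z - y]).
  rewrite predeqE => s; split=> [/= <-|[z _ [/= -> ->]]].
    by exists (g1 s); [exists s|split=> //=; rewrite opprB addrC subrK].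
  by rewrite opprB addrC subrK.
by apply: fin_bigcup_measurable => // z _; apply: measurableI.
Qed.

Lemma L2mu_wintegrable_sqr (B : operator H) (w : R -> H) : L2mu mu B w ->
  exists2 W : R -> R, wintegrable mu W &
    measurable_fun setT W /\ mu_ae mu (fun s => W s = `|B (w s)| ^+ 2).
Proof.
move=> Lw; have [dw sw fin] := Lw.
have [Q mQ Qae] := mu_representative dw sw sqr_norm_continuous.
exists Q => //; apply: (L2mu_wintegrable Lw); first exact: measurable_funTS.
by apply: mu_aeW Qae => s _ _ ->; rewrite ger0_norm// sqr_ge0.
Qed.

Lemma L2muB (B : operator H) (w1 w2 : R -> H) : linear_operator B ->
  L2mu mu B w1 -> L2mu mu B w2 -> L2mu mu B (fun s => w1 s - w2 s).
Proof.
move=> Bl L1 L2; have [d1 [g1 sg1 gw1] _] := L1; have [d2 [g2 sg2 gw2] _] := L2.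
have d12 := mu_aeI d1 d2.
have d3 : mu_ae mu (fun s => dom B (w1 s - w2 s)).
  by apply: mu_aeW d12 => s _ _ [h1 h2]; have [] := operatorB Bl h1 h2.
have s3 : strongly_measurable mu (fun s => B (w1 s - w2 s)).
  exists (fun n s => g1 n s - g2 n s); first by move=> n; exact: simple_functionB.
  apply: mu_aeW (mu_aeI d12 (mu_aeI gw1 gw2)) => s _ _ [[h1 h2] [c1 c2]].
  by have [_ ->] := operatorB Bl h1 h2; apply: cvgB.
split=> //.
have [W1 iW1 [mW1 aW1]] := L2mu_wintegrable_sqr L1.
have [W2 iW2 [mW2 aW2]] := L2mu_wintegrable_sqr L2.
have [W3 mW3 aW3] := mu_representative d3 s3 sqr_norm_continuous.
pose G s := 2 * (`|W1 s| + `|W2 s|).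
have iG : wintegrable mu G.
  by apply: wintegrableZ; apply: wintegrableD; apply: wintegrable_norm.
(* The minimum makes the domination by [G] hold everywhere; almost everywhere it is [|W3|], by
   [|x - y|^2 <= 2 (|x|^2 + |y|^2)]. *)
pose F s := Num.min `|W3 s| (G s).
have G0 s : 0 <= G s by rewrite mulr_ge0// addr_ge0.
have iF : wintegrable mu F.
  apply: (le_wintegrable hmu _ _ iG).
    apply: measurable_funTS; apply: measurable_minr; first exact: measurableT_comp.
    apply: measurable_funM => //.
    by apply: measurable_funD; exact: measurableT_comp.
  by move=> s _; rewrite /F ger0_norm ?le_min ?normr_ge0 ?G0// ge_min lexx orbT.
have FE : mu_ae mu (fun s => F s = `|B (w1 s - w2 s)| ^+ 2).
  apply: mu_aeW (mu_aeI d12 (mu_aeI aW3 (mu_aeI aW1 aW2))).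
  move=> s _ _ [[h1 h2] [e3 [e1 e2]]].
  rewrite /F /G e1 e2 e3 !ger0_norm ?sqr_ge0// min_l//.
  have [_ ->] := operatorB Bl h1 h2.
  have : `|B (w1 s) - B (w2 s)| ^+ 2 <= (`|B (w1 s)| + `|B (w2 s)|) ^+ 2.
    by rewrite ler_sqr ?nnegrE ?addr_ge0// ler_normB.
  have := sqr_ge0 (`|B (w1 s)| - `|B (w2 s)|); nra.
rewrite -(mu_ae_integral FE).
exact: (integrable_lty _ iF).
Qed.

End almost_everywhere_kernel.

Section coordinate.
Context (R : realType) (H : completeNormedModType R) (dot : {dot H for idfun}).
Hypothesis hdot : induces_norm dot.
Variables (A Ah : operator H) (mu k : R -> R) (lam : R) (e : H).
Hypothesis hmu : admissible_kernel mu.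
Hypotheses (Ahlin : linear_operator Ah) (Ahsa : self_adjoint dot Ah).
Hypotheses (lam_gt0 : 0 < lam) (dome : dom Ah e) (Ahe : Ah e = Num.sqrt lam *: e).
Hypothesis norme : `|e| = 1.
Variables (u0 : R -> H) (u1 : H) (u v : R -> H).
Hypothesis sol : solution dot A Ah mu k u0 u1 u v.
Local Notation leb := (@lebesgue_measure R).
Local Notation halfline := (`]0, +oo[%classic : set R).
Implicit Types (t r s : R) (w : H).

Let phi t := dot (u t) e.
Let psi t := dot (v t) e.

Let sqrt_lam_gt0 : 0 < Num.sqrt lam.
Proof. by rewrite sqrtr_gt0. Qed.

Let sqrt_lam2 : Num.sqrt lam ^+ 2 = lam.
Proof. by rewrite sqr_sqrtr// ltW. Qed.

Lemma dot_eigenvector w : dom Ah w -> dot (Ah w) e = Num.sqrt lam * dot w e.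
Proof. by move=> dw; rewrite (self_adjoint_sym Ahsa dw dome) Ahe dotZr. Qed.

Lemma dot_eigenvector_le w : dom Ah w -> lam * dot w e ^+ 2 <= `|Ah w| ^+ 2.
Proof.
move=> dw; rewrite -sqrt_lam2 -exprMn -(dot_eigenvector dw).
exact: (dot_sqr_le hdot).
Qed.

Let dot_eta t s : dot (eta u t s) e = phi t - phi (t - s).
Proof. by rewrite /eta dotBl. Qed.

Lemma solution_L2mu t : 0 <= t -> L2mu mu Ah (eta u t).
Proof. by move=> t0; have [] := solution_phase sol t0. Qed.

Lemma solution_dom t : 0 <= t -> dom Ah (u t).
Proof. by move=> t0; have [] := solution_phase sol t0. Qed.

(** Integrated Bessel inequality for one vector. The squared norm is written as the squared
    coordinate [Q] plus a nonnegative remainder [V], both through measurable representatives, so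
    that additivity applies. *)
Lemma mode_wint_le (z : R -> H) (F : R -> R) : L2mu mu Ah z ->
  mu_ae mu (fun s => F s = dot (z s) e ^+ 2) ->
  lam * wint mu F <= wint mu (fun s => `|Ah (z s)| ^+ 2).
Proof.
move=> Lz Fz; have [dz sz _] := Lz.
have cd := @dot_continuousl _ _ _ hdot e.
have cd2 : continuous (fun x => dot x e ^+ 2) by move=> x; apply: cvgM; exact: cd.
have cV : continuous (fun x : H => `| `|x| ^+ 2 - dot x e ^+ 2 |).
  by move=> x; apply: cvg_norm; apply: cvgB; [exact: sqr_norm_continuous|exact: cd2].
have [Q mQ Qae] := mu_representative hmu dz sz cd2.
have [V mV Vae] := mu_representative hmu dz sz cV.
have dle (x : H) : dot x e ^+ 2 <= `|x| ^+ 2 by exact: dot_sqr_le.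
have iQ : wintegrable mu Q.
  apply: (L2mu_wintegrable hmu Lz); first exact: measurable_funTS.
  by apply: mu_aeW Qae => s _ _ ->; rewrite ger0_norm ?sqr_ge0.
have iV : wintegrable mu V.
  apply: (L2mu_wintegrable hmu Lz); first exact: measurable_funTS.
  apply: mu_aeW Vae => s _ _ ->; rewrite normr_id ger0_norm ?subr_ge0//.
  by rewrite gerBl sqr_ge0.
have FQ : mu_ae mu (fun s => F s = lam^-1 * Q s).
  apply: mu_aeW (mu_aeI dz (mu_aeI Fz Qae)) => s _ _ [ds [-> ->]].
  rewrite (dot_eigenvector ds) exprMn sqrt_lam2 mulKf//.
  by rewrite gt_eqF.
rewrite (mu_ae_wint hmu FQ) wintZ// mulVKf ?gt_eqF//.
have -> : wint mu (fun s => `|Ah (z s)| ^+ 2) = wint mu (fun s => Q s + `|V s|).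
  apply: (mu_ae_wint hmu); apply: mu_aeW (mu_aeI Qae Vae) => s _ _ [-> ->].
  by rewrite normr_id ger0_norm ?subr_ge0// addrC subrK.
rewrite wintD//; last exact: wintegrable_norm.
by rewrite lerDl; apply: wint_ge0.
Qed.

Lemma mode_continuity t (eps : R) : 0 <= t -> 0 < eps -> exists2 d, 0 < d &
  forall r, 0 <= r -> `|t - r| < d ->
    [/\ (phi r - phi t) ^+ 2 < eps, (psi r - psi t) ^+ 2 < eps &
        wint mu (fun s => (phi r - phi (r - s) - (phi t - phi (t - s))) ^+ 2) < eps].
Proof.
move=> t0 eps0.
have m1 : 0 < 1 - kernel_mass mu by rewrite subr_gt0 kernel_mass_lt1.
(* A common lower bound of the weights [1], [lam] and [(1 - mass) lam] carried by the three
   quantities in [phase_norm2]. *)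
have [c [c0 c1 c2 c3]] : exists c : R,
    [/\ 0 < c, c <= 1, c <= lam & c <= (1 - kernel_mass mu) * lam].
  exists (Num.min 1 (Num.min lam ((1 - kernel_mass mu) * lam))); split.
  - by rewrite !lt_min ltr01 lam_gt0 mulr_gt0.
  - by rewrite ge_min lexx.
  - by rewrite !ge_min lexx orbT.
  - by rewrite !ge_min lexx !orbT.
have /(@cvgrPdist_lt R R^o)/(_ _ (mulr_gt0 c0 eps0))[d /= d0 hd] := solution_continuous sol t0.
exists d => // r r0 tr; have := hd r tr; rewrite /= in_itv/= andbT => /(_ r0).
have [/= dr Lr] := solution_phase sol r0; have [/= dt Lt] := solution_phase sol t0.
rewrite sub0r normrN => /(le_lt_trans (ler_norm _)); rewrite /phase_norm2 /=.
have [dur _] := operatorB Ahlin dr dt.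
have I1 := @mode_wint_le (fun s => eta u r s - eta u t s)
  (fun s => (phi r - phi (r - s) - (phi t - phi (t - s))) ^+ 2) (L2muB hmu Ahlin Lr Lt).
have {}I1 : lam * wint mu (fun s => (phi r - phi (r - s) - (phi t - phi (t - s))) ^+ 2)
    <= wint mu (fun s => `|Ah (eta u r s - eta u t s)| ^+ 2).
  apply: I1; rewrite /mu_ae; apply: nearW => s _ _.
  by rewrite dotBl !dot_eta.
have I2 := dot_eigenvector_le dur; rewrite dotBl -/(phi r) -/(phi t) in I2.
have I3 : (psi r - psi t) ^+ 2 <= `|v r - v t| ^+ 2.
  by rewrite -dotBl; exact: dot_sqr_le.
rewrite -/(wint mu (fun s => `|Ah (eta u r s - eta u t s)| ^+ 2)).
set W := wint mu (fun s => `|Ah _| ^+ 2) in I1 *.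
set w := wint mu _ in I1 *.
move: I2 I3; set X := (phi r - phi t) ^+ 2; set Y := (psi r - psi t) ^+ 2.
have X0 : 0 <= X by exact: sqr_ge0. have Y0 : 0 <= Y by exact: sqr_ge0.
have w0 : 0 <= w by apply: wint_ge0 => // s _; exact: sqr_ge0.
move=> I2 I3 tot.
have I2' : (1 - kernel_mass mu) * (lam * X) <= (1 - kernel_mass mu) * `|Ah (u r - u t)| ^+ 2.
  by rewrite ler_pM2l.
have J1 : c * X <= (1 - kernel_mass mu) * lam * X by rewrite ler_wpM2r.
have J2 : c * Y <= 1 * Y by rewrite ler_wpM2r.
have J3 : c * w <= lam * w by rewrite ler_wpM2r.
have cX : 0 <= c * X by rewrite mulr_ge0// ltW.
have cY : 0 <= c * Y by rewrite mulr_ge0// ltW.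
have cw : 0 <= c * w by rewrite mulr_ge0// ltW.
suff : [/\ c * X < c * eps, c * Y < c * eps & c * w < c * eps].
  by rewrite !(ltr_pM2l c0).
have alg (x y z P N Z E : R) : 0 <= x -> 0 <= y -> 0 <= z -> x <= P -> y <= N ->
    z <= Z -> P + N + Z < E -> [/\ x < E, y < E & z < E] by move=> *; split; lra.
apply: (alg _ _ _ _ _ _ _ cX cY cw _ _ _ tot).
- by apply: (le_trans J1); rewrite -mulrA.
- by apply: (le_trans J2); rewrite mul1r.
- exact: (le_trans J3).
Qed.

(** At negative times [phi] is controlled only through [eta^0], outside a null set, and need not be
    measurable. Correcting it there alters no delay integral, by [mu_ae_shift]. *)
Lemma mode_representative : exists f : R -> R,
  [/\ measurable_fun setT f, forall t, 0 <= t -> f t = phi t &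
      forall t, 0 <= t -> mu_ae mu (fun s => f (t - s) = phi (t - s))].
Proof.
have [deta seta _] := solution_L2mu (lexx 0).
have [D [mD sD aD dD hD]] := mu_regular hmu deta seta.
pose G := (fun s => phi (- s) - phi 0) \_ D.
have mG : measurable_fun setT G.
  apply/(measurable_restrictT _ mD).
  apply: (@eq_measurable_fun _ _ _ _ _
    (fun s => - (Num.sqrt lam)^-1 * dot (Ah (eta u 0 s)) e)).
    move=> s; rewrite inE => Ds; rewrite dot_eigenvector; last exact: dD.
    by rewrite mulrA mulNr mulVf ?gt_eqF// mulN1r dot_eta sub0r opprB.
  by apply: measurable_funM => //; apply: (hD (fun x => dot x e)); exact: (dot_continuousl hdot).
have cphi : continuous (fun t => phi (Num.max t 0)).
  apply: continuous_dist => t eps eps0.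
  have m0 x : 0 <= Num.max x 0 :> R by rewrite le_max lexx orbT.
  have [d d0 hd] := mode_continuity (m0 t) (mulr_gt0 eps0 eps0).
  exists d => // x tx.
  have [h _ _] := hd _ (m0 x) (le_lt_trans (max0_lipschitz _ _) tx).
  rewrite distrC -(@ltr_pXn2r _ 2)// ?nnegrE ?(ltW eps0)//.
  by rewrite real_normK ?num_real.
(* The first term is [phi] frozen at [phi 0] in the past, and [G] restores the past relative to
   [phi 0] on the good set [D]; it vanishes for [r >= 0]. *)
pose f r := phi (Num.max r 0) + G (- r).
have Gneg s : s <= 0 -> G s = 0.
  move=> s0; rewrite /G patchN//; apply/negP; rewrite inE => /sD[].
  by rewrite /= in_itv/= andbT ltNge s0.
have f0 t : 0 <= t -> f t = phi t.
  by move=> t0; rewrite /f max_l// Gneg ?addr0// oppr_le0.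
exists f; split=> //.
- apply: measurable_funD; first exact: continuous_measurable_fun.
  by apply: (measurableT_comp mG); exact: oppr_measurable.
- move=> t t0; apply: mu_aeW (mu_ae_shift hmu t0 aD) => s s0 ms h.
  have [st|ts] := leP s t; first by rewrite f0// subr_ge0.
  rewrite /f max_r ?subr_le0 ?(ltW ts)// opprB /G patchT ?inE; last exact: h.
  by rewrite opprB addrC subrK.
Qed.

Let derive_dot t : 0 < t -> is_derive t 1 phi (psi t).
Proof.
move=> t0; have [dv Ev] := solution_ut sol t0.
have cl : (fun h => dot (h^-1 *: ((u \o shift t) (h *: 1) - u t)) e) @ 0^' --> psi t.
  apply: (@continuous_cvg _ _ _ _ _ (fun h : R => h^-1 *: ((u \o shift t) (h *: 1) - u t))
    (fun x => dot x e) (v t)); first exact: (dot_continuousl hdot).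
  by rewrite -Ev; exact: dv.
have Ef : (fun h => dot (h^-1 *: ((u \o shift t) (h *: 1) - u t)) e) =
          (fun h => h^-1 *: ((phi \o shift t) (h *: 1) - phi t)).
  by apply/funext => h; rewrite dotZl dotBl.
rewrite Ef in cl.
split; first by apply/cvg_ex; exists (psi t).
by apply/cvg_lim.
Qed.

(** The weak equation is tested against [e] alone. The last clause includes the time 0, out of reach
    of [scalar_solution]; it serves to restart a mode at [a = 0]. *)
Lemma mode_scalar_solution : exists f : R -> R,
  [/\ scalar_solution mu lam k f psi, forall t, 0 <= t -> f t = phi t,
      forall t, 0 <= t -> mu_ae mu (fun s => f (t - s) = phi (t - s)) &
      forall t (eps : R), 0 <= t -> 0 < eps -> exists2 d, 0 < d &
        forall r, 0 <= r -> `|t - r| < d ->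
        [/\ (f r - f t) ^+ 2 < eps, (psi r - psi t) ^+ 2 < eps &
        wint mu (fun s => (f r - f (r - s) - (f t - f (t - s))) ^+ 2) < eps]].
Proof.
have [f [mf f0 fae]] := mode_representative.
have mdelta t : measurable_fun halfline (fun s => f t - f (t - s)).
  by apply: measurable_funB; [exact: measurable_cst|exact: measurable_delay].
have cont t (eps : R) : 0 <= t -> 0 < eps -> exists2 d, 0 < d &
    forall r, 0 <= r -> `|t - r| < d ->
    [/\ (f r - f t) ^+ 2 < eps, (psi r - psi t) ^+ 2 < eps &
    wint mu (fun s => (f r - f (r - s) - (f t - f (t - s))) ^+ 2) < eps].
  move=> t0 eps0; have [d d0 hd] := mode_continuity t0 eps0.
  exists d => // r r0 tr; have [h1 h2 h3] := hd _ r0 tr; rewrite !f0//; split=> //.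
  congr (_ < eps): h3; apply: (mu_ae_wint hmu).
  by apply: mu_aeW (mu_aeI (fae _ r0) (fae _ t0)) => s _ _ [-> ->].
have int t : 0 <= t -> wintegrable mu (fun s => (f t - f (t - s)) ^+ 2).
  move=> t0; have Lt := solution_L2mu t0; have [dt _ _] := Lt.
  have : wintegrable mu (fun s => lam * (f t - f (t - s)) ^+ 2).
    apply: (L2mu_wintegrable hmu Lt).
      by apply: measurable_funM => //; apply: measurable_funX; exact: mdelta.
    apply: mu_aeW (mu_aeI dt (fae _ t0)) => s _ _ [ds ->].
    have q0 : 0 <= lam * dot (eta u t s) e ^+ 2.
      by apply: mulr_ge0; [exact: ltW|exact: sqr_ge0].
    by rewrite f0// -dot_eta (ger0_norm q0); exact: dot_eigenvector_le.
  move=> /(wintegrableZ lam^-1).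
  by under eq_fun do rewrite mulKf ?gt_eqF//.
have sq_lt (x eps : R) : 0 < eps -> x ^+ 2 < eps ^+ 2 -> `|x| < eps.
  move=> eps0 h; rewrite -(@ltr_pXn2r _ 2)// ?nnegrE ?(ltW eps0)//.
  by rewrite real_normK ?num_real.
have near_ge0 t r d : 0 < t -> `|t - r| < Num.min d t -> 0 <= r /\ `|t - r| < d.
  move=> t0; rewrite lt_min => /andP[h1 h2]; split=> //.
  by have := ler_norm (t - r); lra.
exists f; split; [split; [exact: mf|exact: int| | | | ]|exact: f0|exact: fae|exact: cont].
- move=> t t0; apply: (near_eq_is_derive _ (derive_dot t0)).
  near=> x; rewrite f0//; apply: ltW.
  by near: x; exact: (cvgr_gt t).
- move=> t t0; apply/(@cvgrPdist_lt R R^o) => eps eps0.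
  have [d d0 hd] := cont t (eps ^+ 2) (ltW t0) (exprn_gt0 _ eps0).
  exists (Num.min d t) => /=; first by rewrite lt_min d0.
  move=> r /= /(near_ge0 _ _ _ t0)[r0 tr].
  by have [_ h _] := hd _ r0 tr; rewrite distrC; exact: sq_lt.
- move=> t t0; apply/(@cvgrPdist_lt R R^o) => eps eps0.
  have e2 : 0 < eps / 2 by rewrite divr_gt0.
  have [d d0 hd] := cont t (eps / 2 * (eps / 2)) (ltW t0) (mulr_gt0 e2 e2).
  exists (Num.min d t) => /=; first by rewrite lt_min d0.
  move=> r /= /(near_ge0 _ _ _ t0)[r0 tr].
  have [_ _ h] := hd _ r0 tr; rewrite distrC /memory_force.
  have ir := wintegrable_sqr hmu (mdelta r) (int r r0).
  have it := wintegrable_sqr hmu (mdelta t) (int t (ltW t0)).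
  rewrite -wintB//.
  have mB : measurable_fun halfline (fun s => f r - f (r - s) - (f t - f (t - s))).
    exact: measurable_funB.
  have iB : wintegrable mu (fun s => (f r - f (r - s) - (f t - f (t - s))) ^+ 2).
    have mN : measurable_fun halfline (fun s => - (f t - f (t - s))).
      by apply: measurableT_comp => //; exact: mdelta.
    apply: (wintegrable_sqrD hmu (mdelta r) mN (int r r0)).
    by under eq_fun do rewrite sqrrN; exact: int (ltW t0).
  apply: (le_lt_trans (wint_small hmu mB iB e2)).
  by rewrite [ltRHS](splitr eps) ltrD2l ltr_pdivrMr.
- have [utt wd ae] := solution_wave sol.
  exists (utt^~ e); first exact: wd e dome.
  move: ae; apply: (@filterS _ (almost_everywhere leb)) => t h t0.
  have t0' := ltW t0; have dt := solution_dom t0'.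
  have [deta _ _] := solution_L2mu t0'.
  have E1 : dot (Ah (u t)) (Ah e) = lam * f t.
    by rewrite Ahe dotZr (dot_eigenvector dt) mulrA -expr2 sqrt_lam2 f0.
  have E2 : \int[leb]_(s in halfline) (mu s * dot (Ah (eta u t s)) (Ah e)) =
      lam * memory_force mu f t.
    rewrite -[LHS]/(wint mu (fun s => dot (Ah (eta u t s)) (Ah e))).
    rewrite -(wintZ lam (wintegrable_sqr hmu (mdelta t) (int t t0'))).
    apply: (mu_ae_wint hmu); apply: mu_aeW (mu_aeI deta (fae _ t0')) => s _ _ [ds ->].
    by rewrite Ahe dotZr (dot_eigenvector ds) mulrA -expr2 sqrt_lam2 f0// dot_eta.
  rewrite (h t0 e dome) dotZl E1 E2 -/(psi t).
  move: (f t) (memory_force mu f t) (k t * psi t) => x1 x2 x3; ring.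
Unshelve. all: by end_near. Qed.

End coordinate.

(** * Extension of a mode to the half line *)

Section extension.
Context (R : realType) (mu : R -> R) (lam : R).
Hypothesis hmu : admissible_kernel mu.
Hypothesis lam_gt0 : 0 < lam.
Local Notation leb := (@lebesgue_measure R).
Local Notation halfline := (`]0, +oo[%classic : set R).
Variables (k f g : R -> R).
Hypothesis sol : scalar_solution mu lam k f g.
Hypothesis cont : forall t (eps : R), 0 <= t -> 0 < eps -> exists2 d, 0 < d &
  forall r, 0 <= r -> `|t - r| < d ->
  [/\ (f r - f t) ^+ 2 < eps, (g r - g t) ^+ 2 < eps &
      wint mu (fun s => (f r - f (r - s) - (f t - f (t - s))) ^+ 2) < eps].
Variables (a T : R).
Hypotheses (a_ge0 : 0 <= a) (T_gt0 : 0 < T).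
Hypothesis k_zero : forall r, a <= r < a + T -> k r = 0.
Implicit Types (t r s : R).

Let sq_lt (x eps : R) : 0 < eps -> x ^+ 2 < eps ^+ 2 -> `|x| < eps.
Proof.
move=> eps0 h; rewrite -(@ltr_pXn2r _ 2)// ?nnegrE ?(ltW eps0)//.
by rewrite real_normK ?num_real.
Qed.

Let m0 t : 0 <= Num.max t 0 :> R.
Proof. by rewrite le_max lexx orbT. Qed.

Let am0 t : 0 <= a + Num.max t 0.
Proof. by rewrite addr_ge0. Qed.

Let shift_dist t x d : `|t - x| < d -> `|a + Num.max t 0 - (a + Num.max x 0)| < d.
Proof.
move=> tx; rewrite opprD addrACA subrr add0r.
exact: le_lt_trans (max0_lipschitz _ _) tx.
Qed.

(** Splitting at time [a]: [c] is the trajectory with its past frozen at [f a], and [p] below is the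
    remainder, supported in the past. *)
Let c t := f (a + Num.max t 0).
Let gc t := g (a + Num.max t 0).
Let p t := f (a + t) - c t.

Let tame_c : tame c gc.
Proof.
split.
- by move=> t t0; rewrite /c !max_r.
- move=> t t0; have at0 : 0 < a + t by rewrite ltr_wpDl.
  have d1 := scalar_derive sol at0.
  have d2 : is_derive t 1 (fun x : R => a + x) (1 : R).
    by apply: is_derive_eq; rewrite add0r mulr1.
  have d3 : is_derive t 1 (f \o (fun x : R => a + x)) (g (a + t)).
    by apply: is_derive_eq; rewrite mulr1.
  have -> : gc t = g (a + t) by rewrite /gc max_l// ltW.
  apply: (near_eq_is_derive _ d3).
  near=> x; rewrite /c /= max_l//; apply: ltW.
  by near: x; exact: (cvgr_gt t).
- apply: continuous_dist => t eps eps0.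
  have [d d0 hd] := cont (am0 t) (exprn_gt0 2 eps0); exists d => // x tx.
  have [h _ _] := hd _ (am0 x) (shift_dist tx).
  by rewrite distrC; exact: (sq_lt eps0 h).
- apply: continuous_dist => t eps eps0.
  have [d d0 hd] := cont (am0 t) (exprn_gt0 2 eps0); exists d => // x tx.
  have [_ h _] := hd _ (am0 x) (shift_dist tx).
  by rewrite distrC; exact: (sq_lt eps0 h).
Unshelve. all: by end_near. Qed.

Let pc t : p t + c t = f (a + t).
Proof. by rewrite /p subrK. Qed.

Let mf := scalar_measurable sol.

Let measurable_p : measurable_fun setT p.
Proof.
apply: measurable_funB; last exact: tame_measurable tame_c.
by apply: (measurableT_comp mf); exact: measurable_funD.
Qed.

Let p_future t : 0 <= t -> p t = 0.
Proof. by move=> t0; rewrite /p /c max_l// subrr. Qed.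

Let p_past s : 0 <= s -> p (- s) = f (a - s) - f a.
Proof. by move=> s0; rewrite /p /c max_r ?oppr_le0// addr0. Qed.

Let p_integrable : wintegrable mu (fun s => p (- s) ^+ 2).
Proof.
apply: eq_integrable (scalar_integrable sol a_ge0) => //.
move=> s; rewrite inE /= in_itv/= andbT => s0.
by rewrite p_past ?(ltW s0)// -sqrrN opprB.
Qed.

Let history_p : history mu p.
Proof.
split=> //.
move=> eps eps0.
have e8 : 0 < eps / 16 by rewrite divr_gt0.
have [d d0 hd] := cont a_ge0 e8.
exists d => // h h0 hd'.
have mN : measurable_fun halfline (fun s => p (h - s) - p (- s)).
  apply: measurable_funB; first exact: measurable_delay.
  rewrite (_ : (fun s => p (- s)) = (fun s => p (0 - s))).
    exact: measurable_delay.
  by apply/funext => s; rewrite sub0r.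
pose D s := f (a + h) - f (a + h - s) - (f a - f (a - s)).
have mdelta t : measurable_fun halfline (fun s => f t - f (t - s)).
  by apply: measurable_funB; [exact: measurable_cst|exact: measurable_delay].
have mD : measurable_fun halfline D by exact: measurable_funB.
have ah0 : 0 <= a + h by rewrite addr_ge0.
have iD : wintegrable mu (fun s => D s ^+ 2).
  have mND : measurable_fun halfline (fun s => - (f a - f (a - s))).
    by apply: measurableT_comp => //; exact: mdelta.
  apply: (wintegrable_sqrD hmu (mdelta (a + h)) mND (scalar_integrable sol ah0)).
  by under eq_fun do rewrite sqrrN; exact: (scalar_integrable sol a_ge0).
have close r : 0 <= r -> r <= h -> (f (a + r) - f a) ^+ 2 <= eps / 16.
  move=> r0 rh.
  have ar : `|a - (a + r)| < d.
    by rewrite opprD addrA subrr sub0r normrN ger0_norm// (le_lt_trans rh).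
  by have [h1 _ _] := hd _ (addr_ge0 a_ge0 r0) ar; exact: ltW.
have hD : wint mu (fun s => D s ^+ 2) < eps / 16.
  have ah : `|a - (a + h)| < d by rewrite opprD addrA subrr sub0r normrN ger0_norm.
  by have [_ _ h3] := hd _ ah0 ah.
(* The increment of [p] differs from [- D s] by [x - y], with [x] and [y] small near [a]:
   [(x - y)^2 <= 4 eps / 16], so that twice this is [eps / 2]. *)
have bnd s : 0 < s -> (p (h - s) - p (- s)) ^+ 2 <= 2 * D s ^+ 2 + eps / 2.
  move=> s0; pose x := f (a + h) - f a; pose y := f (a + Num.max (h - s) 0) - f a.
  have -> : p (h - s) - p (- s) = - D s + (x - y).
    rewrite p_past ?(ltW s0)// /p /c /D /x /y !addrA.
    move: (f (a + h)) (f (a + h - s)) (f (a + Num.max (h - s) 0)) (f a) (f (a - s)).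
    by move=> *; ring.
  have x2 : x ^+ 2 <= eps / 16 by apply: close.
  have y2 : y ^+ 2 <= eps / 16.
    by apply: close => //; rewrite ge_max h0 andbT gerBl ltW.
  move: (D s) x2 y2 => z; have := sqr_ge0 (z + (x - y)); have := sqr_ge0 (x + y).
  by clearbody x y; nra.
have i2 : wintegrable mu (fun s => 2 * D s ^+ 2 + eps / 2).
  by apply: wintegrableD; [exact: wintegrableZ|exact: wintegrable_cst].
have i1 : wintegrable mu (fun s => (p (h - s) - p (- s)) ^+ 2).
  apply: (le_wintegrable hmu _ _ i2); first exact: measurable_funX.
  by move=> s s0; rewrite ger0_norm ?sqr_ge0// bnd.
apply: (le_lt_trans (le_wint hmu i1 i2 bnd)).
rewrite (wintD (wintegrableZ 2 iD) (wintegrable_cst hmu _)) wintZ// wint_cst//.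
have := mass_le1 hmu; have := mass_ge0 hmu.
by move: (kernel_mass mu) (wint mu (fun s => D s ^+ 2)) hD => x y; nra.
Qed.

Let q := acceleration mu lam p c.

Let cq : continuous q.
Proof. exact: (acceleration_continuous hmu history_p tame_c). Qed.

Let qE t : 0 <= t ->
  q t = - lam * ((1 - kernel_mass mu) * f (a + t) + memory_force mu f (a + t)).
Proof.
move=> t0; have at0 : 0 <= a + t by rewrite addr_ge0.
have [i1 _] := tame_delay_integrable hmu tame_c t0.
have [i2 _] := history_delay hmu history_p t0.
have {}i2 := wintegrable_sqr hmu (measurable_delay t measurable_p) i2.
rewrite /q /acceleration (max_l t0) /delay -(wintD i2 i1).
have -> : (fun s => p (t - s) + c (t - s)) = (fun s => f (a + t - s)).
  by apply/funext => s; rewrite pc addrA.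
have iF : wintegrable mu (fun s => f (a + t - s)).
  apply: eq_integrable (wintegrableD i2 i1) => //.
  by move=> s _ /=; rewrite pc addrA.
rewrite /memory_force (wintB (wintegrable_cst hmu _) iF) wint_cst//.
have -> : c t = f (a + t) by rewrite /c max_l.
move: (wint mu _) (f _) (kernel_mass mu) => x y z; ring.
Qed.

Let velocity_increment s t : 0 < s -> s < t -> t <= T ->
  gc t - gc s = primitive q t - primitive q s.
Proof.
move=> s0 st tT; have t0 := lt_trans s0 st.
rewrite /gc !max_l ?ltW//.
have [P iP aeP] := scalar_wave sol.
have as0 : 0 < a + s by rewrite ltr_wpDl.
have ast : a + s < a + t by rewrite ltrD2l.
have [ip ->] := iP _ _ as0 ast.
have dF x : 0 < x -> is_derive (a + x) 1 (fun z : R => primitive q (z - a)) (q x).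
  move=> x0.
  have d2 : is_derive (a + x) 1 (fun z : R => z - a) (1 : R).
    by apply: is_derive_eq; rewrite subr0.
  have d1 : is_derive (a + x - a) 1 (primitive q) (q x).
    by rewrite addrAC subrr add0r; exact: primitive_derive.
  have -> : (fun z : R => primitive q (z - a)) = primitive q \o (fun z : R => z - a) by [].
  by apply: is_derive_eq; rewrite mulr1.
have cqa : continuous (fun z : R => q (z - a)).
  move=> x; apply: (@continuous_comp _ _ _ (fun z : R => z - a) q); last exact: cq.
  by apply: cvgB => //; exact: cvg_cst.
transitivity (\int[leb]_(r in `[(a + s), (a + t)]) q (r - a)).
  apply: ae_eq_Rintegral.
  (* The coefficient vanishes on a half-open interval only; its right end is discarded as a null
     set. *)
  have ne : {ae leb, forall r : R, r <> a + T}.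
    exists [set a + T]; split; [exact: measurable_set1|exact: lebesgue_measure_set1|].
    by move=> r /= h; apply: contrapT => h2; apply: h.
  move: aeP ne; apply: (@filterS2 _ (almost_everywhere leb)) => r h rT.
  rewrite /= in_itv/= => /andP[ar rb].
  have r0 : 0 < r by exact: lt_le_trans ar.
  have ra : a <= r by rewrite (le_trans _ ar)// lerDl ltW.
  have raT : r < a + T.
    rewrite lt_neqAle (le_trans rb) ?lerD2l// andbT; exact/eqP.
  rewrite h// k_zero ?ra// mul0r addr0 qE ?subr_ge0//.
  by rewrite subrKC.
have cF : continuous (fun z : R => primitive q (z - a)).
  move=> x; apply: (@continuous_comp _ _ _ (fun z : R => z - a) (primitive q)).
    by apply: cvgB => //; exact: cvg_cst.
  exact: primitive_continuous.
rewrite /Rintegral (@continuous_FTC2 R (fun z => q (z - a)) (fun z => primitive q (z - a)))//.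
- by rewrite -EFinB /= ![a + _]addrC !addrK.
- exact: continuous_subspaceT.
- split.
  + move=> x; rewrite in_itv/= => /andP[ax xt].
    have x0 : 0 < x - a by rewrite subr_gt0 (lt_trans _ ax)// ltrDl.
    by have [+ _] := dF _ x0; rewrite subrKC.
  + by apply: cvg_at_right_filter; exact: cF.
  + by apply: cvg_at_left_filter; exact: cF.
- move=> x; rewrite in_itv/= => /andP[ax xt].
  have x0 : 0 < x - a by rewrite subr_gt0 (lt_trans _ ax)// ltrDl.
  by rewrite derive1E; have [_ +] := dF _ x0; rewrite subrKC.
Qed.

(** The weak equation is available on compact intervals of positive times; continuity at 0 brings
    the identity down to the initial time, including for [a = 0]. *)
Let velocity t : 0 <= t <= T -> gc t = g a + primitive q t.
Proof.
move=> /andP[t0 tT].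
have gc0 : gc 0 = g a by rewrite /gc maxxx addr0.
move: t0; rewrite le_eqVlt => /predU1P[<-|t0].
  by rewrite primitive_le0// addr0.
pose X s := gc s - primitive q s.
have cX : continuous X.
  move=> s; apply: cvgB; first exact: (tame_derivative tame_c).
  exact: primitive_continuous.
suff : X t = X 0 by rewrite /X (primitive_le0 q (lexx 0)) subr0 gc0 => <-; rewrite subrK.
apply/eqP; rewrite -subr_eq0 -normr_eq0 eq_le normr_ge0 andbT.
apply/ler_addgt0Pl => eps eps0; rewrite addr0.
have [d d0 hd] := dist_continuous (cX 0) eps0.
pose s := Num.min (t / 2) (d / 2).
have s0 : 0 < s by rewrite lt_min !divr_gt0.
have st : s < t by rewrite gt_min ltr_pdivrMr// ltr_pMr// ltr1n.
have sd : s < d by rewrite gt_min orbC ltr_pdivrMr// ltr_pMr// ltr1n.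
have -> : X t = X s by have := velocity_increment s0 st tT; rewrite /X; lra.
by rewrite distrC ltW// hd// sub0r normrN gtr0_norm.
Qed.

Let position t : t <= T -> c t = twice_primitive (f a) (g a) q t.
Proof.
move=> tT.
have htw := tame_twice_primitive (f a) (g a) cq.
have c0 : c 0 = f a by rewrite /c maxxx addr0.
have tw0 : twice_primitive (f a) (g a) q 0 = f a.
  by rewrite /twice_primitive maxxx mulr0 addr0 primitive_le0// addr0.
have [t0|t0] := leP t 0.
  by rewrite (tame_past tame_c t0) (tame_past htw t0) c0 tw0.
have dX x : 0 < x < t -> is_derive x 1 (fun z => c z - twice_primitive (f a) (g a) q z) 0.
  move=> /andP[x0 xt]; have d1 := tame_derive tame_c x0; have d2 := tame_derive htw x0.
  apply: is_derive_eq; rewrite velocity ?subrr//.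
  by rewrite (ltW x0) (le_trans (ltW xt)).
have cX : continuous (fun z => c z - twice_primitive (f a) (g a) q z).
  move=> x; apply: cvgB; [exact: (tame_continuous tame_c)|exact: (tame_continuous htw)].
have l1 := nondecreasing_derive (ltW t0) dX (fun _ _ => lexx 0) (continuous_subspaceT cX).
have dX' x : 0 < x < t -> is_derive x 1 (fun z => - (c z - twice_primitive (f a) (g a) q z)) 0.
  by move=> xt; have d1 := dX x xt; apply: is_derive_eq; rewrite oppr0.
have cX' : continuous (fun z => - (c z - twice_primitive (f a) (g a) q z)).
  by move=> x; apply: cvgN; exact: cX.
have l2 := nondecreasing_derive (ltW t0) dX' (fun _ _ => lexx 0) (continuous_subspaceT cX').
move: l1 l2; rewrite c0 tw0 subrr oppr0 oppr_ge0 subr_le0 subr_ge0 => l1 l2.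
by apply/eqP; rewrite eq_le l2 l1.
Qed.

Lemma scalar_extension : exists (p y : R -> R),
  [/\ history mu p, continuous y,
      forall t, 0 <= t -> acceleration mu lam p (twice_primitive (f a) (g a) y) t = y t,
      forall t, t <= T -> p t + twice_primitive (f a) (g a) y t = f (a + t) &
      forall t, 0 <= t <= T -> g a + primitive y t = g (a + t)].
Proof.
have [y [cy yp yP]] := scalar_existence hmu lam_gt0 (f a) (g a) history_p.
have yPT t : 0 <= t <= T ->
    acceleration mu lam p (twice_primitive (f a) (g a) y) t = y t.
  by move=> /andP[t0 _]; exact: yP.
have uniq := scalar_uniqueness hmu lam_gt0 history_p (ltW T_gt0) cy tame_c yPT position.
exists p, y; split=> //.
- by move=> t /uniq[<- _]; exact: pc.
- move=> t tT; have /andP[t0 _] := tT.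
  have -> : g (a + t) = gc t by rewrite /gc max_l.
  rewrite (velocity tT); congr (_ + _); apply: eq_primitive => r /andP[r0 rt].
  have rT : r <= T by rewrite (le_trans rt)//; case/andP: tT.
  by have [_ qy] := uniq _ rT; rewrite -[in LHS](max_l r0) -qy.
Qed.

End extension.

(** * Realization of a scalar solution along an eigenvector *)

Section mode_extension.
Import HBSimple.
Context (R : realType) (H : completeNormedModType R) (dot : {dot H for idfun}).
Hypothesis hdot : induces_norm dot.
Variables (A Ah : operator H) (mu : R -> R) (lam : R) (e : H).
Hypothesis hmu : admissible_kernel mu.
Hypotheses (Ahlin : linear_operator Ah) (Ahsa : self_adjoint dot Ah).
Hypotheses (lam_gt0 : 0 < lam) (dome : dom Ah e) (Ahe : Ah e = Num.sqrt lam *: e).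
Hypothesis norme : `|e| = 1.
Local Notation leb := (@lebesgue_measure R).
Local Notation halfline := (`]0, +oo[%classic : set R).
Implicit Types (t r s : R) (F : R -> R).

Let AhZ (x : R) : dom Ah (x *: e) /\ Ah (x *: e) = x *: Ah e.
Proof. exact: operatorZ. Qed.

Let norm_AhZ (x : R) : `|Ah (x *: e)| ^+ 2 = lam * x ^+ 2.
Proof.
have [_ ->] := AhZ x; rewrite Ahe !normrZ norme mulr1 exprMn.
by rewrite !real_normK ?num_real// sqr_sqrtr ?ltW// mulrC.
Qed.

Lemma eta_scale F t s : eta (fun t => F t *: e) t s = (F t - F (t - s)) *: e.
Proof. by rewrite /eta scalerBl. Qed.

Lemma strongly_measurable_scale F (w : H) : measurable_fun setT F ->
  strongly_measurable mu (fun s => F s *: w).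
Proof.
move=> mF; have mF' : measurable_fun setT (EFin \o F) by exact/measurable_EFinP.
have [g gF] := approximation_sfun measurableT mF'.
exists (fun n s => g n s *: w).
  move=> n; split.
    apply: (@sub_finite_set _ _ ((fun r : R => r *: w) @` range (g n))).
      by move=> _ [s _ <-]; exists (g n s) => //; exists s.
    by apply: finite_image; exact: fimfunP.
  move=> y.
  have -> : (fun s => g n s *: w) @^-1` [set y] =
      \bigcup_(r in range (g n) `&` [set r | r *: w = y]) g n @^-1` [set r].
    rewrite predeqE => s; split=> [/= hs|[r [_ /= <-] /= ->]//].
    by exists (g n s) => //; split=> //; exists s.
  apply: fin_bigcup_measurable; first by apply: finite_setIl; exact: fimfunP.
  by move=> r _.
rewrite /mu_ae; apply: nearW => s _ _.
have /fine_cvg := gF s I => h; apply: cvgZl.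
exact: h.
Qed.

Lemma L2mu_mode F t : measurable_fun setT F ->
  wintegrable mu (fun s => (F t - F (t - s)) ^+ 2) ->
  L2mu mu Ah (eta (fun t => F t *: e) t).
Proof.
move=> mF iF; split.
- by rewrite /mu_ae; apply: nearW => s _ _; rewrite eta_scale; have [] := AhZ (F t - F (t - s)).
- have -> : (fun s => Ah (eta (fun t => F t *: e) t s)) =
      (fun s => (F t - F (t - s)) *: Ah e).
    by apply/funext => s; rewrite eta_scale; have [_ ->] := AhZ (F t - F (t - s)).
  apply: strongly_measurable_scale; apply: measurable_funB => //.
  by apply: (measurableT_comp mF); exact: measurable_funB.
- have -> : (fun s => (mu s * `|Ah (eta (fun t => F t *: e) t s)| ^+ 2)%:E) =
      EFin \o (fun s => mu s * (lam * (F t - F (t - s)) ^+ 2)).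
    by apply/funext => s; rewrite eta_scale norm_AhZ.
  exact: (integrable_lty _ (wintegrableZ lam iF)).
Qed.

Lemma mode_energy F G t :
  wintegrable mu (fun s => (F t - F (t - s)) ^+ 2) ->
  energy Ah mu (fun t => F t *: e) (fun t => G t *: e) t = scalar_energy mu lam F G t.
Proof.
move=> iF; rewrite /energy /scalar_energy normrZ norme mulr1 norm_AhZ.
rewrite real_normK ?num_real//.
have -> : (fun s => mu s * `|Ah (eta (fun t => F t *: e) t s)| ^+ 2) =
    (fun s => mu s * (lam * (F t - F (t - s)) ^+ 2)).
  by apply/funext => s; rewrite eta_scale norm_AhZ.
rewrite -[\int[_]_(s in _) _]/(wint mu (fun s => lam * (F t - F (t - s)) ^+ 2)).
rewrite wintZ// /memory_energy.
have alg (g2 m f2 w : R) : 2^-1 * g2 + (1 - m) / 2 * (lam * f2) + 2^-1 * (lam * w) =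
    2^-1 * g2 + (1 - m) / 2 * lam * f2 + lam / 2 * w by ring.
exact: alg.
Qed.

Variables (p y : R -> R) (a b : R).
Hypotheses (hp : history mu p) (cy : continuous y).
Hypothesis yP : forall t, 0 <= t -> acceleration mu lam p (twice_primitive a b y) t = y t.

Let c := twice_primitive a b y.
Let G t := b + primitive y t.
Let F t := p t + c t.

Let tame_c : tame c G.
Proof. exact: tame_twice_primitive. Qed.

Let mF : measurable_fun setT F.
Proof.
apply: measurable_funD; first exact: history_measurable hp.
exact: tame_measurable tame_c.
Qed.

Let FE t : 0 <= t -> F t = c t.
Proof. by move=> t0; rewrite /F (history_future hp t0) add0r. Qed.

Let mdelay (h : R -> R) t : measurable_fun setT h ->
  measurable_fun halfline (fun s => h t - h (t - s)).
Proof.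
by move=> mh; apply: measurable_funB; [exact: measurable_cst|exact: measurable_delay].
Qed.

Let mc : measurable_fun setT c.
Proof. exact: tame_measurable tame_c. Qed.

Let mp : measurable_fun setT p.
Proof. exact: history_measurable hp. Qed.

Let sqrN_integrable (h : R -> R) :
  wintegrable mu (fun s => h s ^+ 2) -> wintegrable mu (fun s => (- h s) ^+ 2).
Proof. by move=> ih; under eq_fun do rewrite sqrrN. Qed.

Lemma extension_delay t : 0 <= t ->
  wintegrable mu (fun s => F (t - s)) /\ wintegrable mu (fun s => F (t - s) ^+ 2).
Proof.
move=> t0; have [i1 i2] := tame_delay_integrable hmu tame_c t0.
have [i3 _] := history_delay hmu hp t0.
have i4 := wintegrable_sqr hmu (measurable_delay t mp) i3.
split; first exact: wintegrableD.
exact: (wintegrable_sqrD hmu (measurable_delay t mp) (measurable_delay t mc)).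
Qed.

Lemma extension_integrable t : 0 <= t -> wintegrable mu (fun s => (F t - F (t - s)) ^+ 2).
Proof.
move=> t0; have [_ i2] := extension_delay t0.
have mN : measurable_fun halfline (fun s => - F (t - s)).
  by apply: measurableT_comp => //; exact: measurable_delay.
apply: (wintegrable_sqrD hmu (F := fun=> F t) (measurable_cst _) mN).
  exact: wintegrable_cst.
exact: sqrN_integrable.
Qed.

Let derive_scale (h : R -> R) (h' : R) t : is_derive t 1 h h' ->
  is_derive t 1 (fun x => h x *: e) (h' *: e).
Proof.
move=> [dh Eh].
have cl : (fun x => (x^-1 *: ((h \o shift t) (x *: 1) - h t)) *: e) @ 0^' --> h' *: e.
  by apply: cvgZl; rewrite -Eh; exact: dh.
have Ef : (fun x : R => (x^-1 *: ((h \o shift t) (x *: 1) - h t)) *: e) =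
    (fun x => x^-1 *: (((fun z => h z *: e) \o shift t) (x *: 1) - h t *: e)).
  by apply/funext => x; rewrite -scalerA scalerBl.
rewrite Ef in cl; split; first by apply/cvg_ex; exists (h' *: e).
exact/cvg_lim.
Qed.

Let derive_F t : 0 < t -> is_derive t 1 F (G t).
Proof.
move=> t0; apply: (near_eq_is_derive _ (tame_derive tame_c t0)).
near=> x; rewrite FE//; apply: ltW.
by near: x; exact: (cvgr_gt t).
Unshelve. all: by end_near. Qed.

(** Along the direction [(1, 1)] the argument [t - s] is constant, so only [u t] varies. The memory
    equation then holds for every [s] without any regularity of the past. *)
Let derive_eta (u : R -> H) (w : H) t s : is_derive t 1 u w ->
  'D_(1, 1) (fun q : R * R => eta u q.1 q.2) (t, s) = w.
Proof.
move=> [_ <-]; rewrite /derive.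
rewrite (_ : (fun h : R => h^-1 *: (((fun q : R * R => eta u q.1 q.2) \o shift (t, s))
    (h *: (1, 1)) - eta u t s)) =
  (fun h : R => h^-1 *: ((u \o shift t) (h *: 1) - u t)))//.
apply/funext => h; congr (h^-1 *: _); rewrite /= /eta.
have -> : h *: 1 + t - (h *: 1 + s) = t - s by rewrite /GRing.scale /= mulr1; ring.
by rewrite opprB addrA subrK.
Qed.

Let yE t : 0 <= t ->
  y t = - (1 - kernel_mass mu) * (lam * F t) - lam * memory_force mu F t.
Proof.
move=> t0; rewrite -(yP t0) /acceleration (max_l t0).
have [i1 _] := tame_delay_integrable hmu tame_c t0.
have [i2 _] := history_delay hmu hp t0.
have {}i2 := wintegrable_sqr hmu (measurable_delay t mp) i2.
rewrite /delay -(wintD i2 i1) -/c -(FE t0).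
have [iF _] := extension_delay t0.
rewrite /memory_force (wintB (wintegrable_cst hmu _) iF) wint_cst//.
move: (wint mu _) (F t) (kernel_mass mu) => x1 x2 x3; ring.
Qed.

Let extension_continuous t (eps : R) : 0 <= t -> 0 < eps -> exists2 d, 0 < d &
  forall r, 0 <= r -> `|t - r| < d ->
   [/\ (F r - F t) ^+ 2 < eps, (G r - G t) ^+ 2 < eps &
     wint mu (fun s => (F r - F (r - s) - (F t - F (t - s))) ^+ 2) < eps].
Proof.
move=> t0 eps0.
have [L L0 hL] := tame_lipschitz (t + 1) tame_c.
have e8 : 0 < eps / 8 by rewrite divr_gt0.
have [d1 d10 hd1] := history_uniform hmu hp e8.
have se0 : 0 < Num.sqrt eps by rewrite sqrtr_gt0.
have se2 : Num.sqrt eps ^+ 2 = eps by rewrite sqr_sqrtr// ltW.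
have [d2 d20 hd2] := dist_continuous (@tame_derivative _ _ _ tame_c t) se0.
(* Within this distance the Lipschitz bound gives increments of [c] of at most [sqrt eps / 4]; two
   of them contribute at most [eps / 4] after squaring. *)
pose eta0 := Num.sqrt eps / (4 * (L + 1)).
have L1 : 0 < L + 1 by rewrite ltr_wpDl.
have eta00 : 0 < eta0 by rewrite divr_gt0// mulr_gt0.
have sqlt (x z : R) : `|x| < z -> x ^+ 2 < z ^+ 2.
  move=> xz; rewrite -(real_normK (num_real x)) ltr_pXn2r// ?nnegrE//.
  by rewrite (le_trans _ (ltW xz)).
exists (Num.min (Num.min 1 eta0) (Num.min d1 d2)).
  by rewrite !lt_min ltr01 eta00 d10 d20.
move=> r r0; rewrite !lt_min => /andP[/andP[tr1 tre] /andP[trd1 trd2]].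
have rN : r <= t + 1 by have := ler_norm (r - t); rewrite distrC; lra.
have tN : t <= t + 1 by rewrite lerDl.
have cl x z : x <= t + 1 -> z <= t + 1 -> `|x - z| = `|t - r| ->
    `|c z - c x| <= Num.sqrt eps / 4.
  move=> xN zN xz; rewrite (le_trans (hL _ _ xN zN))// distrC xz.
  apply: (@le_trans _ _ ((L + 1) * eta0)).
    by rewrite ler_pM// ?lerDl// ltW.
  rewrite /eta0 le_eqVlt; apply/orP; left; apply/eqP; field.
  by rewrite gt_eqF.
have c1 : `|c r - c t| <= Num.sqrt eps / 4 by exact: cl.
split.
- rewrite !FE// -[ltRHS]se2; apply: sqlt; apply: (le_lt_trans c1).
  by rewrite ltr_pdivrMr// ltr_pMr// ltr1n.
- by rewrite -[ltRHS]se2; apply: sqlt; rewrite distrC; exact: hd2.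
- have rt : `|r - t| < d1 by rewrite distrC.
  have iP := history_delayB_integrable hmu hp r0 t0.
  have hP := hd1 r t r0 t0 rt.
  have bnd s : 0 < s -> (F r - F (r - s) - (F t - F (t - s))) ^+ 2 <=
      2 * (p (r - s) - p (t - s)) ^+ 2 + eps / 2.
    move=> s0.
    have c2 : `|c (r - s) - c (t - s)| <= Num.sqrt eps / 4.
      apply: cl; rewrite ?lerBlDr ?(le_trans rN) ?(le_trans tN) ?lerDl ?ltW//.
      by congr `| _ |; ring.
    rewrite (FE r0) (FE t0) /F.
    have -> : c r - (p (r - s) + c (r - s)) - (c t - (p (t - s) + c (t - s))) =
       (c r - c t) - (c (r - s) - c (t - s)) - (p (r - s) - p (t - s)).
      move: (c r) (c t) (c (r - s)) (c (t - s)) (p (r - s)) (p (t - s)).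
      by move=> *; ring.
    have b2 : `|(c r - c t) - (c (r - s) - c (t - s))| <= Num.sqrt eps / 2.
      rewrite (le_trans (ler_normB _ _))// (le_trans (lerD c1 c2))//.
      by rewrite [leRHS]splitr -mulrA -invfM -natrM.
    move: ((c r - c t) - _) b2 (p (r - s) - p (t - s)) => x xb z.
    have x2 : x ^+ 2 <= eps / 4.
      have -> : eps / 4 = (Num.sqrt eps / 2) ^+ 2 by rewrite exprMn se2; field.
      have s2 : 0 <= Num.sqrt eps / 2 by rewrite divr_ge0// sqrtr_ge0.
      by rewrite -(real_normK (num_real x)) ler_sqr ?nnegrE.
    by have := sqr_ge0 (x + z); nra.
  have i2 : wintegrable mu (fun s => 2 * (p (r - s) - p (t - s)) ^+ 2 + eps / 2).
    by apply: wintegrableD; [exact: wintegrableZ|exact: wintegrable_cst].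
  have i1 : wintegrable mu (fun s => (F r - F (r - s) - (F t - F (t - s))) ^+ 2).
    apply: (le_wintegrable hmu _ _ i2).
      by apply: measurable_funX; apply: measurable_funB; exact: mdelay.
    by move=> s s0; rewrite ger0_norm ?sqr_ge0// bnd.
  apply: (le_lt_trans (le_wint hmu i1 i2 bnd)).
  rewrite (wintD (wintegrableZ 2 iP) (wintegrable_cst hmu _)) wintZ// wint_cst//.
  have := mass_le1 hmu; have := mass_ge0 hmu; move: hP.
  by move: (kernel_mass mu) (wint mu _) => z1 z2; nra.
Qed.

Lemma extension_solution :
  solution dot A Ah mu (fun=> 0) (fun t => F t *: e) (G 0 *: e)
    (fun t => F t *: e) (fun t => G t *: e).
Proof.
split=> //.
- move=> t t0; split; first by have [] := AhZ (F t).
  by apply: L2mu_mode => //; exact: extension_integrable.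
- move=> t t0; apply/(@cvgrPdist_lt R R^o) => eps eps0.
  (* The weights in the phase norm: 1 for the velocity, and at most [lam] for each of position and
     memory. *)
  have l1 : 0 < 1 + lam + lam by rewrite !addr_gt0.
  have [d d0 hd] := extension_continuous t0 (divr_gt0 eps0 l1).
  exists d => //= r tr; rewrite /= in_itv/= andbT => r0.
  have [h1 h2 h3] := hd r r0 tr.
  rewrite sub0r normrN /phase_norm2 /= -!scalerBl norm_AhZ normrZ norme mulr1.
  rewrite real_normK ?num_real//.
  have -> : (fun s => mu s * `|Ah (eta (fun x => F x *: e) r s - eta (fun x => F x *: e) t s)| ^+ 2) =
     (fun s => mu s * (lam * (F r - F (r - s) - (F t - F (t - s))) ^+ 2)).
    by apply/funext => s; rewrite !eta_scale -scalerBl norm_AhZ.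
  rewrite -[\int[_]_(s in _) _]/(wint mu (fun s =>
     lam * (F r - F (r - s) - (F t - F (t - s))) ^+ 2)).
  have mB : measurable_fun halfline (fun s => F r - F (r - s) - (F t - F (t - s))).
    by apply: measurable_funB; exact: mdelay.
  have iB : wintegrable mu (fun s => (F r - F (r - s) - (F t - F (t - s))) ^+ 2).
    have mN : measurable_fun halfline (fun s => - (F t - F (t - s))).
      by apply: measurableT_comp => //; exact: mdelay.
    apply: (wintegrable_sqrD hmu (mdelay r mF) mN (extension_integrable r0)).
    exact/sqrN_integrable/extension_integrable.
  rewrite wintZ//.
  have w0 : 0 <= wint mu (fun s => (F r - F (r - s) - (F t - F (t - s))) ^+ 2).
    by apply: wint_ge0 => // s _; exact: sqr_ge0.
  have dE : (1 + lam + lam) * (eps / (1 + lam + lam)) = eps.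
    by rewrite mulrC mulfVK// gt_eqF.
  move: (eps / (1 + lam + lam)) dE h1 h2 h3 => del dE h1 h2 h3.
  have k1 : (1 - kernel_mass mu) * (lam * (F r - F t) ^+ 2) <= lam * (F r - F t) ^+ 2.
    rewrite ler_piMl ?gerBl ?mass_ge0//.
    by apply: mulr_ge0; [exact: ltW|exact: sqr_ge0].
  have k2 : 0 <= (1 - kernel_mass mu) * (lam * (F r - F t) ^+ 2).
    apply: mulr_ge0; first by rewrite subr_ge0 mass_le1.
    by apply: mulr_ge0; [exact: ltW|exact: sqr_ge0].
  rewrite ger0_norm; last first.
    by rewrite !addr_ge0// ?sqr_ge0//; apply: mulr_ge0 => //; exact: ltW.
  rewrite -(ltr_pM2l lam_gt0) in h1; rewrite -(ltr_pM2l lam_gt0) in h3.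
  have alg (x z w v l q : R) : x <= z -> z < l -> w < q -> v < l ->
    x + w + v < q + l + l by move=> *; lra.
  have -> : eps = del + lam * del + lam * del by rewrite -dE; ring.
  exact: (alg _ _ _ _ _ _ k1 h1 h2 h3).
- by move=> t t0; exact/derive_scale/derive_F.
- exists (fun t w => y t * dot e w).
    move=> w dw s t s0 st.
    have iy : leb.-integrable `[s, t] (EFin \o y).
      apply: continuous_compact_integrable; first exact: segment_compact.
      exact: continuous_subspaceT.
    split.
      apply: eq_integrable (integrableZl _ (dot e w) iy) => //.
      by move=> x _; rewrite /= mulrC EFinM.
    rewrite RintegralZr// -primitive_sub// ?ltW// !dotZl -mulrBl; congr (_ * _).
    by rewrite /G opprD addrACA subrr add0r.
  apply: nearW => t t0 w dw.
  have t0' := ltW t0.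
  rewrite scale0r dot0l addr0.
  have Ew : dot (Ah e) (Ah w) = lam * dot e w.
    rewrite Ahe dotZl dotC (dot_eigenvector Ahsa dome Ahe dw) mulrA -expr2 dotC.
    by rewrite sqr_sqrtr// ltW.
  have [_ ->] := AhZ (F t); rewrite dotZl Ew (yE t0').
  have -> : \int[leb]_(s in halfline) (mu s * dot (Ah (eta (fun x => F x *: e) t s)) (Ah w)) =
     lam * dot e w * memory_force mu F t.
    have i2 := wintegrable_sqr hmu (mdelay t mF) (extension_integrable t0').
    rewrite -(wintZ _ i2); apply: eq_Rintegral => s _; rewrite eta_scale.
    have [_ ->] := AhZ (F t - F (t - s)); rewrite dotZl Ew.
    by rewrite [lam * dot e w * _]mulrC.
  move: (F t) (memory_force mu F t) (kernel_mass mu) (dot e w) => x1 x2 x3 x4; ring.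
- apply: nearW => t t0 z _; apply: eq_Rintegral => s _; congr (_ * dot _ _).
  by apply: derive_eta; exact/derive_scale/derive_F.
Qed.

End mode_extension.

(** * Mode estimates and summation *)

Section modes.
Context (R : realType) (H : completeNormedModType R) (dot : {dot H for idfun}).
Hypothesis hdot : induces_norm dot.
Variables (A Ah : operator H) (mu k : R -> R).
Hypothesis hmu : admissible_kernel mu.
Hypotheses (Ahlin : linear_operator Ah) (Ahsa : self_adjoint dot Ah).
Variables (u0 : R -> H) (u1 : H) (u v : R -> H).
Hypothesis sol : solution dot A Ah mu k u0 u1 u v.
Local Notation leb := (@lebesgue_measure R).
Local Notation halfline := (`]0, +oo[%classic : set R).
Implicit Types (t r s : R) (lam : R) (e : H).

(** Formed with the raw coordinates, hence free of any choice of representative; the weighted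
    integral ignores the null sets involved. *)
Definition mode_part lam e t :=
  scalar_energy mu lam (fun t => dot (u t) e) (fun t => dot (v t) e) t.

(** For the zero vectors that may pad the eigenbasis. *)
Lemma mode_part0 lam t : mode_part lam 0 t = 0.
Proof.
rewrite /mode_part /scalar_energy /memory_energy !dot0r !expr0n/= !mulr0 !add0r.
rewrite (_ : (fun s => _) = fun=> 0); first by rewrite wint_cst// !mulr0.
by apply/funext => s; rewrite dot0r subrr expr0n.
Qed.

Section unit_mode.
Variables (lam : R) (e : H).
Hypotheses (lam_gt0 : 0 < lam) (dome : dom Ah e) (Ahe : Ah e = Num.sqrt lam *: e).
Hypothesis norme : `|e| = 1.

Let mode_part_eq f t : 0 <= t -> f t = dot (u t) e ->
  mu_ae mu (fun s => f (t - s) = dot (u (t - s)) e) ->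
  scalar_energy mu lam f (fun t => dot (v t) e) t = mode_part lam e t.
Proof.
move=> t0 ft fae; rewrite /mode_part /scalar_energy ft; congr (_ + _ * _).
by apply: (mu_ae_wint hmu); apply: mu_aeW fae => s _ _ ->; rewrite ft.
Qed.

Lemma mode_growth a b (K : R) : 0 < a -> a <= b -> 0 <= K ->
  (forall r, a <= r < b -> `|k r| <= K) ->
  forall t, a <= t <= b -> mode_part lam e t <= expR (2 * K * (t - a)) * mode_part lam e a.
Proof.
move=> a0 ab K0 kK t /andP[at_ tb].
have [f [fsol f0 fae _]] :=
  mode_scalar_solution hdot hmu Ahlin Ahsa lam_gt0 dome Ahe norme sol.
have t0 : 0 <= t by rewrite (le_trans (ltW a0)).
rewrite -(mode_part_eq t0 (f0 _ t0) (fae _ t0)).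
rewrite -(mode_part_eq (ltW a0) (f0 _ (ltW a0)) (fae _ (ltW a0))).
by apply: (scalar_energy_growth hmu lam_gt0 fsol a0 ab K0 kK); rewrite at_.
Qed.

Lemma mode_decay C alpha a T : decay_constants dot A Ah mu C alpha ->
  0 <= a -> 0 < T -> (forall r, a <= r < a + T -> k r = 0) ->
  forall t, 0 <= t <= T ->
    mode_part lam e (a + t) <= C * expR (- alpha * t) * mode_part lam e a.
Proof.
move=> [_ _ dec] a0 T0 kT.
have [f [fsol f0 fae fcont]] :=
  mode_scalar_solution hdot hmu Ahlin Ahsa lam_gt0 dome Ahe norme sol.
have [p [y [hp cy yP pos vel]]] := scalar_extension hmu lam_gt0 fsol fcont a0 T0 kT.
have S := extension_solution A hmu Ahlin Ahsa lam_gt0 dome Ahe norme hp cy yP.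
(* The memory parts agree too, since [pos] holds at all times up to [T], negative ones included. *)
have Een t : 0 <= t <= T ->
    energy Ah mu (fun t => (p t + twice_primitive (f a) (dot (v a) e) y t) *: e)
      (fun t => (dot (v a) e + primitive y t) *: e) t = mode_part lam e (a + t).
  move=> /andP[t0 tT]; have at0 : 0 <= a + t by rewrite addr_ge0.
  rewrite (mode_energy Ahlin lam_gt0 dome Ahe norme (F :=
    fun t => p t + twice_primitive (f a) (dot (v a) e) y t)
    (fun t => dot (v a) e + primitive y t)); last first.
    exact: extension_integrable.
  rewrite -(mode_part_eq at0 (f0 _ at0) (fae _ at0)) /scalar_energy.
  rewrite (pos t tT) vel ?t0//; congr (_ + _ * _).
  rewrite /memory_energy; apply: eq_Rintegral => s; rewrite inE/= in_itv/= andbT => s0.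
  rewrite (pos t tT) pos ?addrA//.
  by rewrite (le_trans _ tT)// gerBl ltW.
move=> t tT; have /andP[t0 _] := tT.
rewrite -(Een t tT) -[X in mode_part lam e X](addr0 a) -Een ?lexx ?(ltW T0)//.
exact: (dec _ _ _ _ S).
Qed.

End unit_mode.

Section eigenbasis.
Variables (e_ : nat -> H) (l_ : nat -> R).
Hypothesis l_gt0 : forall n, 0 < l_ n.
Hypothesis eP : forall n, dom Ah (e_ n) /\ Ah (e_ n) = Num.sqrt (l_ n) *: e_ n.
Hypothesis e01 : forall n, e_ n = 0 \/ `|e_ n| = 1.
Hypothesis parseval : forall x, series (fun j => dot x (e_ j) ^+ 2) @ \oo --> `|x| ^+ 2.

Let dot_le_norm (x : H) n : dot x (e_ n) ^+ 2 <= `|x| ^+ 2.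
Proof.
have [->|en] := e01 n; first by rewrite dot0r expr0n sqr_ge0.
exact: dot_sqr_le.
Qed.

Let dot_Ah n (w : H) : dom Ah w -> dot (Ah w) (e_ n) ^+ 2 = l_ n * dot w (e_ n) ^+ 2.
Proof.
move=> dw; have [de Ae] := eP n.
by rewrite (dot_eigenvector Ahsa de Ae dw) exprMn sqr_sqrtr// ltW.
Qed.

Lemma memory_series t : 0 <= t ->
  series (fun j => l_ j * memory_energy mu (fun t => dot (u t) (e_ j)) t) @ \oo -->
  wint mu (fun s => `|Ah (eta u t s)| ^+ 2).
Proof.
move=> t0; have Lt := solution_L2mu sol t0; have [dt st _] := Lt.
have [D [mD sD aD dD hD]] := mu_regular hmu dt st.
have mmu := kernel_measurable hmu.
pose h j s := dot (Ah (eta u t s)) (e_ j) ^+ 2.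
(* After truncation to [D], measurability, monotonicity of the partial sums and Parseval's identity
   hold at every [s]. *)
pose hD_ j := h j \_ D; pose W := (fun s => `|Ah (eta u t s)| ^+ 2) \_ D.
have mh j : measurable_fun setT (hD_ j).
  apply/(measurable_restrictT _ mD); apply: (hD (fun x => dot x (e_ j) ^+ 2)).
  by move=> x; apply: cvgM; exact: (dot_continuousl hdot).
have hD0 j s : 0 <= hD_ j s by rewrite /hD_ patchE; case: ifP => // _; exact: sqr_ge0.
have ih j : wintegrable mu (hD_ j).
  apply: (L2mu_wintegrable hmu Lt); first exact: measurable_funTS.
  apply: mu_aeW aD => s _ _ Ds; rewrite /hD_ patchT ?inE//.
  by rewrite ger0_norm ?sqr_ge0// /h dot_le_norm.
have mW : measurable_fun setT W.
  by apply/(measurable_restrictT _ mD); apply: (hD (fun x => `|x| ^+ 2)); exact: sqr_norm_continuous.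
have iW : wintegrable mu W.
  apply: (L2mu_wintegrable hmu Lt); first exact: measurable_funTS.
  apply: mu_aeW aD => s _ _ Ds; rewrite /W patchT ?inE//.
  by rewrite ger0_norm ?sqr_ge0.
have -> : wint mu (fun s => `|Ah (eta u t s)| ^+ 2) = wint mu W.
  by apply: (mu_ae_wint hmu); apply: mu_aeW aD => s _ _ Ds; rewrite /W patchT ?inE.
have Ej : (fun j => l_ j * memory_energy mu (fun t => dot (u t) (e_ j)) t) =
    (fun j => wint mu (hD_ j)).
  apply/funext => j.
  have -> : memory_energy mu (fun t => dot (u t) (e_ j)) t =
      wint mu (fun s => (l_ j)^-1 * hD_ j s).
    apply: (mu_ae_wint hmu); apply: mu_aeW aD => s _ _ Ds.
    rewrite /hD_ patchT ?inE// /h dot_Ah; last exact: dD.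
    by rewrite mulKf ?gt_eqF// /eta dotBl.
  by rewrite wintZ// mulVKf// gt_eqF.
have iS n : wintegrable mu (fun s => series (fun j => hD_ j s) n).
  elim: n => [|n IH].
    have -> : (fun s => series (fun j => hD_ j s) 0) = fun=> 0.
      by apply/funext => s; rewrite /series/= big_geq.
    exact: wintegrable_cst.
  have -> : (fun s => series (fun j => hD_ j s) n.+1) =
      (fun s => series (fun j => hD_ j s) n + hD_ n s).
    by apply/funext => s; rewrite seriesSr.
  exact: wintegrableD.
have ES n : series (fun j => wint mu (hD_ j)) n =
    wint mu (fun s => series (fun j => hD_ j s) n).
  elim: n => [|n IH].
    have -> : (fun s => series (fun j => hD_ j s) 0) = fun=> 0.
      by apply/funext => s; rewrite /series/= big_geq.
    by rewrite wint_cst// mulr0 /series/= big_geq.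
  have -> : (fun s => series (fun j => hD_ j s) n.+1) =
      (fun s => series (fun j => hD_ j s) n + hD_ n s).
    by apply/funext => s; rewrite seriesSr.
  by rewrite seriesSr IH wintD.
rewrite Ej (_ : series _ = fun n => wint mu (fun s => series (fun j => hD_ j s) n)); last first.
  by apply/funext => n; exact: ES.
rewrite /wint /Rintegral; apply: fine_cvg; rewrite fineK; last exact: (integrable_fin_num _ iW).
have mS n : measurable_fun halfline
    (fun s => (mu s * series (fun j => hD_ j s) n)%:E) by exact: measurable_int (iS n).
have lim s : (fun n => (mu s * series (fun j => hD_ j s) n)%:E) @ \oo -->
    (mu s * W s)%:E.
  apply: cvg_EFin; first exact: nearW.
  apply: cvgM; first exact: cvg_cst.
  rewrite /W /hD_ patchE; case: ifPn => sDn.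
    rewrite (_ : (fun j => _) = (fun j => dot (Ah (eta u t s)) (e_ j) ^+ 2)).
      exact: parseval.
    by apply/funext => j; rewrite patchE sDn.
  rewrite (_ : series _ = fun=> 0); first exact: cvg_cst.
  apply/funext => n; rewrite /series/= big1// => j _.
  by rewrite patchE (negbTE sDn).
have -> : (\int[leb]_(s in halfline) (mu s * W s)%:E = \int[leb]_(s in halfline)
    limn (fun n => (mu s * series (fun j => hD_ j s) n)%:E))%E.
  by apply: eq_integral => s _; apply/esym/cvg_lim.
apply: cvg_monotone_convergence => //.
- move=> n s; rewrite /= in_itv/= andbT => s0; rewrite lee_fin mulr_ge0//.
    by rewrite (kernel_ge0 hmu)// ltW.
  by rewrite /series/= sumr_ge0.
- move=> s; rewrite /= in_itv/= andbT => s0 n m nm; rewrite lee_fin ler_wpM2l//.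
    by rewrite (kernel_ge0 hmu)// ltW.
  by apply: nondecreasing_series.
Qed.

Lemma energy_series t : 0 <= t ->
  series (fun j => mode_part (l_ j) (e_ j) t) @ \oo --> energy Ah mu u v t.
Proof.
move=> t0; have dt := solution_dom sol t0.
have -> : series (fun j => mode_part (l_ j) (e_ j) t) = (fun n =>
    2^-1 * series (fun j => dot (v t) (e_ j) ^+ 2) n +
    (1 - kernel_mass mu) / 2 * series (fun j => dot (Ah (u t)) (e_ j) ^+ 2) n +
    2^-1 * series (fun j => l_ j * memory_energy mu (fun t => dot (u t) (e_ j)) t) n).
  apply/funext => n; elim: n => [|n IH].
    by rewrite /series/= !big_geq// !mulr0 !addr0.
  rewrite !seriesSr IH /mode_part /scalar_energy dot_Ah//.
  move: (memory_energy _ _ _) (dot (v t) (e_ n)) (dot (u t) (e_ n)) => x1 x2 x3.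
  have alg (S1 S2 S3 m l : R) :
      2^-1 * S1 + (1 - m) / 2 * S2 + 2^-1 * S3 +
      (2^-1 * x2 ^+ 2 + (1 - m) / 2 * l * x3 ^+ 2 + l / 2 * x1) =
      2^-1 * (S1 + x2 ^+ 2) + (1 - m) / 2 * (S2 + l * x3 ^+ 2) + 2^-1 * (S3 + l * x1).
    by ring.
  exact: alg.
apply: cvgD.
  apply: cvgD.
    by apply: cvgM; [exact: cvg_cst|exact: parseval].
  by apply: cvgM; [exact: cvg_cst|exact: parseval].
by apply: cvgM; [exact: cvg_cst|exact: memory_series].
Qed.

End eigenbasis.
End modes.

(** * Summation over the modes and passage through the successive intervals *)

Lemma series_limit_le (R : realType) (f g : nat -> R) (a b c : R) :
  (forall j, f j <= c * g j) -> series f @ \oo --> a -> series g @ \oo --> b ->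
  a <= c * b.
Proof.
move=> fg fa gb; have cgb : (fun n => c * series g n) @ \oo --> c * b.
  by apply: cvgM; [exact: cvg_cst|exact: gb].
apply: (ler_cvg_to fa cgb); apply: nearW => n.
by rewrite /series/= mulr_sumr; apply: ler_sum.
Qed.

Lemma monotone_bracket (R : realType) (s : nat -> R) (N m : nat) (t : R) :
  s N <= t -> t < s (N + m)%N -> exists2 n, (N <= n)%N & s n <= t < s n.+1.
Proof.
elim: m => [|m IH] sN; first by rewrite addn0 ltNge sN.
rewrite addnS => tm; have [|mt] := ltP t (s (N + m)%N); first exact: IH.
by exists (N + m)%N; [exact: leq_addr|rewrite mt tm].
Qed.

Theorem theorem3p15 (R : realType) (H : completeNormedModType R)
    (dot : {dot H for idfun}) (hdot : induces_norm dot)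
    (A Ah : operator H)
    (hAlin : linear_operator A) (hAsa : self_adjoint dot A)
    (hApos : positive_operator dot A) (hAinv : compact_inverse A)
    (hAh : is_sqrt_operator dot Ah A)
    (mu : R -> R) (hmu : admissible_kernel mu)
    (t_ kb : nat -> R) (k : R -> R)
    (hkloc : Linfty_loc k) (hk : on_off t_ kb k)
    (C alpha : R) (hdecay : decay_constants dot A Ah mu C alpha)
    (T c : nat -> R)
    (hT : forall n, T n = t_ n.+1 - t_ n)
    (hTC : forall n, alpha^-1 * ln C < T n.*2)
    (hc : forall n, c n = C * expR (- alpha * T n.*2))
    (hsum : series (fun n : nat =>
              ln (expR (2 * kb n.*2.+1 * T n.*2.+1) * c n)) @ \oo --> -oo) :
  asymptotically_stable dot A Ah mu k.
Proof.
move=> u0 u1 u v sol.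
have [C1 alpha0 _] := hdecay.
have [Ahlin Ahsa _ _ _] := hAh.
have [e_ [l_ [l_gt0 Ae e01 pars]]] := eigenbasis hdot hAlin hAsa hApos hAinv.
have eP n : dom Ah (e_ n) /\ Ah (e_ n) = Num.sqrt (l_ n) *: e_ n.
  by have [de Aen] := Ae n; exact: (sqrt_eigenvector hdot hAh (l_gt0 n) de Aen).
pose E := energy Ah mu u v.
have Eseries t : 0 <= t -> series (fun j => mode_part dot mu u v (l_ j) (e_ j) t) @ \oo --> E t.
  by move=> t0; exact: (energy_series hdot hmu Ahsa sol l_gt0 eP e01 pars).
have E0 t : 0 <= E t.
  have m1 : 0 <= 1 - kernel_mass mu by rewrite subr_ge0 mass_le1.
  rewrite /E /energy; apply: addr_ge0.
    by apply: addr_ge0; rewrite mulr_ge0 ?sqr_ge0// divr_ge0.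
  by rewrite mulr_ge0//; apply: wint_ge0 => // s _; exact: sqr_ge0.
have C0 : 0 < C by rewrite (lt_trans ltr01).
have T_gt0 n : 0 < T n by rewrite hT subr_gt0; exact: on_off_incr hk n.
have tS n : t_ n + T n = t_ n.+1 by rewrite hT subrKC.
have t_ge0 n : 0 <= t_ n.
  by elim: n => [|n IH]; rewrite ?(on_off_t0 hk)// -tS addr_ge0// ltW.
have t_gt0 n : 0 < t_ n.+1 by rewrite -tS ltr_wpDl.
have even n s : 0 <= s <= T n.*2 -> E (t_ n.*2 + s) <= C * expR (- alpha * s) * E (t_ n.*2).
  move=> sT; have /andP[s0 _] := sT.
  apply: (series_limit_le _ (Eseries _ (addr_ge0 (t_ge0 _) s0)) (Eseries _ (t_ge0 _))).
  move=> j; have [-> |ej] := e01 j; first by rewrite !mode_part0// mulr0.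
  have [de Aej] := eP j.
  apply: (mode_decay hdot hmu Ahlin Ahsa sol (l_gt0 j) de Aej ej hdecay _ (T_gt0 n.*2)) => //.
  by move=> r; rewrite tS; exact: on_off_even hk n r.
have odd n s : t_ n.*2.+1 <= s <= t_ n.*2.+2 ->
    E s <= expR (2 * kb n.*2.+1 * (s - t_ n.*2.+1)) * E (t_ n.*2.+1).
  move=> st; have /andP[ts _] := st; have s0 : 0 <= s := le_trans (t_ge0 _) ts.
  apply: (series_limit_le _ (Eseries _ s0) (Eseries _ (t_ge0 _))).
  move=> j; have [-> |ej] := e01 j; first by rewrite !mode_part0// mulr0.
  have [de Aej] := eP j.
  apply: (mode_growth hdot hmu Ahlin Ahsa sol (l_gt0 j) de Aej ej (t_gt0 _) _ _ _ st).
  - exact/ltW/(on_off_incr hk).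
  - exact/ltW/(on_off_bound_gt0 hk).
  - by move=> r /(on_off_odd hk)/ltW.
pose x n := ln (expR (2 * kb n.*2.+1 * T n.*2.+1) * c n).
have c_gt0 n : 0 < c n by rewrite hc mulr_gt0// expR_gt0.
have expx n : expR (x n) = expR (2 * kb n.*2.+1 * T n.*2.+1) * c n.
  by rewrite lnK// posrE mulr_gt0// expR_gt0.
have mid n : E (t_ n.*2.+1) <= c n * E (t_ n.*2).
  by rewrite hc -tS; apply: even; rewrite lexx ltW.
(* The growth exponent is largest at the end of the interval, so one factor [exp (x n)] serves for
   all its points. *)
have oddE n s : t_ n.*2.+1 <= s <= t_ n.*2.+2 -> E s <= expR (x n) * E (t_ n.*2).
  move=> st; have /andP[ts st2] := st; apply: (le_trans (odd n s st)).
  rewrite expx -[leRHS]mulrA; apply: ler_pM; [exact: expR_ge0|exact: E0| |exact: mid].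
  rewrite ler_expR; apply: ler_wpM2l; last by rewrite hT lerD2r.
  by rewrite mulr_ge0// ltW// (on_off_bound_gt0 hk).
have bound n : E (t_ n.*2) <= expR (series x n) * E (t_ 0).
  elim: n => [|n IH]; first by rewrite /series/= big_geq// expR0 mul1r.
  have h : E (t_ n.*2.+2) <= expR (x n) * E (t_ n.*2).
    by apply: oddE; rewrite lexx andbT ltW// (on_off_incr hk).
  rewrite doubleS (le_trans h)// seriesSr expRD [expR (series x n) * _]mulrC -mulrA.
  by rewrite ler_wpM2l// expR_ge0.
(* The sum of a bound for the even interval, where the decay estimate may first lose a factor [C],
   and one for the odd interval. *)
have all_t n s : t_ n.*2 <= s <= t_ n.*2.+2 ->
    E s <= C * (expR (series x n) * E (t_ 0)) + expR (series x n.+1) * E (t_ 0).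
  move=> /andP[ns sn]; have [sm|ms] := leP s (t_ n.*2.+1).
    rewrite ler_wpDr ?mulr_ge0 ?expR_ge0//.
    have sT : 0 <= s - t_ n.*2 <= T n.*2 by rewrite subr_ge0 ns lerBlDl tS.
    have := even n _ sT; rewrite subrKC => /le_trans; apply.
    rewrite ler_pM ?mulr_ge0 ?expR_ge0 ?(ltW C0)//.
    rewrite ler_piMr ?(ltW C0)// -expR0 ler_expR mulNr oppr_le0 mulr_ge0 ?(ltW alpha0)//.
    by case/andP: sT.
  rewrite ler_wpDl ?mulr_ge0 ?expR_ge0 ?(ltW C0)//.
  have smn : t_ n.*2.+1 <= s <= t_ n.*2.+2 by rewrite (ltW ms) sn.
  rewrite (le_trans (oddE n s smn))// seriesSr expRD [expR (series x n) * _]mulrC -mulrA.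
  by rewrite ler_wpM2l ?expR_ge0.
apply/(@cvgrPdist_lt R R^o) => eps eps0.
(* The threshold for the partial sums: [C + 1] collects the two terms of [all_t], and the 1 added to
   [E (t_ 0)] avoids a zero denominator and makes the final inequality strict. *)
pose M := ln (eps / ((C + 1) * (E (t_ 0) + 1))).
have Cp1 : 0 < C + 1 by rewrite addr_gt0.
have Ep1 : 0 < E (t_ 0) + 1 by rewrite ltr_wpDl.
have D0 : 0 < (C + 1) * (E (t_ 0) + 1) by rewrite mulr_gt0.
have [N _ hN] := (cvgrNyPle _).1 hsum M.
exists (t_ N.*2); split; first exact: num_real.
move=> t /ltW Nt; rewrite /= sub0r normrN ger0_norm ?E0//.
have d0 : 0 < alpha^-1 * ln C by rewrite mulr_gt0 ?invr_gt0// ln_gt0.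
(* Each even interval is longer than the fixed positive length [ln C / alpha], so the switching
   times are unbounded and every late time falls into some period. *)
have grow m : m%:R * (alpha^-1 * ln C) <= t_ m.*2.
  elim: m => [|m IH]; first by rewrite mul0r.
  rewrite doubleS -(tS m.*2.+1) -(tS m.*2) -natr1 mulrDl mul1r -addrA lerD//.
  by rewrite ler_wpDr// ltW.
have [m hm] : exists m, t < t_ (N + m).*2.
  pose m := Num.truncn (t / (alpha^-1 * ln C)).
  exists m.+1; apply: (@lt_le_trans _ _ (m.+1%:R * (alpha^-1 * ln C))).
    by rewrite -ltr_pdivrMr// real_truncnS_gt ?num_real.
  apply: le_trans (grow (N + m.+1)%N); rewrite ler_pM2r// ler_nat.
  exact: leq_addl.
have [n Nn /andP[nt tn]] := monotone_bracket (s := fun n => t_ n.*2) Nt hm.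
have tnn : t_ n.*2 <= t <= t_ n.*2.+2 by rewrite nt ltW// -doubleS.
apply: (le_lt_trans (all_t n t tnn)).
have sM i : (N <= i)%N -> expR (series x i) <= eps / ((C + 1) * (E (t_ 0) + 1)).
  move=> Ni; rewrite -[leRHS]lnK ?posrE ?divr_gt0// ler_expR.
  exact: hN.
have s1 := sM n Nn; have s2 := sM n.+1 (leqW Nn).
apply: (@le_lt_trans _ _ ((C + 1) * (eps / ((C + 1) * (E (t_ 0) + 1)) * E (t_ 0)))).
  rewrite mulrDl mul1r; apply: lerD; last by rewrite ler_wpM2r.
  by rewrite ler_pM2l// ler_wpM2r.
have -> : (C + 1) * (eps / ((C + 1) * (E (t_ 0) + 1)) * E (t_ 0)) =
    eps * (E (t_ 0) / (E (t_ 0) + 1)).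
  by field; rewrite !gt_eqF.
by rewrite -[ltRHS]mulr1 ltr_pM2l// ltr_pdivrMr// mul1r ltrDl.
Qed.
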